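(* Let $[p_1,\dots,p_9,q]\in\mathbb{X}_{3,10}$ be a generic configuration of $10$ points of $\mathbb{P}^2(\mathbb{C})$ in general position, and let $C_0$ and $C$ be smooth cubic curves with $p_1,\dots,p_8,p_9\in C_0$ and $p_1,\dots,p_8,q\in C$. Then $$[p_1,\dots,p_9,q].T_{89}=[p_1,\dots,p_7,\bar p_8,\bar p_9,\bar q],$$ where $\bar p_8,\bar p_9\in C_0$ and $\bar q\in C$ are determined by: (1) the nine points $p_1,\dots,p_8,\bar p_9\in C_0$ are the base points of a pencil of cubic curves; (2) $\bar p_8+\bar p_9=p_8+p_9$ under the addition of $C_0$; (3) $\bar p_9+\bar q=p_8+q$ under the addition of $C$. In particular, $\bar p_9$ is the ninth point of the intersection $C_0\cap C$.
   Context: $\mathbb{X}_{3,10}$ is the space of $10$-tuples of points of $\mathbb{P}^2(\mathbb{C})$ in general position (distinct, no three collinear) modulo the diagonal $PGL_3(\mathbb{C})$-action. The Weyl group $W_{3,10}=\langle s_0,\dots,s_9\rangle$ acts birationally on the right on $\mathbb{X}_{3,10}$ ($[P].(ab)=([P].a).b$): $s_k$ ($1\le k\le9$) swaps the $k$-th and $(k+1)$-th points; for distinct $i,j,k$, $s_{ijk}$ is the standard Cremona transformation with respect to the $i$-th, $j$-th, $k$-th points: in homogeneous coordinates where these are the coordinate points, it fixes them and replaces every other point $(x_1:x_2:x_3)$ by $(x_1^{-1}:x_2^{-1}:x_3^{-1})$ (with $s_0=s_{123}$); $s_{89}$ swaps the 8th and 9th points. Define $T_{89}=s_{128}s_{348}s_{567}s_{348}s_{128}s_{89}$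 (an element of $\langle s_0,\dots,s_8\rangle\cong W(E_8^{(1)})$, the translation by the root $\varepsilon_8-\varepsilon_9$). For points $p,q,p',q'$ on a smooth cubic $D$, ''$p+q=p'+q'$ under the addition of $D$'' means that the third intersection point of $D$ with the line through $p,q$ coincides with the third intersection point of $D$ with the line through $p',q'$. *)

(* Defs.v *)
(* points of P^2(C) as nonzero row vectors in C^3 = 'rV[CC]_3,
   with C realised as the complex numbers over Stdlib's reals (Rstruct). *)
From mathcomp Require Import all_boot all_order all_algebra all_fingroup.
From mathcomp Require Import Rstruct complex.
From mathcomp Require Import mpoly.

Set Implicit Arguments.
Unset Strict Implicit.
Unset Printing Implicit Defensive.

Import GRing.Theory.
Local Open Scope ring_scope.

Definition CC : closedFieldType := (Rdefinitions.R)[i].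

Definition vec3 := 'rV[CC]_3.

Definition proj_eq (x y : vec3) : Prop :=
  x != 0 /\ exists c : CC, c != 0 /\ y = c *: x.

(* An ordered 10-tuple of (representatives of) points of P^2(C);
   index 0..8 are p_1..p_9 (the paper's 1-based indices minus one),
   index 9 is the tenth point q. *)
Definition config := 'I_10 -> vec3.

Definition o10 (k : nat) : 'I_10 := inord k.

Definition rows3 (P : config) (i j k : 'I_10) : 'M[CC]_3 :=
  \matrix_(r < 3, c < 3)
    (P (if r == 0 :> nat then i else if r == 1 :> nat then j else k)) 0 c.

(* General position: for any three distinct indices the three points are
   linearly independent (this gives: nonzero, pairwise distinct, and no
   three collinear). *)
Definition general_position (P : config) : Prop :=
  forall i j k : 'I_10, i != j -> j != k -> i != k ->
    \det (rows3 P i j k) != 0.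

(* Equality in X_{3,10} = configurations modulo the diagonal PGL_3 action
   (and rescaling of representatives). *)
Definition X_eq (P Q : config) : Prop :=
  exists M : 'M[CC]_3, M \in unitmx /\ forall l, proj_eq (P l *m M) (Q l).

Definition e3 (r : nat) : vec3 := delta_mx 0 (inord r).

(* Standard Cremona transformation s_{ijk} on representatives: choose the
   homogeneous coordinates in which the points i, j, k are the coordinate
   points (change of coordinates x |-> x *m (rows3 P i j k)^-1); then the
   points i,j,k are fixed and every other point (x1:x2:x3) is replaced by
   (x1^-1 : x2^-1 : x3^-1). *)
Definition cremona (i j k : 'I_10) (P : config) : config :=
  fun l =>
    if l == i then e3 0 else if l == j then e3 1 else if l == k then e3 2
    else \row_(c < 3) ((P l *m invmx (rows3 P i j k)) 0 c)^-1.

Definition swap (a b : 'I_10) (P : config) : config :=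
  fun l => P (tperm a b l).

(* The right action: [P].(s_128 s_348 s_567 s_348 s_128 s_89)
   = (((((([P].s_128).s_348).s_567).s_348).s_128).s_89). *)
Definition T89 (P : config) : config :=
  swap (o10 7) (o10 8)
    (cremona (o10 0) (o10 1) (o10 7)
      (cremona (o10 2) (o10 3) (o10 7)
        (cremona (o10 4) (o10 5) (o10 6)
          (cremona (o10 2) (o10 3) (o10 7)
            (cremona (o10 0) (o10 1) (o10 7) P))))).

Definition tform := {mpoly CC[3]}.
Definition ev (f : tform) (x : vec3) : CC := f.@[fun c => x 0 c].
Definition on_curve (f : tform) (x : vec3) : Prop := x != 0 /\ ev f x = 0.

Definition is_cubic (f : tform) : Prop := f != 0 /\ f \is 3.-homog.

Definition smooth_cubic (f : tform) : Prop :=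
  is_cubic f /\
  forall x : vec3, x != 0 -> ev f x = 0 ->
    exists c : 'I_3, ev (f^`M(c)) x != 0.

Definition pencil_base_points (pts : 'I_9 -> vec3) : Prop :=
  exists F G : tform, is_cubic F /\ is_cubic G /\
    (forall a b : CC, a *: F + b *: G = 0 -> a = 0 /\ b = 0) /\
    forall x : vec3, x != 0 ->
      (ev F x = 0 /\ ev G x = 0 <-> exists l : 'I_9, proj_eq (pts l) x).

(* r is the third intersection point of the cubic D with the line through
   the (distinct) points p, q of D: restricted to the line s p + t q the
   cubic tform is c s t (b s - a t) with c <> 0 and r = a p + b q. *)
Definition third_point (D : tform) (p q r : vec3) : Prop :=
  exists a b c : CC, c != 0 /\ proj_eq (a *: p + b *: q) r /\
    forall s t : CC, ev D (s *: p + t *: q) = c * s * t * (b * s - a * t).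

(* p + q = p' + q' under the addition of D. *)
Definition add_eq (D : tform) (p q p' q' : vec3) : Prop :=
  exists r : vec3, third_point D p q r /\ third_point D p' q' r.

Definition flat (P : config) : 'I_30 -> CC :=
  fun k => P (inord (k %/ 3)) 0 (inord (k %% 3)).

Definition replace3 (P : config) (pb8 pb9 qb : vec3) : config :=
  fun l => if l == o10 7 then pb8 else if l == o10 8 then pb9
           else if l == o10 9 then qb else P l.

Definition nine (P : config) (x : vec3) : 'I_9 -> vec3 :=
  fun l => if (l : nat) == 8 then x else P (inord l).

Definition bar_conditions (P : config) (C0 C : tform) (pb8 pb9 qb : vec3) :
  Prop :=
  on_curve C0 pb8 /\ on_curve C0 pb9 /\ on_curve C qb /\
  pencil_base_points (nine P pb9) /\
  add_eq C0 pb8 pb9 (P (o10 7)) (P (o10 8)) /\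
  add_eq C pb9 qb (P (o10 7)) (P (o10 9)).

(* Main.v *)
(* Let p be the eighth point and b the ninth base point of the cubics through p_1, ..., p_8.  For x on
   a cubic of this pencil let y be the third point of the line px; the line by then meets the same
   cubic again at the point x' which corresponds to x in the barred configuration.  In the frame
   given by the images of p_5, p_6, p_7 under s_128 followed by s_348, the image of x has, up to
   factors that do not depend on x, the coordinates [y p_r b] / [y p_r p] for r = 5, 6, 7, where
   [u v w] is the determinant.
   Exchanging p and b exchanges x and x' and keeps y, so the images of the two configurations are
   inverse to each other coordinate by coordinate: they are related by s_567, and undoing the first
   two Cremona transformations on the barred side gives T_89.
   The point b and every nondegeneracy condition are given by formulas over an arbitrary ring, so
   genericity is the nonvanishing of one polynomial with integer coefficients, which is nonzero
   because it does not vanish at some configuration modulo 31. *)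

Require Import Defs.
From mathcomp Require Import all_boot all_order all_algebra all_fingroup.
From mathcomp Require Import Rstruct complex.
From mathcomp Require Import mpoly.
From mathcomp Require Import ring.
From Stdlib Require Import FunctionalExtensionality.
Import GRing.Theory.
Local Open Scope ring_scope.

Set Implicit Arguments.
Unset Strict Implicit.
Unset Printing Implicit Defensive.

(** * Binary forms *)

(** The coordinate formula rests on a net of cubics. The composite of s_128 and s_348 is given by
    the cubics that are double at p and pass through p_1, ..., p_4. As a function of x, the bracket
    [y p_r b] has degree 5. It vanishes on the lines pb and p p_r, since there y is b or p_r, and at
    the base points, since there the formula for y gives the zero vector. The residual cubic is
    double at p and passes through p_1, ..., p_4, so it is a line of the image plane. It also
    vanishes at the two points among p_5, p_6, p_7 other than p_r, so this line is a coordinate line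
    of the frame. The bracket [y p_r p] is the equation of the line p p_r times a factor independent
    of r, and this equation cancels in the quotient. The obstacle is that the points of index 1, 2,
    3, 4, 8 of the image are not values of this map: they come from contracted curves, namely lines
    through p for the first four and a conic for the eighth. They are reached through auxiliary
    points p_i + p, for which y is p_i. *)

Section BinaryForms.
Variable K : fieldType.
Implicit Types (f g h : K -> K -> K).

(** Forms are functions with a derivation of their degree, not polynomials. Divisibility by a linear
    form then follows by induction on the derivation over every field, including the finite field of
    the sample configuration, where values do not determine a polynomial. *)
Inductive bform : nat -> (K -> K -> K) -> Prop :=
| bform_const c f : (forall x y, f x y = c) -> bform 0 f
| bform_step n g h f : bform n g -> bform n h ->
    (forall x y, f x y = x * g x y + y * h x y) -> bform n.+1 f.

Lemma bform_ext n f g : bform n f -> (forall x y, g x y = f x y) -> bform n g.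
Proof.
case=> [c f' Hf|m g' h' f' Hg Hh Hf] E; first by apply: (bform_const (c := c)) => x y; rewrite E.
by apply: (bform_step Hg Hh) => x y; rewrite E.
Qed.

Lemma bform0_inv f : bform 0 f -> exists c, forall x y, f x y = c.
Proof. by move E: 0%N => n H; case: H E => // c f' Hf _; exists c. Qed.

Lemma bformS_inv n f : bform n.+1 f ->
  exists g h, [/\ bform n g, bform n h & forall x y, f x y = x * g x y + y * h x y].
Proof.
by move E: n.+1 => m H; case: H E => // k g h f' Hg Hh Hf [->]; exists g, h.
Qed.

Lemma bform1_inv f : bform 1 f -> exists a b, forall x y, f x y = x * a + y * b.
Proof.
case/bformS_inv=> g [h] [/bform0_inv [a Ha] /bform0_inv [b Hb] E].
by exists a, b => x y; rewrite E Ha Hb.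
Qed.

Lemma bform_lin a b : bform 1 (fun x y => a * x + b * y).
Proof.
apply: (@bform_step 0 (fun _ _ => a) (fun _ _ => b)); try exact: (bform_const (fun _ _ => erefl)).
by move=> x y; ring.
Qed.

Lemma bform_add n f g : bform n f -> bform n g -> bform n (fun x y => f x y + g x y).
Proof.
elim: n f g => [|n IH] f g.
  case/bform0_inv=> a Ha /bform0_inv [b Hb].
  by apply: (bform_const (c := a + b)) => x y; rewrite Ha Hb.
case/bformS_inv=> f1 [f2] [H1 H2 E] /bformS_inv [g1] [g2] [H3 H4 E'].
by apply: (bform_step (IH _ _ H1 H3) (IH _ _ H2 H4)) => x y; rewrite E E'; ring.
Qed.

Lemma bform_scale n f (k : K) : bform n f -> bform n (fun x y => k * f x y).
Proof.
elim: n f => [|n IH] f.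
  by case/bform0_inv=> a Ha; apply: (bform_const (c := k * a)) => x y; rewrite Ha.
case/bformS_inv=> f1 [f2] [H1 H2 E].
by apply: (bform_step (IH _ H1) (IH _ H2)) => x y; rewrite E; ring.
Qed.

Lemma bform_sub n f g : bform n f -> bform n g -> bform n (fun x y => f x y - g x y).
Proof.
move=> Hf Hg; apply: (bform_ext (bform_add Hf (bform_scale (-1) Hg))) => x y; ring.
Qed.

Lemma bform_mul n m f g : bform n f -> bform m g -> bform (n + m) (fun x y => f x y * g x y).
Proof.
elim: n f => [|n IH] f.
  case/bform0_inv=> a Ha Hg.
  by apply: (bform_ext (bform_scale a Hg)) => x y; rewrite Ha.
case/bformS_inv=> f1 [f2] [H1 H2 E] Hg; rewrite addSn.
by apply: (bform_step (IH _ H1 Hg) (IH _ H2 Hg)) => x y; rewrite E; ring.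
Qed.

Lemma bform_swap n f : bform n f -> bform n (fun x y => f y x).
Proof.
elim: n f => [|n IH] f.
  by case/bform0_inv=> a Ha; apply: (bform_const (c := a)) => x y; rewrite Ha.
case/bformS_inv=> f1 [f2] [H1 H2 E].
by apply: (bform_step (IH _ H2) (IH _ H1)) => x y; rewrite E; ring.
Qed.

(** Division with respect to x: as [b != 0], the divisor has an invertible leading coefficient, so
    the remainder is a multiple of the pure power of y. Evaluation at (a, b) gives its
    coefficient. *)
Lemma bform_rem n f (a b : K) : b != 0 -> bform n.+1 f ->
  exists2 d, bform n d &
    forall x y, f x y = (b * x - a * y) * d x y + y ^+ n.+1 * (f a b / b ^+ n.+1).
Proof.
move=> b0; elim: n f => [|n IH] f.
  case/bform1_inv=> u [v E]; exists (fun _ _ => u / b).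
    exact: (bform_const (fun _ _ => erefl)).
  by move=> x y; rewrite !E; field.
case/bformS_inv=> g [h] [/IH [d1 D1 E1] /IH [d2 D2 E2] E].
have Hy : bform n.+1 (fun x y => y ^+ n.+1 * (g a b / b ^+ n.+2)).
  elim: (n.+1) (g a b / b ^+ n.+2) => [|k IHk] c.
    by apply: (bform_const (c := c)) => x y; rewrite expr0 mul1r.
  apply: (bform_step (bform_scale 0 (IHk c)) (IHk c)) => x y.
  by rewrite exprS; ring.
exists (fun x y => (x * d1 x y + y * d2 x y) + y ^+ n.+1 * (g a b / b ^+ n.+2)).
  by apply: bform_add => //; apply: (bform_step D1 D2).
move=> x y; rewrite E E1 E2 E.
have -> : b ^+ n.+2 = b * b ^+ n.+1 by rewrite exprS.
have -> : y ^+ n.+2 = y * y ^+ n.+1 by rewrite exprS.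
have bn0 : b ^+ n.+1 != 0 by rewrite expf_neq0.
by field; rewrite b0 bn0.
Qed.

Lemma bform_div n f (a b : K) : (a != 0) || (b != 0) -> bform n.+1 f -> f a b = 0 ->
  exists2 d, bform n d & forall x y, f x y = (b * x - a * y) * d x y.
Proof.
(* For [b = 0] the divisor is a multiple of y, and the two variables are exchanged. *)
move=> ab Hf fab; case: (eqVneq b 0) => [b0|b0].
  have a0 : a != 0 by move: ab; rewrite b0 eqxx orbF.
  have [d Hd E] := bform_rem b a0 (bform_swap Hf).
  exists (fun x y => - d y x).
    by apply: (bform_ext (bform_scale (-1) (bform_swap Hd))) => x y; ring.
  by move=> x y; rewrite E fab; ring.
have [d Hd E] := bform_rem a b0 Hf.
by exists d => // x y; rewrite E fab; ring.
Qed.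

(* The roots are given with homogeneous coordinates, pairwise non proportional. *)
Lemma bform_div_roots k n f (r : nat -> K * K) : bform (k + n) f ->
  (forall i, (i < k)%N -> f (r i).1 (r i).2 = 0) ->
  (forall i j, (i < k)%N -> (j < i)%N -> (r j).2 * (r i).1 - (r j).1 * (r i).2 != 0) ->
  (forall i, (i < k)%N -> ((r i).1 != 0) || ((r i).2 != 0)) ->
  exists2 d, bform n d &
    forall x y, f x y = (\prod_(i <- iota 0 k) ((r i).2 * x - (r i).1 * y)) * d x y.
Proof.
elim: k n f => [|k IH] n f Hf rt ne nz.
  by exists f => // x y; rewrite big_nil mul1r.
rewrite addSnnS in Hf.
have [||| d Hd E] := IH _ _ Hf.
- by move=> i ik; apply: rt; rewrite ltnW.
- by move=> i j ik ji; apply: ne => //; rewrite ltnW.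
- by move=> i ik; apply: nz; rewrite ltnW.
have [|| d' Hd' E'] := @bform_div n d (r k).1 (r k).2 _ Hd.
- exact: nz.
- have := rt k (ltnSn k); rewrite E => /eqP; rewrite mulf_eq0 => /orP [|/eqP //].
  rewrite prodf_seq_eq0 => /hasP; case=> i; rewrite mem_iota add0n => /andP [_ ik].
  by rewrite /= (negbTE (ne k i (ltnSn k) ik)).
exists d' => // x y; rewrite E E' -[in iota 0 k.+1]addn1 iotaD big_cat /= big_seq1 add0n.
ring.
Qed.

End BinaryForms.

(** * The pencil in the frame of a base point *)

Definition triple (R : Type) := (R * R * R)%type.
Notation "u '.x'" := (u.1.1) (at level 2, left associativity, only parsing).
Notation "u '.y'" := (u.1.2) (at level 2, left associativity, only parsing).
Notation "u '.z'" := (u.2) (at level 2, left associativity, only parsing).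

Section Triples.
Variable R : comNzRingType.
Implicit Types (u v w p : triple R) (F G : triple R -> R).

Definition tadd u v : triple R := (u.x + v.x, u.y + v.y, u.z + v.z).
Definition tscale (k : R) u : triple R := (k * u.x, k * u.y, k * u.z).
Definition tsub u v : triple R := (u.x - v.x, u.y - v.y, u.z - v.z).
Definition br u v w : R :=
  u.x * (v.y * w.z - v.z * w.y) - u.y * (v.x * w.z - v.z * w.x)
  + u.z * (v.x * w.y - v.y * w.x).

(* If [F] is a cubic form with [F p = 0], then
   [2 F (s p + t v) = s^2 t (pol1 F p v) + s t^2 (pol2 F p v) + 2 t^3 (F v)]. *)
Definition pol1 F p v : R := F (tadd p v) - F (tsub p v) - (F v + F v).
Definition pol2 F p v : R := F (tadd p v) + F (tsub p v).

(** On the line pv, once the zero p is removed, F and G restrict to two binary quadratics with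
    coefficients [pol1], [pol2] and twice the value at v. These are the minors of the resulting 2 x
    3 matrix. *)
Definition m12 F G p v := pol1 F p v * pol2 G p v - pol2 F p v * pol1 G p v.
Definition m13 F G p v := pol1 F p v * (G v + G v) - (F v + F v) * pol1 G p v.
Definition m23 F G p v := pol2 F p v * (G v + G v) - (F v + F v) * pol2 G p v.

(** If also [F v = 0], the restriction of 2F to the line is s t (s [pol1] + t [pol2]), whose third
    zero is (s : t) = ([pol2] : -[pol1]). *)
Definition chord F p v := tsub (tscale (pol2 F p v) p) (tscale (pol1 F p v) v).
(* The third point on the line [p v] of the cubic through [v] of the pencil of [F] and [G]. *)
Definition pchord F G p v := tsub (tscale (m23 F G p v) p) (tscale (m13 F G p v) v).

(* [x], [y], [z] below are coordinates with respect to a base point (0:0:1). *)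
Definition conic5 (a c v : triple R) : R :=
  a.z * c.z * (a.y * c.x - a.x * c.y) * v.x * v.y
  - v.z * (c.z * a.x * a.y * (v.y * c.x - v.x * c.y)
           + a.z * c.x * c.y * (v.x * a.y - v.y * a.x)).

(** A basis of the cubics that are double at (0:0:1) and pass through (1:0:0), (0:1:0), a and c. The
    factor [conic5 a c] is the conic through these five points; the linear factors are the lines
    joining (0:0:1) to a and to c, and the line z = 0. *)
Definition twoCremona (a c v : triple R) : triple R :=
  ((v.x * a.y - v.y * a.x) * conic5 a c v,
   (v.y * c.x - v.x * c.y) * conic5 a c v,
   v.z * (v.x * a.y - v.y * a.x) * (v.y * c.x - v.x * c.y)).

Definition dot u v : R := u.x * v.x + u.y * v.y + u.z * v.z.

End Triples.

Section NormalizedFrame.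
Variable K : fieldType.
Implicit Types (u v w : triple K).
Variables f1 f2 f3 g1 g2 g3 : K -> K -> K.
Hypotheses (Hf1 : bform 1 f1) (Hf2 : bform 2 f2) (Hf3 : bform 3 f3).
Hypotheses (Hg1 : bform 1 g1) (Hg2 : bform 2 g2) (Hg3 : bform 3 g3).

Let n12 x y := f1 x y * g2 x y - f2 x y * g1 x y.
Let n13 x y := f1 x y * g3 x y - f3 x y * g1 x y.
Let n23 x y := f2 x y * g3 x y - f3 x y * g2 x y.

Lemma bform_n12 : bform 3 n12.
Proof. by apply: bform_sub; [exact: (bform_mul Hf1 Hg2) | exact: (bform_mul Hf2 Hg1)]. Qed.
Lemma bform_n13 : bform 4 n13.
Proof. by apply: bform_sub; [exact: (bform_mul Hf1 Hg3) | exact: (bform_mul Hf3 Hg1)]. Qed.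
Lemma bform_n23 : bform 5 n23.
Proof. by apply: bform_sub; [exact: (bform_mul Hf2 Hg3) | exact: (bform_mul Hf3 Hg2)]. Qed.

Definition common_zero u :=
  u.z ^+ 2 * f1 u.x u.y + u.z * f2 u.x u.y + f3 u.x u.y = 0 /\
  u.z ^+ 2 * g1 u.x u.y + u.z * g2 u.x u.y + g3 u.x u.y = 0.

(** At a common zero the vector (z^2, z, 1) is orthogonal to both rows of coefficients, hence
    proportional to their cross product (n23, -n13, n12). *)
Lemma common_zero_n13 u : common_zero u -> n13 u.x u.y = - (u.z * n12 u.x u.y).
Proof.
case=> /eqP; rewrite addrC addr_eq0 => /eqP Ef /eqP; rewrite addrC addr_eq0 => /eqP Eg.
by rewrite /n13 /n12 Ef Eg; ring.
Qed.
Lemma common_zero_n23 u : common_zero u -> n23 u.x u.y = u.z ^+ 2 * n12 u.x u.y.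
Proof.
case=> /eqP; rewrite addrC addr_eq0 => /eqP Ef /eqP; rewrite addrC addr_eq0 => /eqP Eg.
by rewrite /n23 /n12 Ef Eg; ring.
Qed.

(* [V v] and the triple below describe the third point, on the line joining (0:0:1) and [v], of the
   cubic of the pencil through [v]. *)
Let V v := v.z * n12 v.x v.y + n13 v.x v.y.
Definition third v : triple K :=
  (- (V v * v.x), - (V v * v.y), v.z * n13 v.x v.y + n23 v.x v.y).

Lemma third_common_zero v : common_zero v -> third v = (0, 0, 0).
Proof.
move=> Hv; rewrite /third /V (common_zero_n13 Hv) (common_zero_n23 Hv).
congr (_, _, _); ring.
Qed.

Section Quartic.
Variables (b z : triple K).
Hypotheses (Hb : common_zero b) (Hz : common_zero z).
Hypothesis bz : z.x * b.y - z.y * b.x != 0.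

(** On the line joining (0:0:1) to b the third point is b, and on the line to z it is z, so the
    bracket contains both lines. It is affine in [v.z] with coefficients of degrees 4 and 5; two
    linear factors leave degrees 2 and 3. *)
Lemma br_third_factor : exists A2 A3, [/\ bform 2 A2, bform 3 A3 &
  forall v, br (third v) z b =
    (v.x * b.y - v.y * b.x) * (v.x * z.y - v.y * z.x) * (v.z * A2 v.x v.y + A3 v.x v.y)].
Proof.
pose pz := z.x * b.y - z.y * b.x.
pose tz (x y : K) := (z.y * b.z - z.z * b.y) * x + (z.z * b.x - z.x * b.z) * y.
have Htz : bform 1 tz by exact: bform_lin.
pose A4 x y := pz * n13 x y - n12 x y * tz x y.
pose A5 x y := pz * n23 x y - n13 x y * tz x y.
have H4 : bform 4 A4.
  by apply: bform_sub; [exact: (bform_scale pz bform_n13) | exact: (bform_mul bform_n12 Htz)].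
have H5 : bform 5 A5.
  by apply: bform_sub; [exact: (bform_scale pz bform_n23) | exact: (bform_mul bform_n13 Htz)].
have E v : br (third v) z b = v.z * A4 v.x v.y + A5 v.x v.y.
  by rewrite /br /third /A4 /A5 /V /= /tz /pz; ring.
have b0 : (b.x != 0) || (b.y != 0).
  by apply/negPn; rewrite negb_or !negbK; apply/negP => /andP [/eqP h1 /eqP h2];
     move: bz; rewrite h1 h2 !mulr0 subrr eqxx.
have z0 : (z.x != 0) || (z.y != 0).
  by apply/negPn; rewrite negb_or !negbK; apply/negP => /andP [/eqP h1 /eqP h2];
     move: bz; rewrite h1 h2 !mul0r subrr eqxx.
have r4b : A4 b.x b.y = 0 by rewrite /A4 (common_zero_n13 Hb) /pz /tz; ring.
have r5b : A5 b.x b.y = 0.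
  by rewrite /A5 (common_zero_n13 Hb) (common_zero_n23 Hb) /pz /tz; ring.
have r4z : A4 z.x z.y = 0 by rewrite /A4 (common_zero_n13 Hz) /pz /tz; ring.
have r5z : A5 z.x z.y = 0.
  by rewrite /A5 (common_zero_n13 Hz) (common_zero_n23 Hz) /pz /tz; ring.
have [B4 HB4 E4] := bform_div b0 H4 r4b.
have [B5 HB5 E5] := bform_div b0 H5 r5b.
have bz' : b.y * z.x - b.x * z.y != 0.
  by move: bz; congr (_ != 0); ring.
have s4z : B4 z.x z.y = 0.
  by move: r4z; rewrite E4 => /eqP; rewrite mulf_eq0 (negbTE bz') => /eqP.
have s5z : B5 z.x z.y = 0.
  by move: r5z; rewrite E5 => /eqP; rewrite mulf_eq0 (negbTE bz') => /eqP.
have [C4 HC4 E4'] := bform_div z0 HB4 s4z.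
have [C5 HC5 E5'] := bform_div z0 HB5 s5z.
exists C4, C5; split=> // v; rewrite E E4 E5 E4' E5'; ring.
Qed.

Variables (a c z1 z2 : triple K).
Hypotheses (Ha : common_zero a) (Hc : common_zero c).
Hypotheses (H1 : common_zero z1) (H2 : common_zero z2).
Hypotheses (He0 : common_zero (1, 0, 0)) (He1 : common_zero (0, 1, 0)).
Hypotheses (bx : b.x != 0) (by_ : b.y != 0) (zx : z.x != 0) (zy : z.y != 0).
Hypotheses (az : a.z != 0) (cz : c.z != 0).
Hypotheses (ax : a.x != 0) (ay : a.y != 0) (cx : c.x != 0) (cy : c.y != 0).
Let indep u v := u.x * v.y - u.y * v.x != 0.
Hypotheses (iac : indep a c).
Hypotheses (iab : indep a b) (icb : indep c b) (i1b : indep z1 b) (i2b : indep z2 b).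
Hypotheses (iaz : indep a z) (icz : indep c z) (i1z : indep z1 z) (i2z : indep z2 z).

(** The residual cubic is double at (0:0:1) and vanishes at the common zeros off the two lines, so
    it belongs to the net of [twoCremona]. Its vanishing at z1 and z2 identifies u as a line through
    their images. *)
Lemma br_third_twoCremona : exists u,
  [/\ dot u (twoCremona a c z1) = 0, dot u (twoCremona a c z2) = 0 &
   forall v, br (third v) z b =
    (v.x * b.y - v.y * b.x) * (v.x * z.y - v.y * z.x) * dot u (twoCremona a c v)].
Proof.
have [A2 [A3 [HA2 HA3 E]]] := br_third_factor.
(* At a common zero [third] is the zero triple while the two linear factors do not vanish. *)
have van v : common_zero v -> v.x * b.y - v.y * b.x != 0 -> v.x * z.y - v.y * z.x != 0 ->
    v.z * A2 v.x v.y + A3 v.x v.y = 0.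
  move=> Hv hb hz; have := E v; rewrite (third_common_zero Hv) => /esym /eqP.
  rewrite /br /= !mul0r subrr addr0.
  by rewrite !mulf_eq0 (negbTE hb) (negbTE hz) => /eqP.
have A10 : A3 1 0 = 0.
  by have := van _ He0; rewrite /= !mul0r !add0r !mul1r !subr0 => ->.
have A01 : A3 0 1 = 0.
  by have := van _ He1; rewrite /= !mul0r !add0r !mul1r ?sub0r !oppr_eq0 => ->.
have [B3 HB3 E3] := @bform_div _ _ _ 1 0 (introT orP (or_introl (oner_neq0 K))) HA3 A10.
have B01 : B3 0 1 = 0.
  by move: A01; rewrite E3 mul0r sub0r mul1r => /eqP; rewrite mulN1r oppr_eq0 => /eqP.
have [C3 HC3 E3'] := @bform_div _ _ _ 0 1 (introT orP (or_intror (oner_neq0 K))) HB3 B01.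
have [m [n En]] := bform1_inv HC3.
have A3E x y : A3 x y = - (x * y * (m * x + n * y)).
  by rewrite E3 E3' En; ring.
pose dl := a.y * c.x - a.x * c.y.
have dl0 : dl != 0.
  by move: iac; rewrite /indep -oppr_eq0 /dl; congr (_ != 0); ring.
pose D := a.z * c.z * dl.
have D0 : D != 0 by rewrite !mulf_neq0.
(* The part without [v.z] fixes u0 and u1: in the direction of c the form [e4] vanishes, in the
   direction of a the form [e3] does. *)
pose u0 := - (m * c.x + n * c.y) / (D * dl).
pose u1 := - (m * a.x + n * a.y) / (D * dl).
pose ll (x y : K) := c.z * a.x * a.y * (y * c.x - x * c.y) + a.z * c.x * c.y * (x * a.y - y * a.x).
pose e3 (x y : K) := x * a.y - y * a.x.
pose e4 (x y : K) := y * c.x - x * c.y.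
pose h x y := A2 x y + (u0 * e3 x y + u1 * e4 x y) * ll x y.
have He3 : bform 1 e3.
  by apply: (bform_ext (bform_lin a.y (- a.x))) => x y; rewrite /e3; ring.
have He4 : bform 1 e4.
  by apply: (bform_ext (bform_lin (- c.y) c.x)) => x y; rewrite /e4; ring.
have Hll : bform 1 ll.
  apply: (bform_ext (bform_add (bform_scale (c.z * a.x * a.y) He4)
    (bform_scale (a.z * c.x * c.y) He3))) => x y; rewrite /ll /e3 /e4; ring.
have Hh : bform 2 h.
  apply: bform_add => //; apply: (@bform_mul _ 1 1 _ _ _ Hll).
  by apply: bform_add; apply: bform_scale.
have key v : v.z * A2 v.x v.y + A3 v.x v.y =
   (u0 * e3 v.x v.y + u1 * e4 v.x v.y) * conic5 a c v + v.z * h v.x v.y.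
  rewrite A3E /conic5 /h /u0 /u1 /D /e3 /e4 /ll /dl; field.
  by rewrite -/dl az cz dl0.
have qa : conic5 a c a = 0 by rewrite /conic5; ring.
have qc : conic5 a c c = 0 by rewrite /conic5; ring.
(* The quadratic form [h] vanishes in the directions of a and c, so it is a constant multiple of
   [e3] times [e4]. This constant is the last coefficient of u, up to sign. *)
have ha : h a.x a.y = 0.
  have := key a; rewrite van // qa mulr0 add0r => /esym /eqP.
  by rewrite mulf_eq0 (negbTE az) => /eqP.
have hc : h c.x c.y = 0.
  have := key c; rewrite van // qc mulr0 add0r => /esym /eqP.
  by rewrite mulf_eq0 (negbTE cz) => /eqP.
have [h1 Hh1 Eh1] := @bform_div _ _ _ a.x a.y (introT orP (or_introl ax)) Hh ha.
have h1c : h1 c.x c.y = 0.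
  move: hc; rewrite Eh1 => /eqP; rewrite mulf_eq0 => /orP [h0|/eqP //].
  by move: dl0; rewrite /dl (eqP h0) eqxx.
have [h2 Hh2 Eh2] := @bform_div _ _ _ c.x c.y (introT orP (or_introl cx)) Hh1 h1c.
have [k Ek] := bform0_inv Hh2.
pose u : triple K := (u0, u1, - k).
have cE v : v.z * A2 v.x v.y + A3 v.x v.y = dot u (twoCremona a c v).
  rewrite key Eh1 Eh2 Ek /dot /twoCremona /u /= /e3 /e4; ring.
exists u; split; first by rewrite -cE van.
  by rewrite -cE van.
by move=> v; rewrite E cE.
Qed.

End Quartic.
End NormalizedFrame.

(** * Restriction of a cubic to the lines through one of its points *)

Section CubicFunctions.
Variable R : comNzRingType.
Implicit Types (u v w p : triple R).

Definition monomial3 (j : nat) u : R :=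
  match j with
  | 0 => u.x * u.x * u.x | 1 => u.x * u.x * u.y | 2 => u.x * u.x * u.z
  | 3 => u.x * u.y * u.y | 4 => u.x * u.y * u.z | 5 => u.x * u.z * u.z
  | 6 => u.y * u.y * u.y | 7 => u.y * u.y * u.z | 8 => u.y * u.z * u.z
  | _ => u.z * u.z * u.z
  end.

Definition cubic_of (c : nat -> R) u : R :=
  c 0 * monomial3 0 u + c 1 * monomial3 1 u + c 2 * monomial3 2 u + c 3 * monomial3 3 u
  + c 4 * monomial3 4 u + c 5 * monomial3 5 u + c 6 * monomial3 6 u + c 7 * monomial3 7 u
  + c 8 * monomial3 8 u + c 9 * monomial3 9 u.

Definition cubic (F : triple R -> R) := exists c, forall u, F u = cubic_of c u.

Variable F : triple R -> R.
Hypothesis HF : cubic F.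

Lemma cubic_line p v s t : F p = 0 ->
  F (tadd (tscale s p) (tscale t v)) *+ 2 =
  s ^+ 2 * t * pol1 F p v + s * t ^+ 2 * pol2 F p v + t ^+ 3 * (F v *+ 2).
Proof.
(* The claim is a polynomial identity in the coefficients of F only after multiples of [F p] are
   added. They are inserted while [F p = 0] is at hand, and [ring] does the rest; the lemmas below
   proceed likewise. *)
move=> Fp; have -> : pol2 F p v = pol2 F p v - F p *+ 2 by rewrite Fp mul0rn subr0.
have -> : t ^+ 3 * (F v *+ 2) = t ^+ 3 * (F v *+ 2) + F p * (s ^+ 3 *+ 2).
  by rewrite Fp mul0r addr0.
case: HF => c E {Fp}.
rewrite /pol1 /pol2 !E /cubic_of /monomial3 /tadd /tsub /tscale /=; ring.
Qed.

(* Up to factors of 2 this says that [pol1 F p] is linear and that [pol2 F p] is quadratic. *)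
Lemma pol1_comb p u v s t :
  pol1 F p (tadd (tscale s u) (tscale t v)) = s * pol1 F p u + t * pol1 F p v.
Proof.
case: HF => c E.
rewrite /pol1 /pol2 !E /cubic_of /monomial3 /tadd /tsub /tscale /=; ring.
Qed.

Lemma pol2_comb p u v s t : F p = 0 ->
  pol2 F p (tadd (tscale s u) (tscale t v)) =
  s ^+ 2 * pol2 F p u + s * t * (pol2 F p (tadd u v) - pol2 F p u - pol2 F p v)
  + t ^+ 2 * pol2 F p v.
Proof.
move=> Fp.
have H w : pol2 F p w = pol2 F p w - F p *+ 2 by rewrite Fp mul0rn subr0.
rewrite (H (tadd (tscale s u) (tscale t v))) (H (tadd u v)) (H u) (H v) {H}.
case: HF => c E {Fp}.
rewrite /pol1 /pol2 !E /cubic_of /monomial3 /tadd /tsub /tscale /=; ring.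
Qed.

Lemma pol1_shift p v z : F p = 0 -> pol1 F p (tadd v (tscale z p)) = pol1 F p v.
Proof.
move=> Fp.
have -> : pol1 F p v = pol1 F p v + F p * (6%:R * z) by rewrite Fp mul0r addr0.
case: HF => c E {Fp}.
rewrite /pol1 /pol2 !E /cubic_of /monomial3 /tadd /tsub /tscale /=; ring.
Qed.

Lemma pol2_shift p v z : F p = 0 ->
  pol2 F p (tadd v (tscale z p)) = pol2 F p v + z * pol1 F p v *+ 2.
Proof.
move=> Fp.
have H w : pol2 F p w = pol2 F p w - F p *+ 2 by rewrite Fp mul0rn subr0.
rewrite (H (tadd v (tscale z p))) (H v) {H}.
have -> : z * pol1 F p v = z * pol1 F p v + F p * (3%:R * z ^+ 2) by rewrite Fp mul0r addr0.
case: HF => c E {Fp}.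
rewrite /pol1 /pol2 !E /cubic_of /monomial3 /tadd /tsub /tscale /=; ring.
Qed.

Lemma cubic_shift p v z : F p = 0 ->
  F (tadd v (tscale z p)) *+ 2 = F v *+ 2 + z * pol2 F p v + z ^+ 2 * pol1 F p v.
Proof.
move=> Fp; have <- : tadd (tscale z p) (tscale 1 v) = tadd v (tscale z p).
  by rewrite /tadd /tscale /= !mul1r; congr (_, _, _); rewrite addrC.
rewrite cubic_line //; ring.
Qed.
End CubicFunctions.

(** * Coordinates in the frame of three points *)

Section Frames.
Variable K : fieldType.
Implicit Types (u v w p X : triple K) (F G : triple K -> K).

Definition lincomb u0 u1 p X := tadd (tadd (tscale X.x u0) (tscale X.y u1)) (tscale X.z p).
Definition frcoord u0 u1 p v : triple K :=
  (br v u1 p / br u0 u1 p, br u0 v p / br u0 u1 p, br u0 u1 v / br u0 u1 p).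

Lemma lincombK u0 u1 p v : br u0 u1 p != 0 -> lincomb u0 u1 p (frcoord u0 u1 p v) = v.
Proof.
case: v => [[v0 v1] v2] h; rewrite /lincomb /frcoord /tadd /tscale /=.
by congr (_, _, _); move: h; rewrite /br /= => h; field.
Qed.

Lemma br_lincomb u0 u1 p A B C :
  br (lincomb u0 u1 p A) (lincomb u0 u1 p B) (lincomb u0 u1 p C) = br u0 u1 p * br A B C.
Proof. rewrite /br /lincomb /tadd /tscale /=; ring. Qed.

Lemma frcoord_lincomb u0 u1 p X : br u0 u1 p != 0 -> frcoord u0 u1 p (lincomb u0 u1 p X) = X.
Proof.
by case: X => [[X0 X1] X2] h; rewrite /frcoord /lincomb /tadd /tscale /br /=;
   congr (_, _, _); move: h; rewrite /br /= => h; field.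
Qed.

Hypothesis two_neq0 : (2%:R : K) != 0.
Variables u0 u1 p : triple K.
Let pt x y := tadd (tscale x u0) (tscale y u1).
Let lc := lincomb u0 u1 p.

Section OneCubic.
Variable F : triple K -> K.
Hypotheses (HF : cubic F) (F0 : F u0 = 0) (F1 : F u1 = 0) (Fp : F p = 0).

Definition fr1 x y := pol1 F p (pt x y) / 2%:R.
Definition fr2 x y := pol2 F p (pt x y) / 2%:R.
Definition fr3 x y := F (pt x y).

Lemma bform_fr1 : bform 1 fr1.
Proof.
apply: (bform_ext (bform_lin (pol1 F p u0 / 2%:R) (pol1 F p u1 / 2%:R))) => x y.
by rewrite /fr1 pol1_comb //; field.
Qed.

Lemma bform_quad (a b c : K) : bform 2 (fun x y => a * x ^+ 2 + b * (x * y) + c * y ^+ 2).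
Proof.
apply: (bform_step (bform_lin a b) (bform_lin 0 c)) => x y; ring.
Qed.

Lemma bform_fr2 : bform 2 fr2.
Proof.
apply: (bform_ext (bform_quad (pol2 F p u0 / 2%:R)
  ((pol2 F p (tadd u0 u1) - pol2 F p u0 - pol2 F p u1) / 2%:R) (pol2 F p u1 / 2%:R))) => x y.
by rewrite /fr2 pol2_comb //; field.
Qed.

Lemma bform_fr3 : bform 3 fr3.
Proof.
apply: (bform_step (bform_quad 0 (pol1 F u0 u1 / 2%:R) (pol2 F u0 u1 / 2%:R))
  (bform_scale 0 (bform_quad 0 0 0))) => x y.
rewrite /fr3; apply: (mulfI two_neq0); rewrite mulr_natl cubic_line // F1.
by field.
Qed.

Lemma lincomb_shift X : lc X = tadd (pt X.x X.y) (tscale X.z p).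
Proof. by []. Qed.

Lemma frE X : F (lc X) = X.z ^+ 2 * fr1 X.x X.y + X.z * fr2 X.x X.y + fr3 X.x X.y.
Proof.
apply: (mulfI two_neq0); rewrite mulr_natl lincomb_shift cubic_shift // /fr1 /fr2 /fr3.
by field.
Qed.

Lemma pol1_lc X : pol1 F p (lc X) = 2%:R * fr1 X.x X.y.
Proof. by rewrite lincomb_shift pol1_shift // /fr1; field. Qed.

Lemma pol2_lc X : pol2 F p (lc X) = 2%:R * fr2 X.x X.y + 4%:R * X.z * fr1 X.x X.y.
Proof. by rewrite lincomb_shift pol2_shift // /fr1 /fr2; field. Qed.

End OneCubic.

Section TwoCubics.
Variables F G : triple K -> K.
Hypotheses (HF : cubic F) (F0 : F u0 = 0) (F1 : F u1 = 0) (Fp : F p = 0).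
Hypotheses (HG : cubic G) (G0 : G u0 = 0) (G1 : G u1 = 0) (Gp : G p = 0).

Definition frzero := common_zero (fr1 F) (fr2 F) (fr3 F) (fr1 G) (fr2 G) (fr3 G).
Definition frthird := third (fr1 F) (fr2 F) (fr3 F) (fr1 G) (fr2 G) (fr3 G).

Lemma frzeroE X : F (lc X) = 0 -> G (lc X) = 0 -> frzero X.
Proof. by rewrite !frE. Qed.

Lemma pchord_lc X : pchord F G p (lc X) = tscale 4%:R (lc (frthird X)).
Proof.
rewrite /pchord /m23 /m13 !pol1_lc // !pol2_lc // !frE //.
rewrite /lc /lincomb /frthird /third /tadd /tsub /tscale /=.
congr (_, _, _); ring.
Qed.

(** Adding a multiple of p to v only shifts the variable s in both restricted quadratics, which
    leaves their resultant unchanged. So [X.z] disappears, and the resultant becomes a binary form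
    of degree 8 in the direction seen from p. *)
Lemma pencil_res_lc X : m13 F G p (lc X) ^+ 2 - m12 F G p (lc X) * m23 F G p (lc X) = 16%:R * (
  (fr1 F X.x X.y * fr3 G X.x X.y - fr3 F X.x X.y * fr1 G X.x X.y) ^+ 2
  - (fr1 F X.x X.y * fr2 G X.x X.y - fr2 F X.x X.y * fr1 G X.x X.y)
    * (fr2 F X.x X.y * fr3 G X.x X.y - fr3 F X.x X.y * fr2 G X.x X.y)).
Proof. rewrite /m13 /m12 /m23 !pol1_lc // !pol2_lc // !frE //; ring. Qed.

(** At a common zero v itself [pchord] is the zero triple. The point v + p of the same line replaces
    it: its third point is v as soon as [m12 F G p v] is nonzero. *)
Lemma pchord_zero_shift v : F v = 0 -> G v = 0 ->
  pchord F G p (tadd v p) = tscale (- m12 F G p v) v.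
Proof.
move=> Fv Gv.
have -> : tadd v p = tadd v (tscale 1 p) by rewrite /tadd /tscale /= !mul1r.
have EF : F (tadd v (tscale 1 p)) + F (tadd v (tscale 1 p)) = pol2 F p v + pol1 F p v.
  by rewrite -mulr2n cubic_shift // Fv; ring.
have EG : G (tadd v (tscale 1 p)) + G (tadd v (tscale 1 p)) = pol2 G p v + pol1 G p v.
  by rewrite -mulr2n cubic_shift // Gv; ring.
rewrite /pchord /m13 /m23 EF EG !pol1_shift // !pol2_shift // /m12.
rewrite /tadd /tsub /tscale /=; congr (_, _, _); ring.
Qed.

End TwoCubics.
End Frames.

Section Adj.
Variable R : comNzRingType.
Implicit Types (u v w p : triple R).
(** Frame coordinates with the denominator of Cramer's rule cleared, so that genericity conditions
    can be written over any ring. *)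
Definition adjcoord u0 u1 p v : triple R := (br v u1 p, br u0 v p, br u0 u1 v).
Definition prj (r : nat) u : R := if r == 0%N then u.x else if r == 1%N then u.y else u.z.
End Adj.

(** * Two Cremona transformations *)

Section CremonaTriples.
Variable K : fieldType.
Implicit Types (u v w p X : triple K) (P : nat -> triple K).

Definition tinv u : triple K := (u.x^-1, u.y^-1, u.z^-1).
Definition crem3 (i j k : nat) P : nat -> triple K := fun l =>
  if l == i then (1, 0, 0) else if l == j then (0, 1, 0) else if l == k then (0, 0, 1)
  else tinv (frcoord (P i) (P j) (P k) (P l)).

Lemma adjcoordE u0 u1 p v : br u0 u1 p != 0 ->
  adjcoord u0 u1 p v = tscale (br u0 u1 p) (frcoord u0 u1 p v).
Proof. by move=> h; rewrite /adjcoord /frcoord /tscale /=; congr (_, _, _); field. Qed.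

Lemma conic5_scale (k : K) u v w :
  conic5 (tscale k u) (tscale k v) (tscale k w) = k ^+ 6 * conic5 u v w.
Proof. rewrite /conic5 /tscale /=; ring. Qed.

Definition diag3 (k : triple K) v : triple K := (k.x * v.x, k.y * v.y, k.z * v.z).

Lemma twoCremona_scale (k : K) u v w :
  twoCremona (tscale k u) (tscale k v) (tscale k w) =
  diag3 (k ^+ 8, k ^+ 8, k ^+ 5) (twoCremona u v w).
Proof. rewrite /twoCremona conic5_scale /diag3 /tscale /=; congr (_, _, _); ring. Qed.

Lemma br_diag3 (k : triple K) u v w :
  br (diag3 k u) (diag3 k v) (diag3 k w) = k.x * k.y * k.z * br u v w.
Proof. rewrite /br /diag3 /=; ring. Qed.

Lemma br_tscale3 (k l m : K) u v w :
  br (tscale k u) (tscale l v) (tscale m w) = k * l * m * br u v w.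
Proof. rewrite /br /tscale /=; ring. Qed.

(* [cr] is the composite of two Cremona transformations, in the frame of the first one. *)
Section TwoCremonas.
Variables a c : triple K.
Hypotheses (ax : a.x != 0) (ay : a.y != 0) (az : a.z != 0).
Hypotheses (cx : c.x != 0) (cy : c.y != 0) (cz : c.z != 0).
Let dl := a.y * c.x - a.x * c.y.
Hypothesis dl0 : dl != 0.
Let ks : triple K := ((a.x * a.y)^-1, (c.x * c.y)^-1, a.z * c.z).
Let cr v := tinv (frcoord (tinv a) (tinv c) (0, 0, 1) v).

Ltac explicit := move: ax ay az cx cy cz dl0; rewrite ?/cr ?/ks ?/dl;
  case: a => [[a0 a1] a2]; case: c => [[c0 c1] c2] /= ax' ay' az' cx' cy' cz' d0.
Ltac nonzero := rewrite ?mulr0 ?mul0r ?subr0 ?sub0r ?mul1r ?oppr_eq0;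
  repeat (apply/andP; split); try assumption; rewrite !mulf_neq0 ?oppr_eq0 //; assumption.

Lemma crE v : cr v =
  ((dl / (a.x * a.y)) * (v.x * c.x - v.y * c.y)^-1,
   (dl / (c.x * c.y)) * (v.y * a.y - v.x * a.x)^-1,
   (v.z - (v.x * c.x - v.y * c.y) / (dl / (a.x * a.y)) / a.z
        - (v.y * a.y - v.x * a.x) / (dl / (c.x * c.y)) / c.z)^-1).
Proof.
explicit; rewrite /tinv /frcoord /br /=.
have E : a0^-1 * (c1^-1 * 1 - c2^-1 * 0) - a1^-1 * (c0^-1 * 1 - c2^-1 * 0)
  + a2^-1 * (c0^-1 * 0 - c1^-1 * 0) = (a1 * c0 - a0 * c1) / (a0 * a1 * c0 * c1).
  by field; nonzero.
congr (_, _, _); rewrite ?E.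
- by rewrite -[RHS]invrK; congr (_^-1); rewrite invfM invrK invf_div; field; nonzero.
- by rewrite -[RHS]invrK; congr (_^-1); rewrite invfM invrK invf_div; field; nonzero.
- by congr (_^-1); field; nonzero.
Qed.

(** Off the contracted curves the composite is the cubic map [twoCremona], up to the diagonal matrix
    [ks], which does not depend on v. *)
Lemma cr_point v : v.x != 0 -> v.y != 0 -> v.z != 0 ->
  v.x * a.y - v.y * a.x != 0 -> v.y * c.x - v.x * c.y != 0 -> conic5 a c v != 0 ->
  exists2 s, s != 0 & cr (tinv v) = tscale s (diag3 ks (twoCremona a c v)).
Proof.
move=> vx vy vz e3 e4 q.
exists (v.x * v.y * dl / ((v.x * a.y - v.y * a.x) * (v.y * c.x - v.x * c.y) * conic5 a c v)).
  by rewrite !mulf_neq0 // invr_neq0 // !mulf_neq0.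
rewrite crE; move: vx vy vz e3 e4 q; explicit; case: v => [[x y] z] /= vx vy vz e3 e4 q.
rewrite /tinv /tscale /diag3 /twoCremona /=.
have -> : x^-1 * c0 - y^-1 * c1 = (y * c0 - x * c1) / (x * y).
  by field; nonzero.
have -> : y^-1 * a1 - x^-1 * a0 = (x * a1 - y * a0) / (x * y).
  by field; nonzero.
have -> : z^-1 - (y * c0 - x * c1) / (x * y) / ((a1 * c0 - a0 * c1) / (a0 * a1)) / a2 -
  (x * a1 - y * a0) / (x * y) / ((a1 * c0 - a0 * c1) / (c0 * c1)) / c2 =
  conic5 (a0, a1, a2) (c0, c1, c2) (x, y, z) / (x * y * z * a2 * c2 * (a1 * c0 - a0 * c1)).
  by rewrite /conic5 /=; field; nonzero.
by rewrite !invf_div; congr (_, _, _); field; nonzero.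
Qed.

Lemma cr_first : a.y * c.z - a.z * c.y != 0 ->
  exists2 s, s != 0 & cr (1, 0, 0) = tscale s (diag3 ks (twoCremona a c (0, 1, 1))).
Proof.
move=> h.
exists (dl / (a.x ^+ 2 * c.x ^+ 2 * (a.y * c.z - a.z * c.y))).
  by rewrite mulf_neq0 // invr_neq0 // !mulf_neq0 ?expf_neq0.
rewrite crE; move: h; explicit => h; rewrite /tscale /diag3 /twoCremona /conic5 /=.
have -> : 0 - (1 * c0 - 0 * c1) / ((a1 * c0 - a0 * c1) / (a0 * a1)) / a2 -
  (0 * a1 - 1 * a0) / ((a1 * c0 - a0 * c1) / (c0 * c1)) / c2 =
  - (a0 * c0 * (a1 * c2 - a2 * c1)) / ((a1 * c0 - a0 * c1) * a2 * c2).
  by field; nonzero.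
by rewrite !invf_div; congr (_, _, _); field; nonzero.
Qed.

Lemma cr_second : a.x * c.z - a.z * c.x != 0 ->
  exists2 s, s != 0 & cr (0, 1, 0) = tscale s (diag3 ks (twoCremona a c (1, 0, 1))).
Proof.
move=> h.
exists (- dl / (a.y ^+ 2 * c.y ^+ 2 * (a.x * c.z - a.z * c.x))).
  by rewrite mulf_neq0 ?oppr_eq0 // invr_neq0 // !mulf_neq0 ?expf_neq0.
rewrite crE; move: h; explicit => h; rewrite /tscale /diag3 /twoCremona /conic5 /=.
have -> : 0 - (0 * c0 - 1 * c1) / ((a1 * c0 - a0 * c1) / (a0 * a1)) / a2 -
  (1 * a1 - 0 * a0) / ((a1 * c0 - a0 * c1) / (c0 * c1)) / c2 =
  (a1 * c1 * (a0 * c2 - a2 * c0)) / ((a1 * c0 - a0 * c1) * a2 * c2).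
  by field; nonzero.
by rewrite !invf_div; congr (_, _, _); field; nonzero.
Qed.

(** The line joining (0:0:1) to c is contracted to a coordinate point of the second Cremona
    transformation; the argument is a point of this line. *)
Lemma twoCremona_line_c : exists2 s, s != 0 &
  (1, 0, 0) = tscale s (diag3 ks (twoCremona a c (c.x, c.y, c.z + 1))).
Proof.
exists (- (a.x * a.y) / (dl * (a.z * dl * c.x * c.y))).
  by rewrite !mulf_neq0 // ?invr_neq0 ?mulf_neq0 ?oppr_eq0 // ?mulf_neq0.
explicit; rewrite /tscale /diag3 /twoCremona /conic5 /=; congr (_, _, _); field; nonzero.
Qed.

Lemma twoCremona_line_a : exists2 s, s != 0 &
  (0, 1, 0) = tscale s (diag3 ks (twoCremona a c (a.x, a.y, a.z + 1))).
Proof.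
exists (- (c.x * c.y) / (dl * (c.z * dl * a.x * a.y))).
  by rewrite !mulf_neq0 // ?invr_neq0 ?mulf_neq0 ?oppr_eq0 // ?mulf_neq0.
explicit; rewrite /tscale /diag3 /twoCremona /conic5 /=; congr (_, _, _); field; nonzero.
Qed.

(** Lines through (0:0:1) go to lines through (0:0:1). If u vanishes at the image of v, its value at
    another image point of the same line is therefore a multiple of [u.z], with a factor that does
    not depend on u. *)
Lemma twoCremona_line_dot u v : dot u (twoCremona a c v) = 0 ->
  conic5 a c v * dot u (twoCremona a c (v.x, v.y, v.z + 1)) =
  u.z * ((v.x * a.y - v.y * a.x) * (v.y * c.x - v.x * c.y) * (a.z * c.z * dl * v.x * v.y)).
Proof.
move=> E.
have <- : conic5 a c v * dot u (twoCremona a c (v.x, v.y, v.z + 1)) -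
  (conic5 a c v + conic5 a c (v.x, v.y, v.z + 1) - conic5 a c v) * dot u (twoCremona a c v) =
  u.z * ((v.x * a.y - v.y * a.x) * (v.y * c.x - v.x * c.y) * (a.z * c.z * dl * v.x * v.y)).
  rewrite /dot /twoCremona /conic5 /dl /=; ring.
by rewrite E mulr0 subr0.
Qed.
End TwoCremonas.
End CremonaTriples.

Lemma br_scale1 (R : comNzRingType) (k : R) (u v w : triple R) :
  br (tscale k u) v w = k * br u v w.
Proof. rewrite /br /tscale /=; ring. Qed.

(** * Coordinates of the images in terms of third points *)

Section Half.
Variable K : fieldType.
Hypothesis two_neq0 : (2%:R : K) != 0.
Implicit Types (u v w : triple K).
Variables (P : nat -> triple K) (b : triple K) (F G : triple K -> K).
Hypotheses (HF : cubic F) (HG : cubic G).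
Hypotheses (F0 : forall i, (i < 8)%N -> F (P i) = 0) (G0 : forall i, (i < 8)%N -> G (P i) = 0).
Hypotheses (Fb : F b = 0) (Gb : G b = 0).
Let p := P 7.
Hypothesis gp : forall i j k, (i < j)%N -> (j < k)%N -> (k < 7)%N -> br (P i) (P j) (P k) != 0.
Hypothesis gpp : forall i j, (i < 7)%N -> (j < 7)%N -> i != j -> br (P i) (P j) p != 0.
Hypothesis gpb : forall i j, (i < 7)%N -> (j < 7)%N -> i != j -> br (P i) (P j) b != 0.
Hypothesis gpbp : forall i, (i < 7)%N -> br (P i) b p != 0.
Hypothesis mp : forall i, (i < 7)%N -> m12 F G p (P i) != 0.
Let adj v := adjcoord (P 0) (P 1) p v.
Let cnc v := conic5 (adj (P 2)) (adj (P 3)) (adj v).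
Let tcr v := twoCremona (adj (P 2)) (adj (P 3)) (adj v).
Hypothesis conicr : forall r, (r < 3)%N -> cnc (P (4 + r)) != 0.
Hypothesis detr : br (tcr (P 4)) (tcr (P 5)) (tcr (P 6)) != 0.

Let dlt := br (P 0) (P 1) p.
Let dlt0 : dlt != 0. Proof. exact: gpp. Qed.
Let lc := lincomb (P 0) (P 1) p.
Let cf := frcoord (P 0) (P 1) p.
Let lcK v : lc (cf v) = v. Proof. exact: lincombK. Qed.
Let X i := cf (P i).
Let B := cf b.
Let a := X 2.
Let c := X 3.
Let TC v := twoCremona a c v.

Lemma br_frame_p u v : br u v p = dlt * ((cf u).x * (cf v).y - (cf u).y * (cf v).x).
Proof.
rewrite -{1}(lcK u) -{1}(lcK v); rewrite /br /lc /lincomb /dlt /br /tadd /tscale /=; ring.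
Qed.
Lemma br_frame_0 u v : br (P 0) u v = dlt * ((cf u).y * (cf v).z - (cf u).z * (cf v).y).
Proof.
rewrite -{1}(lcK u) -{1}(lcK v); rewrite /br /lc /lincomb /dlt /br /tadd /tscale /=; ring.
Qed.
Lemma br_frame_1 u v : br (P 1) u v = dlt * ((cf u).z * (cf v).x - (cf u).x * (cf v).z).
Proof.
rewrite -{1}(lcK u) -{1}(lcK v); rewrite /br /lc /lincomb /dlt /br /tadd /tscale /=; ring.
Qed.

Lemma indep_frame u v : br u v p != 0 -> (cf u).x * (cf v).y - (cf u).y * (cf v).x != 0.
Proof. by rewrite br_frame_p mulf_eq0 negb_or => /andP []. Qed.

Lemma cf_x v : br v (P 1) p != 0 -> (cf v).x != 0.
Proof. by move=> h; rewrite mulf_neq0 // invr_neq0. Qed.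
Lemma cf_y v : br (P 0) v p != 0 -> (cf v).y != 0.
Proof. by move=> h; rewrite mulf_neq0 // invr_neq0. Qed.
Lemma cf_z v : br (P 0) (P 1) v != 0 -> (cf v).z != 0.
Proof. by move=> h; rewrite mulf_neq0 // invr_neq0. Qed.

Let ax : a.x != 0. Proof. exact/cf_x/gpp. Qed.
Let ay : a.y != 0. Proof. exact/cf_y/gpp. Qed.
Let az : a.z != 0. Proof. exact/cf_z/gp. Qed.
Let cx : c.x != 0. Proof. exact/cf_x/gpp. Qed.
Let cy : c.y != 0. Proof. exact/cf_y/gpp. Qed.
Let cz : c.z != 0. Proof. exact/cf_z/gp. Qed.

Lemma cnc_frame v : cnc v = dlt ^+ 6 * conic5 a c (cf v).
Proof. by rewrite /cnc /adj !adjcoordE // conic5_scale. Qed.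
Lemma conic_frame v : cnc v != 0 -> conic5 a c (cf v) != 0.
Proof. by rewrite cnc_frame mulf_eq0 negb_or => /andP []. Qed.
Lemma tcr_frame v : tcr v = diag3 (dlt ^+ 8, dlt ^+ 8, dlt ^+ 5) (TC (cf v)).
Proof. by rewrite /tcr /adj !adjcoordE // twoCremona_scale. Qed.
Lemma det_frame : br (TC (X 4)) (TC (X 5)) (TC (X 6)) != 0.
Proof. by move: detr; rewrite !tcr_frame br_diag3 mulf_eq0 negb_or => /andP []. Qed.

Let zero i : (i < 8)%N -> frzero (P 0) (P 1) p F G (X i).
Proof.
move=> hi; apply: frzeroE => //; try exact: F0; try exact: G0.
  by rewrite lincombK // F0.
by rewrite lincombK // G0.
Qed.
Let zerob : frzero (P 0) (P 1) p F G B.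
Proof.
apply: frzeroE => //; try exact: F0; try exact: G0.
  by rewrite lincombK.
by rewrite lincombK.
Qed.

Let X0 : X 0 = (1, 0, 0).
Proof.
rewrite /X /cf /frcoord; congr (_, _, _); first by rewrite divff.
  by rewrite [X in X / _](_ : _ = 0) ?mul0r // /br; ring.
by rewrite [X in X / _](_ : _ = 0) ?mul0r // /br; ring.
Qed.
Let X1 : X 1 = (0, 1, 0).
Proof.
rewrite /X /cf /frcoord; congr (_, _, _); last 2 first.
- by rewrite divff.
- by rewrite [X in X / _](_ : _ = 0) ?mul0r // /br; ring.
- by rewrite [X in X / _](_ : _ = 0) ?mul0r // /br; ring.
Qed.

Lemma br_flip u v w : br u v w != 0 -> br v u w != 0.
Proof. by rewrite -oppr_eq0; congr (_ != 0); rewrite /br; ring. Qed.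

Lemma pchord_twoCremona_aux r s t : (3 < r < 7)%N -> (3 < s < 7)%N -> (3 < t < 7)%N ->
  s != r -> t != r -> exists u,
  [/\ dot u (TC (X s)) = 0, dot u (TC (X t)) = 0 & forall V,
   br (pchord F G p (lc V)) (P r) b =
   4%:R * dlt * ((V.x * B.y - V.y * B.x) * (V.x * (X r).y - V.y * (X r).x) * dot u (TC V))].
Proof.
move=> /andP [r3 r7] /andP [s3 s7] /andP [t3 t7] sr tr.
have ib i : (i < 7)%N -> (X i).x * B.y - (X i).y * B.x != 0.
  by move=> hi; apply: indep_frame; apply: gpbp.
have ip i j : (i < 7)%N -> (j < 7)%N -> i != j -> (X i).x * (X j).y - (X i).y * (X j).x != 0.
  by move=> hi hj ij; apply: indep_frame; apply: gpp.
have z0 := zero (isT : 0 < 8)%N; have z1 := zero (isT : 1 < 8)%N.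
rewrite X0 in z0; rewrite X1 in z1.
have small i : (i <= 3)%N -> i != r by move=> h; rewrite neq_ltn (leq_ltn_trans h r3).
have H := @br_third_twoCremona K _ _ _ _ _ _
  (bform_fr1 two_neq0 (P 0) (P 1) p HF) (bform_fr2 two_neq0 (P 0) (P 1) HF (F0 (isT : 7 < 8)%N))
  (bform_fr3 two_neq0 HF (F0 (isT : 0 < 8)%N) (F0 (isT : 1 < 8)%N))
  (bform_fr1 two_neq0 (P 0) (P 1) p HG) (bform_fr2 two_neq0 (P 0) (P 1) HG (G0 (isT : 7 < 8)%N))
  (bform_fr3 two_neq0 HG (G0 (isT : 0 < 8)%N) (G0 (isT : 1 < 8)%N))
  B (X r) zerob (zero (ltnW r7)) (ib r r7) a c (X s) (X t) (zero (isT : 2 < 8)%N)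
  (zero (isT : 3 < 8)%N) (zero (ltnW s7)) (zero (ltnW t7)) z0 z1.
have [||||u [E1 E2 E3]] := H _ _ _ _ az cz ax cx (ip 2 3 isT isT isT)
  (ib 2 isT) (ib 3 isT) (ib s s7) (ib t t7) (ip 2 r isT r7 (small 2 isT))
  (ip 3 r isT r7 (small 3 isT)) (ip s r s7 r7 sr) (ip t r t7 r7 tr).
- by apply/cf_x/br_flip/gpbp.
- by apply/cf_y/gpbp.
- by apply/cf_x; apply: gpp => //; rewrite eq_sym; apply: small.
- by apply/cf_y; apply: gpp => //; apply: small.
exists u; split=> // V; rewrite pchord_lc ?F0 ?G0 // br_scale1.
by rewrite -(lcK (P r)) -(lcK b) br_lincomb E3 /dlt -!mulrA.
Qed.

Lemma pchord_twoCremona : exists u : nat -> triple K, forall r, (r < 3)%N ->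
  (forall s, (s < 3)%N -> s != r -> dot (u r) (TC (X (4 + s))) = 0) /\
  forall V, br (pchord F G p (lc V)) (P (4 + r)) b =
   4%:R * dlt * ((V.x * B.y - V.y * B.x)
     * (V.x * (X (4 + r)).y - V.y * (X (4 + r)).x) * dot (u r) (TC V)).
Proof.
have [u0 [E01 E02 E0]] := @pchord_twoCremona_aux 4 5 6 isT isT isT isT isT.
have [u1 [E11 E12 E1]] := @pchord_twoCremona_aux 5 4 6 isT isT isT isT isT.
have [u2 [E21 E22 E2]] := @pchord_twoCremona_aux 6 4 5 isT isT isT isT isT.
exists (fun r => nth u0 [:: u0; u1; u2] r).
by case=> [|[|[|//]]] _; split=> //; case=> [|[|[|//]]].
Qed.

Definition crem2 (Q : nat -> triple K) := crem3 2 3 7 (crem3 0 1 7 Q).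
Let P2 := crem2 P.
Let ks : triple K := ((a.x * a.y)^-1, (c.x * c.y)^-1, a.z * c.z).
Let up v : triple K := (v.x, v.y, v.z + 1).
Let iac : a.y * c.x - a.x * c.y != 0.
Proof. by have := indep_frame (gpp (isT : 3 < 7)%N (isT : 2 < 7)%N isT); congr (_ != 0);
  rewrite /a /c /X; ring. Qed.

Lemma crem2_point l : (3 < l)%N -> l != 7 ->
  (forall i, (i < 4)%N -> br (P l) (P i) p != 0) -> br (P 0) (P 1) (P l) != 0 -> cnc (P l) != 0 ->
  exists2 s, s != 0 & P2 l = tscale s (diag3 ks (TC (X l))).
Proof.
move=> l3 l7 hp h01 hc.
have E : P2 l = tinv (frcoord (tinv a) (tinv c) (0, 0, 1) (tinv (X l))).
  by case: l l3 l7 {hp h01 hc} => [|[|[|[|[|[|[|[|l]]]]]]]].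
rewrite E; apply: cr_point => //.
- by apply/cf_x/hp.
- by apply/cf_y/br_flip/hp.
- exact: cf_z.
- exact: indep_frame (hp 2 isT).
- by have := indep_frame (hp 3 isT); rewrite -oppr_eq0; congr (_ != 0); rewrite /c /X; ring.
- exact: conic_frame.
Qed.

(** A Cremona transformation contracts the line through two of its centres to the new third one. So
    the new first point is the image of the line joining p to the second point, and conversely; the
    third and fourth points are paired in the same way. *)
Let other i := nth 0%N [:: 1; 0; 3; 2]%N i.
Lemma crem2_base l : (l < 4)%N ->
  exists2 s, s != 0 & P2 l = tscale s (diag3 ks (TC (up (X (other l))))).
Proof.
case: l => [|[|[|[|//]]]] _; rewrite /other /=.
- have -> : P2 0 = tinv (frcoord (tinv a) (tinv c) (0, 0, 1) (1, 0, 0)) by [].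
  rewrite X1 /up /= add0r; apply: cr_first => //.
  by have := gp (isT : 0 < 2)%N (isT : 2 < 3)%N isT; rewrite br_frame_0 mulf_eq0 negb_or => /andP [].
- have -> : P2 1 = tinv (frcoord (tinv a) (tinv c) (0, 0, 1) (0, 1, 0)) by [].
  rewrite X0 /up /= add0r; apply: cr_second => //.
  have := gp (isT : 1 < 2)%N (isT : 2 < 3)%N isT; rewrite br_frame_1 mulf_eq0 negb_or => /andP [_].
  by rewrite -oppr_eq0; congr (_ != 0); rewrite /a /c /X; ring.
- exact: twoCremona_line_c.
- exact: twoCremona_line_a.
Qed.

Let point r : (r < 3)%N -> exists2 s, s != 0 & P2 (4 + r) = tscale s (diag3 ks (TC (X (4 + r)))).
Proof.
move=> r3; have r7 : (4 + r < 7)%N by rewrite -[7%N]/(4 + 3)%N ltn_add2l.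
apply: crem2_point => //.
- by rewrite neq_ltn r7.
- by move=> i i4; apply: gpp => //; [apply: ltn_trans i4 _ | rewrite neq_ltn (leq_trans i4) ?orbT ?leq_addr].
- exact: gp.
- exact: conicr.
Qed.

Lemma crem2_indep : br (P2 4) (P2 5) (P2 6) != 0.
Proof.
have [s0 h0 E0] := point (isT : 0 < 3)%N; have [s1 h1 E1] := point (isT : 1 < 3)%N.
have [s2 h2 E2] := point (isT : 2 < 3)%N.
rewrite -[4%N]/(4 + 0)%N -[5%N]/(4 + 1)%N -[6%N]/(4 + 2)%N E0 E1 E2 br_tscale3 br_diag3.
apply: mulf_neq0; first by rewrite !mulf_neq0.
apply: mulf_neq0; last exact: det_frame.
have k1 : (a.x * a.y)^-1 != 0 by rewrite invr_neq0 // mulf_neq0.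
have k2 : (c.x * c.y)^-1 != 0 by rewrite invr_neq0 // mulf_neq0.
have k3 : a.z * c.z != 0 by rewrite mulf_neq0.
exact: mulf_neq0 (mulf_neq0 k1 k2) k3.
Qed.

Definition crem2_coord l := frcoord (P2 4) (P2 5) (P2 6) (P2 l).

(** The weight [kap r] is independent of [l] and the factor [rho] is independent of [r]. The
    predicate [D] discards the index at which y is the frame point itself: there both brackets
    vanish and the relation carries no information. *)
Definition half_rel (kap : nat -> K) l y (D : pred nat) :=
  exists2 rho, rho != 0 & forall r, (r < 3)%N -> D r ->
    prj r (crem2_coord l) * kap r * br y (P (4 + r)) p = rho * br y (P (4 + r)) b.

(** The clauses differ in the auxiliary point at which the bracket formula is evaluated: a shifted
    base point for the first four points and for the eighth, the point itself for the last two. *)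
Theorem crem2_chords : exists kap : nat -> K, [/\ forall r, (r < 3)%N -> kap r != 0,
  forall l, (l < 4)%N -> half_rel kap l (P (other l)) xpredT,
  forall t, (t < 3)%N -> half_rel kap 7 (P (4 + t)) (fun r => r != t) &
  forall l y e, (7 < l)%N -> (forall i, (i < 4)%N -> br (P l) (P i) p != 0) ->
    br (P 0) (P 1) (P l) != 0 -> cnc (P l) != 0 -> e != 0 ->
    pchord F G p (P l) = tscale e y -> br y (P 4) p != 0 -> br y (P 4) b != 0 ->
    half_rel kap l y xpredT].
Proof.
have [u Hu] := pchord_twoCremona.
pose ki : triple K := (a.x * a.y, c.x * c.y, (a.z * c.z)^-1).
pose U r := diag3 ki (u r).
have UE r V : dot (U r) (diag3 ks V) = dot (u r) V.
  have k1 : (a.x * a.y) * (a.x * a.y)^-1 = 1 by rewrite divff // mulf_neq0.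
  have k2 : (c.x * c.y) * (c.x * c.y)^-1 = 1 by rewrite divff // mulf_neq0.
  have k3 : (a.z * c.z)^-1 * (a.z * c.z) = 1 by rewrite mulVf // mulf_neq0.
  transitivity (ki.x * ks.x * ((u r).x * V.x) + ki.y * ks.y * ((u r).y * V.y)
    + ki.z * ks.z * ((u r).z * V.z)); first by rewrite /U /dot /diag3 /=; ring.
  by rewrite [ki.x * _]k1 [ki.y * _]k2 [ki.z * _]k3 !mul1r.
(* The form [U r] vanishes at two of the three frame points, so its value anywhere is the [r]-th
   frame coordinate times its value at the third one. *)
pose kap r := dot (U r) (P2 (4 + r)).
have dotU r l : (r < 3)%N -> dot (U r) (P2 l) = prj r (crem2_coord l) * kap r.
  move=> r3; have z s : (s < 3)%N -> s != r -> dot (U r) (P2 (4 + s)) = 0.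
    move=> s3 sr; have [k _ ->] := point s3.
    have -> : dot (U r) (tscale k (diag3 ks (TC (X (4 + s))))) = k * dot (U r) (diag3 ks (TC (X (4 + s)))).
      rewrite /dot /tscale /=; ring.
    by rewrite UE (Hu r r3).1 // mulr0.
  rewrite -[in LHS](lincombK (P2 l) crem2_indep) -/(crem2_coord l).
  have -> : dot (U r) (lincomb (P2 4) (P2 5) (P2 6) (crem2_coord l)) =
    (crem2_coord l).x * dot (U r) (P2 (4 + 0)) + (crem2_coord l).y * dot (U r) (P2 (4 + 1))
    + (crem2_coord l).z * dot (U r) (P2 (4 + 2)).
    rewrite /dot /lincomb /tadd /tscale /=; ring.
  case: r r3 z => [|[|[|//]]] _ z; rewrite /prj /kap /=.
  - by rewrite (z 1%N) ?(z 2%N) //; ring.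
  - by rewrite (z 0%N) ?(z 2%N) //; ring.
  - by rewrite (z 0%N) ?(z 1%N) //; ring.
(* Both brackets contain the line through p and [P (4 + r)]. It cancels, and what remains besides
   [u r], namely [m] and [d], does not depend on [r]. *)
have core l V y e s (D : pred nat) : s != 0 -> e != 0 ->
    pchord F G p (lc V) = tscale e y ->
    (forall r, (r < 3)%N -> D r -> s * dot (u r) (TC V) = prj r (crem2_coord l) * kap r) ->
    (exists r, [/\ (r < 3)%N, D r, br y (P (4 + r)) p != 0 & br y (P (4 + r)) b != 0]) ->
    half_rel kap l y D.
  move=> s0 e0 Ey Hs [r0 [r03 Dr0 np nb]].
  have Eb r : (r < 3)%N -> e * br y (P (4 + r)) b = 4%:R * dlt * ((V.x * B.y - V.y * B.x)
     * (V.x * (X (4 + r)).y - V.y * (X (4 + r)).x) * dot (u r) (TC V)).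
    by move=> r3; rewrite -(Hu r r3).2 Ey br_scale1.
  have Ep r : (r < 3)%N -> e * br y (P (4 + r)) p =
     - m13 F G p (lc V) * dlt * (V.x * (X (4 + r)).y - V.y * (X (4 + r)).x).
    move=> r3; rewrite -br_scale1 -Ey -mulrA.
    have -> : dlt * (V.x * (X (4 + r)).y - V.y * (X (4 + r)).x) = br (lc V) (P (4 + r)) p.
      by rewrite br_frame_p [cf (lc V)]frcoord_lincomb.
    rewrite /pchord /br /tsub /tscale /=; ring.
  pose m := m13 F G p (lc V); pose d := V.x * B.y - V.y * B.x.
  have m0 : m != 0.
    apply/eqP => m0; move: (Ep r0 r03); rewrite -/m m0 oppr0 !mul0r => /eqP.
    by rewrite mulf_eq0 (negbTE e0) (negbTE np).
  have d0 : d != 0.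
    apply/eqP => d0; move: (Eb r0 r03); rewrite -/d d0 !mul0r mulr0 => /eqP.
    by rewrite mulf_eq0 (negbTE e0) (negbTE nb).
  have four0 : (4%:R : K) != 0 by rewrite (natrM _ 2 2) mulf_neq0.
  exists (- m * s / (4%:R * d)).
    by rewrite !mulf_neq0 ?oppr_eq0 // invr_neq0 // mulf_neq0.
  move=> r r3 Dr; apply: (mulfI e0); rewrite -(Hs r r3 Dr).
  rewrite [LHS]mulrCA Ep // [RHS]mulrCA Eb // -/m -/d; field.
  by rewrite d0 four0.
have pchord_up i : (i < 7)%N -> pchord F G p (lc (up (X i))) = tscale (- m12 F G p (P i)) (P i).
  move=> i7; have -> : lc (up (X i)) = tadd (P i) p.
    rewrite -[in RHS](lcK (P i)) /lc /lincomb /up /X /tadd /tscale /=; congr (_, _, _); ring.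
  by rewrite pchord_zero_shift ?F0 ?G0 // ltnW.
have scal k s V r : k = tscale s (diag3 ks V) -> s * dot (u r) V = dot (U r) k.
  move=> ->; rewrite -UE /dot /tscale /=; ring.
have rest l : (l < 4)%N -> half_rel kap l (P (other l)) xpredT.
  move=> l4; have o7 : (other l < 4)%N by case: l l4 => [|[|[|[|//]]]].
  have [s s0 Es] := crem2_base l4.
  apply: (core l (up (X (other l))) _ (- m12 F G p (P (other l))) s) => //.
  - by rewrite oppr_eq0 mp // (ltn_trans o7).
  - by rewrite pchord_up // (ltn_trans o7).
  - by move=> r r3 _; rewrite (scal _ _ _ _ Es) dotU.
  - exists 0%N; split=> //; [apply: gpp | apply: gpb] => //;
      by rewrite ?(ltn_trans o7) // neq_ltn o7.
have kap0 r : (r < 3)%N -> kap r != 0.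
  move=> r3; apply/eqP => k0.
  have [rho rho0 E] := rest 0%N isT.
  have := E r r3 isT; rewrite k0 mulr0 mul0r => /esym /eqP.
  rewrite mulf_eq0 (negbTE rho0) /=; apply/negP; exact: gpb.
exists kap; split=> //.
- move=> t t3.
  have t7 : (4 + t < 7)%N by rewrite -[7%N]/(4 + 3)%N ltn_add2l.
  have it i : (i < 4)%N -> br (P (4 + t)) (P i) p != 0.
    move=> i4; apply: gpp => //; first exact: ltn_trans i4 _.
    by rewrite neq_ltn (leq_trans i4) ?orbT ?leq_addr.
  pose V := X (4 + t).
  pose w := (V.x * a.y - V.y * a.x) * (V.y * c.x - V.x * c.y) *
    (a.z * c.z * (a.y * c.x - a.x * c.y) * V.x * V.y).
  have Vx : V.x != 0 by apply/cf_x/it.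
  have Vy : V.y != 0 by apply/cf_y/br_flip/it.
  have Va : V.x * a.y - V.y * a.x != 0 by exact: indep_frame (it 2 isT).
  have Vc : V.y * c.x - V.x * c.y != 0.
    by have := indep_frame (it 3 isT); rewrite -oppr_eq0; congr (_ != 0); rewrite /V /c /X; ring.
  have w0 : w != 0.
    exact: mulf_neq0 (mulf_neq0 Va Vc) (mulf_neq0 (mulf_neq0 (mulf_neq0 (mulf_neq0 az cz) iac) Vx) Vy).
  have q0 := conic_frame (conicr t3); rewrite -/V -/a -/c in q0.
  (* The new eighth point lies on the image of the line joining p to [P (4 + t)]. For [r != t] the
     form [u r] vanishes at the image of [P (4 + t)], so its values at the image of [up V] and at
     the eighth point are proportional, with a factor independent of [r]. *)
  apply: (core 7 (up V) _ (- m12 F G p (P (4 + t))) (conic5 a c V / (w * (a.z * c.z)))) => //.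
  + by apply: mulf_neq0 => //; apply: invr_neq0; exact: mulf_neq0 w0 (mulf_neq0 az cz).
  + by rewrite oppr_eq0 mp.
  + by rewrite pchord_up.
  + move=> r r3 rt; rewrite -dotU // mulrAC.
    rewrite (twoCremona_line_dot (a := a) (c := c)); last by apply: (Hu r r3).1; rewrite // eq_sym.
    have -> : dot (U r) (P2 7) = (u r).z / (a.z * c.z).
      rewrite /U /dot /diag3 /=; ring.
    by rewrite -/w [(w * _)^-1]invfM mulrA mulfK.
  + pose r := if t == 0%N then 1%N else 0%N.
    have r3 : (r < 3)%N by rewrite /r; case: ifP.
    have rt : r != t by rewrite /r; case: (t) => [|[|?]].
    have r7 : (4 + r < 7)%N by rewrite -[7%N]/(4 + 3)%N ltn_add2l.
    by exists r; split=> //; [apply: gpp | apply: gpb]; rewrite // eqn_add2l eq_sym.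
- move=> l y e l7 hp h01 hc e0 Ey np nb.
  have [|s s0 Es] := crem2_point (ltn_trans (isT : 3 < 7)%N l7) _ hp h01 hc.
    by rewrite neq_ltn l7 orbT.
  apply: (core l (X l) y e s) => //.
  + by rewrite lcK.
  + by move=> r r3 _; rewrite (scal _ _ _ _ Es) dotU.
  + by exists 0%N.
Qed.

End Half.

(** * The ninth base point *)

Section NinthPointDef.
Variable R : comNzRingType.
Variables (F G : triple R -> R) (z : nat -> triple R) (p : triple R).
(** The resultant of the two binary quadratics obtained by restricting F and G to the line pv and
    removing the zero p. *)
Definition pres v := m13 F G p v ^+ 2 - m12 F G p v * m23 F G p v.
Definition prodbr v : R := foldr (fun i acc => br v (z i) p * acc) 1 (iota 0 7).
(* [pres] is, up to a constant, the product of the [br v (z i) p] and of a linear form in [v]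
   vanishing at [p] and at the ninth base point; the direction below is the zero of this form. *)
Definition ninth_dir x q := tsub (tscale (pres q * prodbr x) x) (tscale (pres x * prodbr q) q).
(** When the resultant vanishes, the two quadratics on the line pw share the root (s : t) = (-m13 :
    m12). *)
Definition ninth w := tsub (tscale (m12 F G p w) w) (tscale (m13 F G p w) p).
End NinthPointDef.

Section NinthPoint.
Variable K : fieldType.
Hypothesis two_neq0 : (2%:R : K) != 0.
Implicit Types (u v w : triple K).

Lemma br_eq0_comb p e f v : br e f p != 0 -> br v e p = 0 ->
  exists s t, v = tadd (tscale s p) (tscale t e).
Proof.
move=> h h0; exists (frcoord e f p v).z, (frcoord e f p v).x.
rewrite -[LHS](lincombK v h) /lincomb.
have -> : (frcoord e f p v).y = 0.
  have E : br e v p = - br v e p by rewrite /br; ring.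
  by rewrite /frcoord /= E h0 oppr0 mul0r.
rewrite /tadd /tscale /=; congr (_, _, _); ring.
Qed.

Lemma tscale_tadd0 s (p v : triple K) : tadd (tscale s p) (tscale 0 v) = tscale s p.
Proof. by rewrite /tadd /tscale /= !mul0r !addr0. Qed.
Lemma tadd0_tscale s (p v : triple K) : tadd (tscale 0 p) (tscale s v) = tscale s v.
Proof. by rewrite /tadd /tscale /= !mul0r !add0r. Qed.

Variables (P : nat -> triple K) (F G : triple K -> K).
Hypotheses (HF : cubic F) (HG : cubic G).
Hypotheses (F0 : forall i, (i < 8)%N -> F (P i) = 0) (G0 : forall i, (i < 8)%N -> G (P i) = 0).
Let p := P 7.
Hypothesis gpp : forall i j, (i < 7)%N -> (j < 7)%N -> i != j -> br (P i) (P j) p != 0.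
Hypothesis mp : forall i, (i < 7)%N -> m12 F G p (P i) != 0.
Variables x q : triple K.
Let w := ninth_dir F G P p x q.
Hypothesis mw : m12 F G p w != 0.
Hypothesis wp : forall i, (i < 7)%N -> br w (P i) p != 0.

Let lc := lincomb (P 0) (P 1) p.
Let cf := frcoord (P 0) (P 1) p.
Let dlt := br (P 0) (P 1) p.
Let dlt0 : dlt != 0. Proof. exact: gpp. Qed.
Let lcK v : lc (cf v) = v. Proof. exact: lincombK. Qed.

Let brp u v : br u v p = dlt * ((cf u).x * (cf v).y - (cf u).y * (cf v).x).
Proof.
rewrite -{1}(lcK u) -{1}(lcK v); rewrite /br /lc /lincomb /dlt /br /tadd /tscale /=; ring.
Qed.

Let Fp : F p = 0. Proof. exact: F0. Qed.
Let Gp : G p = 0. Proof. exact: G0. Qed.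

(** The resultant is a form of degree 8 in the direction of v seen from p. It vanishes in the
    directions of the seven other given points, which leaves one linear factor. The power of [dlt]
    comes from writing the brackets in frame coordinates. *)
Lemma pres_factor : exists al be, forall v,
  pres F G p v * dlt ^+ 7 = 16%:R * prodbr P p v * ((cf v).x * al + (cf v).y * be).
Proof.
pose f1 := fr1 (P 0) (P 1) p F; pose f2 := fr2 (P 0) (P 1) p F; pose f3 := fr3 (P 0) (P 1) F.
pose g1 := fr1 (P 0) (P 1) p G; pose g2 := fr2 (P 0) (P 1) p G; pose g3 := fr3 (P 0) (P 1) G.
have Hf1 : bform 1 f1 by exact: bform_fr1.
have Hf2 : bform 2 f2 by exact: bform_fr2.
have Hf3 : bform 3 f3 by apply: bform_fr3 => //; exact: F0.
have Hg1 : bform 1 g1 by exact: bform_fr1.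
have Hg2 : bform 2 g2 by exact: bform_fr2.
have Hg3 : bform 3 g3 by apply: bform_fr3 => //; exact: G0.
pose r x y := (f1 x y * g3 x y - f3 x y * g1 x y) * (f1 x y * g3 x y - f3 x y * g1 x y)
  - (f1 x y * g2 x y - f2 x y * g1 x y) * (f2 x y * g3 x y - f3 x y * g2 x y).
have Hr : bform (7 + 1) r.
  have H13 := bform_n13 Hf1 Hf3 Hg1 Hg3.
  apply: bform_sub; first exact: (bform_mul H13 H13).
  exact: (bform_mul (bform_n12 Hf1 Hf2 Hg1 Hg2) (bform_n23 Hf2 Hf3 Hg2 Hg3)).
have rE v : pres F G p v = 16%:R * r (cf v).x (cf v).y.
  by rewrite -{1}(lcK v) /pres pencil_res_lc // /r expr2.
have sixteen : (16%:R : K) != 0 by rewrite (natrM _ 4 4) (natrM _ 2 2) !mulf_neq0.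
pose rt i := ((cf (P i)).x, (cf (P i)).y).
have rt1 i : (rt i).1 = (cf (P i)).x by [].
have rt2 i : (rt i).2 = (cf (P i)).y by [].
have [||| d Hd E] := @bform_div_roots K 7 1 r rt Hr.
- move=> i i7.
  have E0 : pres F G p (P i) = 0.
    rewrite /pres /m13 /m23 (F0 (ltnW i7)) (G0 (ltnW i7)).
    by rewrite !addr0 !mulr0 !mul0r !subr0 expr0n /= mulr0 subr0.
  have := rE (P i); rewrite E0 rt1 rt2 => /esym /eqP.
  by rewrite mulf_eq0 (negbTE sixteen) => /eqP.
- move=> i j i7 ji; have j7 := ltn_trans ji i7.
  have := gpp i7 j7; rewrite neq_ltn ji orbT => /(_ isT).
  by rewrite brp mulf_eq0 negb_or => /andP [_]; rewrite !rt1 !rt2; congr (_ != 0); ring.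
- move=> i i7; have [j j7 ij] : exists2 j, (j < 7)%N & i != j.
    by case: (i) => [|k]; [exists 1%N | exists 0%N].
  have := gpp i7 j7 ij; rewrite brp rt1 rt2; apply: contraR.
  by rewrite negb_or !negbK => /andP [/eqP -> /eqP ->]; rewrite !mul0r subrr mulr0 eqxx.
have [al [be Ed]] := bform1_inv Hd; exists al, be => v.
rewrite rE E Ed /prodbr -[iota 0 7]/[:: 0; 1; 2; 3; 4; 5; 6]%N !big_cons big_nil !rt1 !rt2 /foldr.
rewrite !brp; ring.
Qed.

Lemma pencil_zero v : F v = 0 -> G v = 0 -> m13 F G p v = 0 /\ m23 F G p v = 0.
Proof. by move=> Fv Gv; rewrite /m13 /m23 Fv Gv !addr0 !mulr0 !mul0r !subr0. Qed.

Lemma cf_comb s t u v : cf (tsub (tscale s u) (tscale t v)) =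
  tsub (tscale s (cf u)) (tscale t (cf v)).
Proof.
rewrite /cf /frcoord /tsub /tscale /= /br /=; congr (_, _, _); ring.
Qed.

Lemma cf_w :
  (cf w).x = pres F G p q * prodbr P p x * (cf x).x - pres F G p x * prodbr P p q * (cf q).x /\
  (cf w).y = pres F G p q * prodbr P p x * (cf x).y - pres F G p x * prodbr P p q * (cf q).y.
Proof. by rewrite /w /ninth_dir cf_comb. Qed.

Lemma pres_ninth_dir : exists al be, [/\ forall v,
  pres F G p v * dlt ^+ 7 = 16%:R * prodbr P p v * ((cf v).x * al + (cf v).y * be),
  (al != 0) || (be != 0) & (cf w).x * al + (cf w).y * be = 0].
Proof.
have sixteen : (16%:R : K) != 0 by rewrite (natrM _ 4 4) (natrM _ 2 2) !mulf_neq0.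
have [al [be E]] := pres_factor; exists al, be; split=> //.
  (* If the linear factor were zero, the resultant would vanish identically and [w] would be the
     zero triple. *)
  apply/negPn/negP; rewrite negb_or !negbK => /andP [/eqP al0 /eqP be0].
  have z v : pres F G p v = 0.
    apply: (mulIf (expf_neq0 7 dlt0)); rewrite E al0 be0; ring.
  have := wp (isT : 0 < 7)%N; rewrite /w /ninth_dir !z !mul0r /br /tsub /tscale /=.
  by rewrite !mul0r !subrr !mul0r subrr addr0 eqxx.
have [-> ->] := cf_w.
apply: (mulfI sixteen); rewrite mulr0.
transitivity (pres F G p q * (16%:R * prodbr P p x * ((cf x).x * al + (cf x).y * be))
  - pres F G p x * (16%:R * prodbr P p q * ((cf q).x * al + (cf q).y * be))); first by ring.
by rewrite -!E; ring.
Qed.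

Lemma prodbr_eq0 v : prodbr P p v = 0 -> exists2 i, (i < 7)%N & br v (P i) p = 0.
Proof.
rewrite /prodbr /= mulr1 => /eqP; rewrite !mulf_eq0.
by do 6?[case/orP => [/eqP ?|]]; [exists 0%N | exists 1%N | exists 2%N | exists 3%N | exists 4%N
  | exists 5%N | move/eqP => ?; exists 6%N].
Qed.

Let b := ninth F G p w.

Lemma ninthE : b = tadd (tscale (- m13 F G p w) p) (tscale (m12 F G p w) w).
Proof. rewrite /b /ninth /tadd /tsub /tscale /=; congr (_, _, _); ring. Qed.

Lemma pres_w : pres F G p w = 0.
Proof.
have [al [be [E _ Ew]]] := pres_ninth_dir.
by apply: (mulIf (expf_neq0 7 dlt0)); rewrite E Ew mulr0 mul0r.
Qed.

Lemma ninth_zero : F b = 0 /\ G b = 0.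
Proof.
have /eqP := pres_w; rewrite /pres subr_eq0 => /eqP Ew.
rewrite ninthE; split; apply: (mulfI two_neq0); rewrite mulr0 mulr_natl cubic_line //.
- transitivity (m12 F G p w * (m13 F G p w ^+ 2 * pol1 F p w
    - m13 F G p w * m12 F G p w * pol2 F p w + m12 F G p w ^+ 2 * (F w *+ 2))); first by ring.
  rewrite Ew /m12 /m13 /m23; ring.
- transitivity (m12 F G p w * (m13 F G p w ^+ 2 * pol1 G p w
    - m13 F G p w * m12 F G p w * pol2 G p w + m12 F G p w ^+ 2 * (G w *+ 2))); first by ring.
  rewrite Ew /m12 /m13 /m23; ring.
Qed.

(** At a common zero the resultant vanishes, so v lies on the line joining p to one of the seven
    points or to [w]. On such a line, eliminating the square term between the two quadratics leaves
    s m12 + t m13 = 0 for the common zeros other than p, and m12 is nonzero there, so there is at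
    most one. *)
Lemma base_points v : F v = 0 -> G v = 0 ->
  (exists2 i, (i < 8)%N & exists k, v = tscale k (P i)) \/ exists k, v = tscale k b.
Proof.
move=> Fv Gv; have [E13 E23] := pencil_zero Fv Gv.
have [al [be [E nz Ew]]] := pres_ninth_dir.
have sixteen : (16%:R : K) != 0 by rewrite (natrM _ 4 4) (natrM _ 2 2) !mulf_neq0.
have on_line e f : br e f p != 0 -> br v e p = 0 ->
  (exists k, v = tscale k p) \/
  exists s t, [/\ t != 0, v = tadd (tscale s p) (tscale t e) & s * m12 F G p e + t * m13 F G p e = 0].
  move=> ef ve; have [s [t Ev]] := br_eq0_comb ef ve.
  have [t0|t0] := eqVneq t 0; first by left; exists s; rewrite Ev t0 tscale_tadd0.
  right; exists s, t; split=> //.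
  have EF : s ^+ 2 * pol1 F p e + s * t * pol2 F p e + t ^+ 2 * (F e *+ 2) = 0.
    apply: (mulfI t0); rewrite mulr0 -[RHS](mul0rn _ 2) -Fv Ev cubic_line //; ring.
  have EG : s ^+ 2 * pol1 G p e + s * t * pol2 G p e + t ^+ 2 * (G e *+ 2) = 0.
    apply: (mulfI t0); rewrite mulr0 -[RHS](mul0rn _ 2) -Gv Ev cubic_line //; ring.
  apply: (mulfI t0); rewrite mulr0.
  transitivity (pol1 F p e * (s ^+ 2 * pol1 G p e + s * t * pol2 G p e + t ^+ 2 * (G e *+ 2))
    - pol1 G p e * (s ^+ 2 * pol1 F p e + s * t * pol2 F p e + t ^+ 2 * (F e *+ 2))).
    rewrite /m12 /m13; ring.
  by rewrite EF EG !mulr0 subrr.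
have isp : (exists k, v = tscale k p) ->
    (exists2 i, (i < 8)%N & exists k, v = tscale k (P i)) \/ exists k, v = tscale k b.
  by case=> k Ev; left; exists 7%N => //; exists k.
have /eqP : 16%:R * prodbr P p v * ((cf v).x * al + (cf v).y * be) = 0.
  by rewrite -E /pres E13 E23 expr0n /= mulr0 subr0 mul0r.
rewrite -mulrA mulf_eq0 (negbTE sixteen) orFb mulf_eq0 => /orP [/eqP h0|/eqP h].
  have [i i7 h] := prodbr_eq0 h0.
  have [j j7 ij] : exists2 j, (j < 7)%N & i != j.
    by case: (i) => [|k]; [exists 1%N | exists 0%N].
  have [/isp //|[s [t [t0 Ev Est]]]] := on_line _ _ (gpp i7 j7 ij) h.
  left; exists i; first exact: ltnW.
  have [Ei _] := pencil_zero (F0 (ltnW i7)) (G0 (ltnW i7)).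
  move/eqP: Est; rewrite Ei mulr0 addr0 mulf_eq0 (negbTE (mp i7)) orbF => /eqP s0.
  by exists t; rewrite Ev s0 tadd0_tscale.
have vw : br v w p = 0.
  rewrite brp; case/orP: nz => nz; apply: (mulfI nz); rewrite mulr0.
    transitivity (dlt * (((cf v).x * al + (cf v).y * be) * (cf w).y
      - (cf v).y * ((cf w).x * al + (cf w).y * be))); first by ring.
    by rewrite h Ew; ring.
  transitivity (dlt * (((cf w).x * al + (cf w).y * be) * (cf v).x
      - (cf w).x * ((cf v).x * al + (cf v).y * be))); first by ring.
  by rewrite h Ew; ring.
have [/isp //|[s [t [t0 Ev Est]]]] := on_line _ _ (wp (isT : 0 < 7)%N) vw.
right; exists (t / m12 F G p w); rewrite ninthE Ev.
have -> : s = t / m12 F G p w * - m13 F G p w.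
  apply: (mulIf mw); move/eqP: Est; rewrite addr_eq0 => /eqP ->.
  by rewrite mulrAC divfK // mulrN.
rewrite -{2}(divfK mw t) /tadd /tscale /=; congr (_, _, _); ring.
Qed.

Lemma br_ninth i : (i < 7)%N -> br (P i) b p != 0.
Proof.
move=> i7; have -> : br (P i) b p = - m12 F G p w * br w (P i) p.
  rewrite ninthE /br /tadd /tscale /=; ring.
by rewrite mulf_neq0 ?oppr_eq0 // wp.
Qed.
End NinthPoint.

(** * Chords of a single cubic *)

Section Chords.
Variable K : fieldType.
Hypothesis two_neq0 : (2%:R : K) != 0.
Implicit Types (u v w : triple K).
Variable F : triple K -> K.
Hypothesis HF : cubic F.

Lemma chord_zero p v : F p = 0 -> F v = 0 -> F (chord F p v) = 0.
Proof.
move=> Fp Fv; have -> : chord F p v = tadd (tscale (pol2 F p v) p) (tscale (- pol1 F p v) v).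
  rewrite /chord /tadd /tsub /tscale /=; congr (_, _, _); ring.
apply: (mulfI two_neq0); rewrite mulr_natl cubic_line // Fv; ring.
Qed.

Lemma pol_comb b y s t : F b = 0 -> F y = 0 ->
  pol1 F (tadd (tscale s b) (tscale t y)) b = t * (s * pol1 F b y *+ 2 + t * pol2 F b y) /\
  pol2 F (tadd (tscale s b) (tscale t y)) b = t * (pol1 F b y + s * (s * pol1 F b y + t * pol2 F b y)).
Proof.
move=> Fb Fy.
have E e : F (tadd (tscale e b) (tscale t y)) *+ 2 =
    e ^+ 2 * t * pol1 F b y + e * t ^+ 2 * pol2 F b y.
  by rewrite cubic_line // Fy mul0rn mulr0 addr0.
have E1 : tadd (tadd (tscale s b) (tscale t y)) b = tadd (tscale (s + 1) b) (tscale t y).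
  rewrite /tadd /tscale /=; congr (_, _, _); ring.
have E2 : tsub (tadd (tscale s b) (tscale t y)) b = tadd (tscale (s - 1) b) (tscale t y).
  rewrite /tadd /tsub /tscale /=; congr (_, _, _); ring.
split; apply: (mulfI two_neq0).
  rewrite [pol1 F (_) b]/pol1 E1 E2 Fb.
  transitivity (F (tadd (tscale (s + 1) b) (tscale t y)) *+ 2
    - F (tadd (tscale (s - 1) b) (tscale t y)) *+ 2); first by ring.
  rewrite !E; ring.
rewrite [pol2 F (_) b]/pol2 E1 E2.
transitivity (F (tadd (tscale (s + 1) b) (tscale t y)) *+ 2
    + F (tadd (tscale (s - 1) b) (tscale t y)) *+ 2); first by ring.
rewrite !E; ring.
Qed.

Lemma pol_comb_r b y s t : F b = 0 ->
  pol1 F b (tadd (tscale s b) (tscale t y)) = t * pol1 F b y /\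
  pol2 F b (tadd (tscale s b) (tscale t y)) = t ^+ 2 * pol2 F b y + s * t * pol1 F b y *+ 2.
Proof.
move=> Fb.
have -> : tadd (tscale s b) (tscale t y) = tadd (tscale t y) (tscale s b).
  by rewrite /tadd /tscale /=; congr (_, _, _); rewrite addrC.
have E1 : pol1 F b (tscale t y) = t * pol1 F b y.
  by rewrite -(tscale_tadd0 t y y) pol1_comb //; ring.
have E2 : pol2 F b (tscale t y) = t ^+ 2 * pol2 F b y.
  by rewrite -(tscale_tadd0 t y y) pol2_comb //; ring.
by rewrite pol1_shift // pol2_shift // E1 E2; split=> //; ring.
Qed.

(** Taking third points on lines through b is an involution. This leads from a barred point back to
    y. *)
Lemma chord_chord b y : F b = 0 ->
  chord F b (chord F b y) = tscale (- pol1 F b y ^+ 3) y.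
Proof.
move=> Fb.
have E : chord F b y = tadd (tscale (pol2 F b y) b) (tscale (- pol1 F b y) y).
  rewrite /chord /tadd /tsub /tscale /=; congr (_, _, _); ring.
rewrite {1}/chord E; have [-> ->] := pol_comb_r y (pol2 F b y) (- pol1 F b y) Fb.
rewrite /tadd /tsub /tscale /=; congr (_, _, _); ring.
Qed.

(** This gives the uniqueness of the barred points. The point u lies on the line by, where F
    vanishes only at b, at y and at the third point (the factor [e]). The case u = b is excluded by
    [k != 0]; the case u = y forces the line to be tangent at y, and then the third point is y
    again. *)
Lemma chord_unique b y u k f : F b = 0 -> F y = 0 -> F u = 0 -> br y f b != 0 ->
  pol1 F b y != 0 -> k != 0 -> chord F u b = tscale k y ->
  exists2 m, m != 0 & u = tscale m (chord F b y).
Proof.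
move=> Fb Fy Fu ybf f10 k0 Ec.
have [s [t Eu]] : exists s t, u = tadd (tscale s b) (tscale t y).
  apply: (br_eq0_comb ybf).
  have H : pol2 F u b * br u y b = 0.
    have -> : pol2 F u b * br u y b = br (chord F u b) y b by rewrite /chord /br /tsub /tscale /=; ring.
    by rewrite Ec br_scale1 /br; ring.
  move/eqP: H; rewrite mulf_eq0 => /orP [/eqP h|/eqP //].
  have : br (chord F u b) f b = 0 by rewrite /chord h /br /tsub /tscale /=; ring.
  by move/eqP; rewrite Ec br_scale1 mulf_eq0 (negbTE k0) (negbTE ybf).
pose e := s * pol1 F b y + t * pol2 F b y.
have [p1 p2] := pol_comb s t Fb Fy; rewrite -Eu in p1 p2.
have se : s * t * e = 0.
  rewrite -[RHS](mul0rn _ 2) -Fu Eu cubic_line // Fy /e; ring.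
have EC : tscale k y = tadd (tscale (t * (t * (pol1 F b y + s * e))) y)
    (tscale (t * (s * (s * e) - e)) b).
  rewrite -Ec /chord p1 p2 {1}Eu /e /tadd /tsub /tscale /=; congr (_, _, _); ring.
have kE : k = t * (t * (pol1 F b y + s * e)).
  apply: (mulIf ybf); rewrite -br_scale1 EC /br /tadd /tscale /=; ring.
have t0 : t != 0 by apply/eqP => t0; move: k0; rewrite kE t0 mul0r eqxx.
have se0 : s * e = 0 by move/eqP: se; rewrite mulrAC mulf_eq0 (negbTE t0) orbF => /eqP.
have e0 : e = 0.
  have H : tscale (t * e) b = (0, 0, 0).
    move: EC; rewrite -kE se0 mulr0 sub0r; case: (b) (y) => [[b0 b1] b2] [[y0 y1] y2].
    rewrite /tadd /tscale /= => -[h0 h1 h2].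
    have aux m n l : l = l + t * - e * m -> n = t * e * m -> n = 0.
      by move=> /eqP; rewrite -subr_eq0 opprD addrA subrr sub0r oppr_eq0 mulrN mulNr oppr_eq0
        => /eqP h ->.
    by congr (_, _, _); [apply: aux h0 _ | apply: aux h1 _ | apply: aux h2 _].
  apply/eqP; apply: contraR ybf => e0.
  have te0 : t * e != 0 by rewrite mulf_neq0.
  case: H => /eqP; rewrite mulf_eq0 (negbTE te0) => /eqP h0 /eqP.
  rewrite mulf_eq0 (negbTE te0) => /eqP h1 /eqP; rewrite mulf_eq0 (negbTE te0) => /eqP h2.
  by rewrite /br h0 h1 h2; apply/eqP; ring.
exists (- t / pol1 F b y).
  by apply: mulf_neq0; rewrite ?oppr_eq0 ?invr_neq0.
have sE : s = - t / pol1 F b y * pol2 F b y.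
  apply: (mulIf f10); rewrite mulrAC divfK //; move/eqP: e0.
  by rewrite /e addr_eq0 mulNr => /eqP.
have tE : t = - (- t / pol1 F b y * pol1 F b y) by rewrite divfK // opprK.
rewrite Eu sE {2}tE /chord /tadd /tsub /tscale /=; congr (_, _, _); ring.
Qed.

End Chords.

(** * Comparison of the two configurations *)

Section ConfigEq.
Variable K : fieldType.
Implicit Types (P Q : nat -> triple K).

Lemma br_diag (x y z : K) : br (x, 0, 0) (0, y, 0) (0, 0, z) = x * y * z.
Proof. rewrite /br /=; ring. Qed.

Definition Xeq3 P Q := exists m0 m1 m2, br m0 m1 m2 != 0 /\
  forall l, (l < 10)%N -> exists2 c, c != 0 & Q l = tscale c (lincomb m0 m1 m2 (P l)).

Lemma Xeq3_trans P Q S : Xeq3 P Q -> Xeq3 Q S -> Xeq3 P S.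
Proof.
move=> [m0 [m1 [m2 [hm Hm]]]] [n0 [n1 [n2 [hn Hn]]]].
exists (lincomb n0 n1 n2 m0), (lincomb n0 n1 n2 m1), (lincomb n0 n1 n2 m2).
split=> [|l hl]; first by rewrite br_lincomb mulf_neq0.
have [c c0 Ec] := Hm l hl; have [d d0 Ed] := Hn l hl.
exists (d * c); first by rewrite mulf_neq0.
rewrite Ed Ec /lincomb /tadd /tscale /=; congr (_, _, _); ring.
Qed.

Lemma Xeq3_br P Q i j k : Xeq3 P Q -> (i < 10)%N -> (j < 10)%N -> (k < 10)%N ->
  br (Q i) (Q j) (Q k) != 0 -> br (P i) (P j) (P k) != 0.
Proof.
move=> [m0 [m1 [m2 [hm H]]]] hi hj hk.
have [ci _ ->] := H i hi; have [cj _ ->] := H j hj; have [ck _ ->] := H k hk.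
by rewrite br_tscale3 br_lincomb !mulf_eq0 !negb_or => /andP [_ /andP []].
Qed.

Lemma crem3_basis i j k P : i != j -> i != k -> j != k ->
  br (crem3 i j k P i) (crem3 i j k P j) (crem3 i j k P k) != 0.
Proof.
move=> ij ik jk; rewrite /crem3 !eqxx [j == i]eq_sym [k == i]eq_sym [k == j]eq_sym.
by rewrite (negbTE ij) (negbTE ik) (negbTE jk) br_diag !mulr1 oner_neq0.
Qed.

Lemma crem3_indep i j k l m P : ~~ (l \in [:: i; j; k]) -> ~~ (m \in [:: i; j; k]) ->
  i != j -> i != k -> j != k ->
  br (P i) (P j) (P k) != 0 -> br (P l) (P j) (P k) != 0 -> br (P i) (P l) (P k) != 0 ->
  br (P m) (P j) (P k) != 0 -> br (P i) (P m) (P k) != 0 -> br (P l) (P m) (P k) != 0 ->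
  br (crem3 i j k P l) (crem3 i j k P m) (crem3 i j k P k) != 0.
Proof.
rewrite !inE !negb_or => /and3P [li lj lk] /and3P [mi mj mk] ij ik jk d a0 a1 c0 c1 ac.
rewrite /crem3 (negbTE li) (negbTE lj) (negbTE lk) (negbTE mi) (negbTE mj) (negbTE mk).
rewrite [k == i]eq_sym [k == j]eq_sym (negbTE ik) (negbTE jk) eqxx.
have -> u v : br (tinv u) (tinv v) (0, 0, 1) = u.x^-1 * v.y^-1 - u.y^-1 * v.x^-1 :> K.
  rewrite /br /tinv /=; ring.
rewrite /frcoord; cbn [fst snd].
set D := br (P i) (P j) (P k) in d *.
rewrite !invf_div; set A0 := br (P l) (P j) (P k) in a0 *; set A1 := br (P i) (P l) (P k) in a1 *.
set C0 := br (P m) (P j) (P k) in c0 *; set C1 := br (P i) (P m) (P k) in c1 *.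
(* A Plücker relation in the pencil of lines through [P k]. *)
have E : A0 * C1 - A1 * C0 = D * br (P l) (P m) (P k).
  rewrite /A0 /A1 /C0 /C1 /D /br; ring.
have -> : D / A0 * (D / C1) - D / A1 * (D / C0) = - (D ^+ 2 * (D * br (P l) (P m) (P k))
   / (A0 * A1 * C0 * C1)).
  by rewrite -E; field; rewrite a0 a1 c0 c1.
by rewrite oppr_eq0 !mulf_neq0 ?expf_neq0 // invr_neq0 // !mulf_neq0.
Qed.

(** Each side is expressed in the frame of its own three points, which absorbs the linear map. Only
    the scalars of the three representatives are left, hence a diagonal matrix. *)
Lemma Xeq3_crem3 i j k P Q : (i < 10)%N -> (j < 10)%N -> (k < 10)%N ->
  Xeq3 P Q -> Xeq3 (crem3 i j k P) (crem3 i j k Q).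
Proof.
move=> hi hj hk [m0 [m1 [m2 [hm H]]]].
have [ci ci0 Ei] := H i hi; have [cj cj0 Ej] := H j hj; have [ck ck0 Ek] := H k hk.
exists (ci, 0, 0), (0, cj, 0), (0, 0, ck); split.
  by rewrite br_diag !mulf_neq0.
move=> l hl; rewrite /crem3.
case: eqP => [_|_].
  exists ci^-1; first exact: invr_neq0.
  by rewrite /lincomb /tadd /tscale /= !mulr0 !mul0r !addr0 mul1r mulr0 mulVf.
case: eqP => [_|_].
  exists cj^-1; first exact: invr_neq0.
  by rewrite /lincomb /tadd /tscale /= !mulr0 !mul0r !addr0 !add0r mul1r mulr0 mulVf.
case: eqP => [_|_].
  exists ck^-1; first exact: invr_neq0.
  by rewrite /lincomb /tadd /tscale /= !mulr0 !mul0r !addr0 !add0r mul1r mulr0 mulVf.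
have [c c0 Ec] := H l hl; exists c^-1; first exact: invr_neq0.
rewrite Ei Ej Ek Ec /tinv /frcoord !br_tscale3 !br_lincomb /lincomb /tadd /tscale /=.
have aux (u w x y : K) : u / (ci * cj * ck) = c / w ->
    (u * (br m0 m1 m2 * x) / (ci * cj * ck * (br m0 m1 m2 * y)))^-1 = c^-1 * (w * (x / y)^-1).
  move=> E; have -> : u * (br m0 m1 m2 * x) / (ci * cj * ck * (br m0 m1 m2 * y)) = c / w * (x / y).
    rewrite -E !invfM; transitivity ((br m0 m1 m2 / br m0 m1 m2) *
      (u * x * (ci^-1 * cj^-1 * ck^-1 * y^-1))); first by ring.
    by rewrite divff //; ring.
  by rewrite invfM (invf_div c w) mulrAC mulrC mulrA.
have a0 (x y : K) : (c * cj * ck * (br m0 m1 m2 * x) / (ci * cj * ck * (br m0 m1 m2 * y)))^-1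
   = c^-1 * (ci * (x / y)^-1).
  by apply: aux; field; rewrite ci0 cj0 ck0.
have a1 (x y : K) : (ci * c * ck * (br m0 m1 m2 * x) / (ci * cj * ck * (br m0 m1 m2 * y)))^-1
   = c^-1 * (cj * (x / y)^-1).
  by apply: aux; field; rewrite ci0 cj0 ck0.
have a2 (x y : K) : (ci * cj * c * (br m0 m1 m2 * x) / (ci * cj * ck * (br m0 m1 m2 * y)))^-1
   = c^-1 * (ck * (x / y)^-1).
  by apply: aux; field; rewrite ci0 cj0 ck0.
rewrite a0 a1 a2; congr (_, _, _); ring.
Qed.

Lemma crem3_involution i j k P : i != j -> i != k -> j != k -> br (P i) (P j) (P k) != 0 ->
  Xeq3 (crem3 i j k (crem3 i j k P)) P.
Proof.
move=> ij ik jk h; exists (P i), (P j), (P k); split=> // l hl.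
exists 1; first exact: oner_neq0.
have one v : tscale 1 v = v :> triple K by case: v => [[? ?] ?]; rewrite /tscale /= !mul1r.
rewrite one {1}/crem3.
have lc0 : lincomb (P i) (P j) (P k) (1, 0, 0) = P i.
  by case: (P i) => [[x y] z]; rewrite /lincomb /tadd /tscale /=; congr (_, _, _); ring.
have lc1 : lincomb (P i) (P j) (P k) (0, 1, 0) = P j.
  by case: (P j) => [[x y] z]; rewrite /lincomb /tadd /tscale /=; congr (_, _, _); ring.
have lc2 : lincomb (P i) (P j) (P k) (0, 0, 1) = P k.
  by case: (P k) => [[x y] z]; rewrite /lincomb /tadd /tscale /=; congr (_, _, _); ring.
case: eqP => [->|/eqP li]; first by rewrite lc0.
case: eqP => [->|/eqP lj]; first by rewrite lc1.
case: eqP => [->|/eqP lk]; first by rewrite lc2.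
have -> : crem3 i j k P i = (1, 0, 0) by rewrite /crem3 eqxx.
have -> : crem3 i j k P j = (0, 1, 0) by rewrite /crem3 eq_sym (negbTE ij) eqxx.
have -> : crem3 i j k P k = (0, 0, 1).
  by rewrite /crem3 ![k == _]eq_sym (negbTE ik) (negbTE jk) eqxx.
have -> : crem3 i j k P l = tinv (frcoord (P i) (P j) (P k) (P l)).
  by rewrite /crem3 (negbTE li) (negbTE lj) (negbTE lk).
set u := frcoord _ _ _ (P l).
have -> : frcoord (1, 0, 0) (0, 1, 0) (0, 0, 1) (tinv u) = tinv u.
  case: (tinv u) => [[u0 u1] u2]; rewrite /frcoord br_diag !mulr1 !divr1.
  by rewrite /br /=; congr (_, _, _); ring.
have -> : tinv (tinv u) = u by case: (u) => [[? ?] ?]; rewrite /tinv /= !invrK.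
by rewrite lincombK.
Qed.
End ConfigEq.

(** * The relation between the images of the two configurations *)

Section Combine.
Variable K : fieldType.
Variables (P Q : nat -> triple K) (kap kap' : nat -> K) (y : nat -> triple K).
Let p := P 7.
Let b := Q 7.
Let other i := nth 0%N [:: 1; 0; 3; 2]%N i.
Hypothesis PQ : forall i, (i < 7)%N -> Q i = P i.
Hypotheses (kap0 : forall r, (r < 3)%N -> kap r != 0) (kap0' : forall r, (r < 3)%N -> kap' r != 0).
Hypothesis gpp : forall i j, (i < 7)%N -> (j < 7)%N -> i != j -> br (P i) (P j) p != 0.
Hypothesis gpb : forall i j, (i < 7)%N -> (j < 7)%N -> i != j -> br (P i) (P j) b != 0.
Hypothesis h1 : forall l, (l < 4)%N -> half_rel P b kap l (P (other l)) xpredT.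
Hypothesis h1' : forall l, (l < 4)%N -> half_rel Q p kap' l (Q (other l)) xpredT.
Hypothesis h2 : forall t, (t < 3)%N -> half_rel P b kap 7 (P (4 + t)) (fun r => r != t).
Hypothesis h2' : forall t, (t < 3)%N -> half_rel Q p kap' 7 (Q (4 + t)) (fun r => r != t).
Hypothesis h3 : forall l, (7 < l < 10)%N -> half_rel P b kap l (y l) xpredT.
Hypothesis h3' : forall l, (7 < l < 10)%N -> half_rel Q p kap' l (y l) xpredT.
Hypothesis yp : forall l r, (7 < l < 10)%N -> (r < 3)%N -> br (y l) (P (4 + r)) p != 0.
Hypothesis yb : forall l r, (7 < l < 10)%N -> (r < 3)%N -> br (y l) (P (4 + r)) b != 0.
Hypothesis indQ : br (crem2 Q 4) (crem2 Q 5) (crem2 Q 6) != 0.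

Let cP l r := prj r (crem2_coord P l).
Let cQ l r := prj r (crem2_coord Q l).

Lemma combine_rel l v (D : pred nat) : half_rel P b kap l v D -> half_rel Q p kap' l v D ->
  (forall r, (r < 3)%N -> D r -> br v (P (4 + r)) p != 0 /\ br v (P (4 + r)) b != 0) ->
  exists2 n, n != 0 & forall r, (r < 3)%N -> D r -> cP l r * cQ l r * (kap r * kap' r) = n.
Proof.
move=> [rho rho0 E] [rho' rho0' E'] nz; exists (rho * rho'); first by rewrite mulf_neq0.
move=> r r3 Dr; have [np nb] := nz r r3 Dr.
have Er := E r r3 Dr; have Er' := E' r r3 Dr.
rewrite PQ -/p -/b -/(cP l r) -/(cQ l r) in Er Er'; last by rewrite -[7%N]/(4 + 3)%N ltn_add2l.
apply: (mulIf np); apply: (mulIf nb).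
transitivity (cP l r * kap r * br v (P (4 + r)) p * (cQ l r * kap' r * br v (P (4 + r)) b)).
  by ring.
by rewrite Er Er'; ring.
Qed.

Lemma combine_all l : (l < 4)%N || (6 < l < 10)%N ->
  exists2 n, n != 0 & forall r, (r < 3)%N -> cP l r * cQ l r * (kap r * kap' r) = n.
Proof.
have r7 r : (r < 3)%N -> (4 + r < 7)%N by move=> r3; rewrite -[7%N]/(4 + 3)%N ltn_add2l.
case: (ltnP l 4) => [l4 _|l4 /= /andP [l6 l10]].
  have o4 : (other l < 4)%N by case: l l4 => [|[|[|[|//]]]].
  have o7 : (other l < 7)%N by exact: ltn_trans o4 _.
  have := h1' l4; rewrite PQ // => h1l'.
  have [|n n0 E] := combine_rel (h1 l4) h1l'; last by exists n => // r r3; exact: E.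
  move=> r r3 _; split; [apply: gpp | apply: gpb]; rewrite ?r7 //;
    by rewrite neq_ltn (leq_trans o4) ?leq_addr.
case: (ltngtP l 7) => [l7|l7|l7].
- by move: l6; rewrite ltnNge -ltnS l7.
- have lr : (7 < l < 10)%N by rewrite l7.
  have [|n n0 E] := combine_rel (h3 lr) (h3' lr); last by exists n => // r r3; exact: E.
  by move=> r r3 _; split; [apply: yp | apply: yb].
rewrite l7; have H t : (t < 3)%N -> exists2 n, n != 0 &
    forall r, (r < 3)%N -> r != t -> cP 7 r * cQ 7 r * (kap r * kap' r) = n.
  move=> t3; have := h2' t3; rewrite PQ ?r7 // => h2t'.
  apply: (combine_rel (h2 t3) h2t') => r r3 rt.
  by split; [apply: gpp | apply: gpb]; rewrite ?r7 // eqn_add2l eq_sym.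
(* For the eighth point each [t] controls only the two coordinates [r != t]. The cases [t = 0] and
   [t = 1] share the coordinate 2, which identifies their constants. *)
have [n n0 E] := H 0%N isT; have [n' n0' E'] := H 1%N isT; exists n => //.
case=> [|r] r3; last exact: E.
by rewrite E' // -(E' 2%N) // E.
Qed.

Lemma crem2_related : Xeq3 (crem3 4 5 6 (crem2 P)) (crem2 Q).
Proof.
(* Rescaling the frame vectors of the barred side by [d] absorbs both systems of weights, so that
   the coordinates become exactly inverse up to a common factor. *)
pose d r := (kap r * kap' r)^-1.
have d0 r : (r < 3)%N -> d r != 0 by move=> r3; rewrite invr_neq0 // mulf_neq0 // ?kap0 ?kap0'.
exists (tscale (d 0%N) (crem2 Q 4)), (tscale (d 1%N) (crem2 Q 5)), (tscale (d 2%N) (crem2 Q 6)).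
split; first by rewrite br_tscale3 !mulf_neq0 // d0.
have sc r v : (r < 3)%N -> v = tscale (d r)^-1 (tscale (d r) v).
  move=> r3; case: v => [[v0 v1] v2]; rewrite /tscale /=.
  by congr (_, _, _); rewrite mulKf // d0.
move=> l l10; case El : ((l < 4)%N || (6 < l < 10)%N); last first.
  have [E|[E|E]] : l = 4 \/ l = 5 \/ l = 6.
  - by move: l l10 El => [|[|[|[|[|[|[|[|[|[|//]]]]]]]]]] //= _ _; [left | right; left | right; right].
  - exists (d 0%N)^-1; first by rewrite invr_neq0 // d0.
    rewrite {1}(@sc 0%N (crem2 Q l)) // E /crem3 /=; congr (tscale _ _).
    rewrite /lincomb /tadd /tscale /=; congr (_, _, _); ring.
  - exists (d 1%N)^-1; first by rewrite invr_neq0 // d0.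
    rewrite {1}(@sc 1%N (crem2 Q l)) // E /crem3 /=; congr (tscale _ _).
    rewrite /lincomb /tadd /tscale /=; congr (_, _, _); ring.
  - exists (d 2%N)^-1; first by rewrite invr_neq0 // d0.
    rewrite {1}(@sc 2%N (crem2 Q l)) // E /crem3 /=; congr (tscale _ _).
    rewrite /lincomb /tadd /tscale /=; congr (_, _, _); ring.
have [n n0 En] := combine_all El; exists n => //.
have -> : crem3 4 5 6 (crem2 P) l = tinv (crem2_coord P l).
  by move: l El {l10 En} => [|[|[|[|[|[|[|l]]]]]]].
have c0 r : (r < 3)%N -> cP l r != 0.
  move=> r3; apply: contraNneq n0 => c0; by rewrite -(En r r3) c0 !mul0r.
have cE r : (r < 3)%N -> n * (d r * (cP l r)^-1) = cQ l r.
  move=> r3; rewrite -(En r r3) /d; field.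
  by rewrite c0 // kap0 // kap0'.
rewrite -{1}(lincombK (crem2 Q l) indQ) -/(crem2_coord Q l).
rewrite /lincomb /tadd /tscale /=.
have E0 := cE 0%N isT; have E1 := cE 1%N isT; have E2 := cE 2%N isT.
rewrite /cP /cQ /prj /= in E0 E1 E2; rewrite -E0 -E1 -E2.
congr (_, _, _); ring.
Qed.

Hypothesis Q017 : br (Q 0) (Q 1) (Q 7) != 0.
Hypothesis Q237 : br (crem3 0 1 7 Q 2) (crem3 0 1 7 Q 3) (crem3 0 1 7 Q 7) != 0.

Lemma four_cremonas : Xeq3 (crem3 2 3 7 (crem3 4 5 6 (crem2 P))) (crem3 0 1 7 Q).
Proof.
apply: (@Xeq3_trans _ _ (crem3 2 3 7 (crem3 2 3 7 (crem3 0 1 7 Q)))); last exact: crem3_involution.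
by apply: Xeq3_crem3 => //; exact: crem2_related.
Qed.

Lemma five_cremonas : Xeq3 (crem3 0 1 7 (crem3 2 3 7 (crem3 4 5 6 (crem2 P)))) Q.
Proof.
apply: (@Xeq3_trans _ _ (crem3 0 1 7 (crem3 0 1 7 Q))); last exact: crem3_involution.
by apply: Xeq3_crem3 => //; exact: four_cremonas.
Qed.
End Combine.

(** * Row vectors and ternary forms over the complex numbers *)

Lemma natCC_neq0 n : (n.+1%:R : CC) != 0.
Proof. by rewrite (Num.Theory.pnatr_eq0 (Rdefinitions.R)[i] n.+1). Qed.

Definition i0 : 'I_3 := inord 0.
Definition i1 : 'I_3 := inord 1.
Definition i2 : 'I_3 := inord 2.
Definition tri_of (x : vec3) : triple CC := (x 0 i0, x 0 i1, x 0 i2).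
Definition vec_of (u : triple CC) : vec3 := \row_(c < 3) prj c u.

Lemma sum3 (f : 'I_3 -> CC) : \sum_(c < 3) f c = f i0 + f i1 + f i2.
Proof.
rewrite !big_ord_recl big_ord0 addr0 addrA; congr (f _ + f _ + f _);
  by apply: val_inj; rewrite /= inordK.
Qed.

Lemma prj_i0 (u : triple CC) : prj i0 u = u.x. Proof. by rewrite /i0 inordK. Qed.
Lemma prj_i1 (u : triple CC) : prj i1 u = u.y. Proof. by rewrite /i1 inordK. Qed.
Lemma prj_i2 (u : triple CC) : prj i2 u = u.z. Proof. by rewrite /i2 inordK. Qed.

Lemma vec_ofK : cancel vec_of tri_of.
Proof. by case=> [[u0 u1] u2]; rewrite /tri_of !mxE prj_i0 prj_i1 prj_i2. Qed.

Lemma ord3P (c : 'I_3) : c = i0 \/ c = i1 \/ c = i2.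
Proof.
case: c => [[|[|[|//]]] h]; [left | right; left | right; right];
  by apply: val_inj; rewrite /= inordK.
Qed.

Lemma tri_ofK : cancel tri_of vec_of.
Proof.
move=> x; apply/rowP => c; rewrite mxE.
by case: (ord3P c) => [->|[->|->]]; rewrite ?prj_i0 ?prj_i1 ?prj_i2.
Qed.

Lemma tri_of0 : tri_of 0 = (0, 0, 0). Proof. by rewrite /tri_of !mxE. Qed.
Lemma vec_of_neq0 u : u != (0, 0, 0) -> vec_of u != 0.
Proof. by apply: contraNneq => h; rewrite -(vec_ofK u) h tri_of0. Qed.
Lemma tri_ofD x y : tri_of (x + y) = tadd (tri_of x) (tri_of y).
Proof. by rewrite /tri_of !mxE. Qed.
Lemma tri_ofZ k x : tri_of (k *: x) = tscale k (tri_of x).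
Proof. by rewrite /tri_of !mxE. Qed.
Definition rows_of (u v w : triple CC) : 'M[CC]_3 :=
  \matrix_(r < 3, c < 3) prj c (if r == 0 :> nat then u else if r == 1 :> nat then v else w).

Lemma det_mx2 (R : comNzRingType) (A : 'M[R]_2) : \det A = A 0 0 * A 1 1 - A 0 1 * A 1 0.
Proof.
rewrite (expand_det_row _ 0) !big_ord_recl big_ord0 addr0 /cofactor !det_mx11 !mxE.
have -> : lift 0 0 = 1 :> 'I_2 by apply: val_inj.
have -> : lift 1 0 = 0 :> 'I_2 by apply: val_inj.
by rewrite /= expr0 expr1 mul1r mulN1r mulrN.
Qed.

Lemma det_rows_of u v w : \det (rows_of u v w) = br u v w.
Proof.
rewrite (expand_det_row _ i0) sum3 /cofactor !det_mx2.
have l00 : lift i0 (0 : 'I_2) = i1 by apply: val_inj; rewrite /= /bump !inordK.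
have l01 : lift i0 (1 : 'I_2) = i2 by apply: val_inj; rewrite /= /bump !inordK.
have l10 : lift i1 (0 : 'I_2) = i0 by apply: val_inj; rewrite /= /bump !inordK.
have l11 : lift i1 (1 : 'I_2) = i2 by apply: val_inj; rewrite /= /bump !inordK.
have l20 : lift i2 (0 : 'I_2) = i0 by apply: val_inj; rewrite /= /bump !inordK.
have l21 : lift i2 (1 : 'I_2) = i1 by apply: val_inj; rewrite /= /bump !inordK.
have E0 c : rows_of u v w i0 c = prj c u by rewrite mxE /i0 inordK.
have E1 c : rows_of u v w i1 c = prj c v by rewrite mxE /i1 inordK.
have E2 c : rows_of u v w i2 c = prj c w by rewrite mxE /i2 inordK.
have minorE i j r c : row' i (col' j (rows_of u v w)) r c = rows_of u v w (lift i r) (lift j c).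
  by rewrite [LHS]mxE [LHS]mxE.
rewrite !minorE l00 l01 l10 l11 l20 l21 !E0 !E1 !E2.
rewrite !prj_i0 !prj_i1 !prj_i2 /i0 /i1 /i2 !inordK // /br; ring.
Qed.

Lemma mul_rows_of x u v w : x *m rows_of u v w = vec_of (lincomb u v w (tri_of x)).
Proof.
apply/rowP => c; rewrite !mxE sum3 !mxE /i0 /i1 /i2 !inordK //=.
by rewrite /lincomb /prj /tadd /tscale; case: (nat_of_ord c) => [|[|n]].
Qed.

Lemma rows3E (P : config) i j k : rows3 P i j k = rows_of (tri_of (P i)) (tri_of (P j)) (tri_of (P k)).
Proof.
apply/matrixP => r c; rewrite !mxE -[in LHS](tri_ofK (P _)) !mxE.
by case: (nat_of_ord r) => [|[|n]].
Qed.

Lemma det_rows3 (P : config) i j k :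
  \det (rows3 P i j k) = br (tri_of (P i)) (tri_of (P j)) (tri_of (P k)).
Proof. by rewrite rows3E det_rows_of. Qed.

Lemma mul_invmx_rows x u v w : br u v w != 0 ->
  x *m invmx (rows_of u v w) = vec_of (frcoord u v w (tri_of x)).
Proof.
move=> h; have un : rows_of u v w \in unitmx by rewrite unitmxE det_rows_of unitfE.
apply: (can_inj (mulmxK un)); rewrite mulmxKV // mul_rows_of vec_ofK lincombK //.
by rewrite tri_ofK.
Qed.

Definition tconf (P : config) (l : nat) : triple CC := tri_of (P (inord l)).

Lemma o10_eq i j : (i < 10)%N -> (j < 10)%N -> (o10 i == o10 j) = (i == j).
Proof. by move=> hi hj; rewrite -val_eqE /= /o10 !inordK. Qed.

Lemma tri_of_e3 r : (r < 3)%N -> tri_of (e3 r) = ((r == 0)%:R, (r == 1)%:R, (r == 2)%:R).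
Proof.
move=> r3; rewrite /tri_of /e3 !mxE !eqxx /= /i0 /i1 /i2 -!val_eqE /= !inordK //.
by rewrite ![_ == r]eq_sym.
Qed.

Lemma cremonaE i j k (P : config) l : (i < 10)%N -> (j < 10)%N -> (k < 10)%N -> (l < 10)%N ->
  br (tconf P i) (tconf P j) (tconf P k) != 0 ->
  tconf (cremona (o10 i) (o10 j) (o10 k) P) l = crem3 i j k (tconf P) l.
Proof.
move=> hi hj hk hl h; rewrite {1}/tconf /cremona /crem3 -[inord l]/(o10 l) !o10_eq //.
case: eqP => _; first by rewrite tri_of_e3.
case: eqP => _; first by rewrite tri_of_e3.
case: eqP => _; first by rewrite tri_of_e3.
rewrite rows3E mul_invmx_rows // /tri_of !mxE prj_i0 prj_i1 prj_i2.
by [].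
Qed.

Lemma crem3_ext i j k (P Q : nat -> triple CC) : (i < 10)%N -> (j < 10)%N -> (k < 10)%N ->
  (forall l, (l < 10)%N -> P l = Q l) -> forall l, (l < 10)%N -> crem3 i j k P l = crem3 i j k Q l.
Proof. by move=> hi hj hk H l hl; rewrite /crem3 !H. Qed.

Lemma X_eq_of (P Q : config) : (forall l, Q l != 0) -> Xeq3 (tconf P) (tconf Q) -> X_eq P Q.
Proof.
move=> Q0 [m0 [m1 [m2 [hm H]]]]; exists (rows_of m0 m1 m2); split.
  by rewrite unitmxE det_rows_of unitfE.
move=> l; have [c c0 Ec] := H l (ltn_ord l).
have E : Q l = c *: (P l *m rows_of m0 m1 m2).
  apply: (can_inj tri_ofK); rewrite tri_ofZ mul_rows_of vec_ofK.
  by move: Ec; rewrite /tconf inord_val.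
split; last by exists c.
by apply: contraNneq (Q0 l) => z; rewrite E z scaler0.
Qed.

Definition cub_fun (f : tform) (u : triple CC) : CC := ev f (vec_of u).

(** The order is that of [monomial3]; the exponent of the tenth monomial is the default value of
    [nth]. *)
Definition exp3 (j : nat) : nat * nat * nat :=
  nth (0, 0, 3)%N [:: (3, 0, 0); (2, 1, 0); (2, 0, 1); (1, 2, 0); (1, 1, 1); (1, 0, 2);
    (0, 3, 0); (0, 2, 1); (0, 1, 2)]%N j.
Definition mon3 (j : nat) : 'X_{1..3} :=
  [multinom (if c == 0 :> nat then (exp3 j).1.1 else if c == 1 :> nat then (exp3 j).1.2
     else (exp3 j).2) | c < 3].

Lemma mon3_prod j u : \prod_(c < 3) (vec_of u 0 c) ^+ (mon3 j c) = monomial3 j u.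
Proof.
rewrite !big_ord_recl big_ord0 !mulr1 !mxE !mnmE /=.
rewrite /prj /=; case: u => [[a b] c] /=.
by move: j => [|[|[|[|[|[|[|[|[|j]]]]]]]]]; rewrite /exp3 /= ?nth_nil /=; ring.
Qed.

Lemma mon3_inj i j : (i < 10)%N -> (j < 10)%N -> mon3 i = mon3 j -> i = j.
Proof.
move=> hi hj /mnmP E; have E0 := E i0; have E1 := E i1; have E2 := E i2.
move: E0 E1 E2; rewrite !mnmE /i0 /i1 /i2 !inordK //=.
by move: i j hi hj {E} => [|[|[|[|[|[|[|[|[|[|i]]]]]]]]]] [|[|[|[|[|[|[|[|[|[|j]]]]]]]]]].
Qed.

Definition mons3 := [seq mon3 j | j <- iota 0 10].

Lemma uniq_mons3 : uniq mons3.
Proof.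
rewrite map_inj_in_uniq ?iota_uniq // => i j.
by rewrite !mem_iota /= => hi hj; apply: mon3_inj.
Qed.

Lemma mem_mons3 (m : 'X_{1..3}) : mdeg m = 3 -> m \in mons3.
Proof.
move=> h; have [j hj E] : exists2 j, (j < 10)%N & exp3 j = (m i0, m i1, m i2).
  move: h; rewrite mdegE !big_ord_recl big_ord0 addn0.
  have -> : ord0 = i0 :> 'I_3 by apply: val_inj; rewrite /= inordK.
  have -> : lift i0 ord0 = i1 :> 'I_3 by apply: val_inj; rewrite /= /bump !inordK.
  have -> : lift i0 (lift ord0 ord0) = i2 :> 'I_3 by apply: val_inj; rewrite /= /bump !inordK.
  move: (m i0) (m i1) (m i2) => [|[|[|[|a]]]] [|[|[|[|b]]]] [|[|[|[|c]]]] //= _;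
  by [exists 0%N | exists 1%N | exists 2%N | exists 3%N | exists 4%N | exists 5%N | exists 6%N
     | exists 7%N | exists 8%N | exists 9%N].
apply/mapP; exists j; first by rewrite mem_iota.
apply/mnmP => c; rewrite mnmE E /=.
by case: (ord3P c) => [->|[->|->]]; rewrite /i0 /i1 /i2 !inordK.
Qed.

Lemma msupp_mons3 (f : tform) : f \is 3.-homog -> {subset msupp f <= mons3}.
Proof. by move=> /dhomogP H m /H E; apply: mem_mons3. Qed.

Lemma cub_funE (f : tform) : f \is 3.-homog ->
  forall u, cub_fun f u = cubic_of (fun j => f@_(mon3 j)) u.
Proof.
move=> hf u; rewrite /cub_fun /ev mevalE.
have -> : \sum_(m <- msupp f) f@_m * \prod_(i < 3) (vec_of u 0 i) ^+ m i =
   \sum_(m <- mons3) f@_m * \prod_(i < 3) (vec_of u 0 i) ^+ m i.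
  rewrite [RHS](bigID (mem (msupp f))) /= [X in _ + X]big1 ?addr0; last first.
    by move=> m h; rewrite memN_msupp_eq0 // mul0r.
  rewrite -[RHS]big_filter; apply: perm_big; apply: uniq_perm.
  - exact: msupp_uniq.
  - exact/filter_uniq/uniq_mons3.
  - move=> m; rewrite mem_filter /=; case: (boolP (m \in msupp f)) => // h.
    by rewrite (msupp_mons3 hf h).
rewrite big_map -[iota 0 10]/[:: 0; 1; 2; 3; 4; 5; 6; 7; 8; 9]%N !big_cons big_nil.
rewrite !mon3_prod /cubic_of addr0 !addrA //.
Qed.

Lemma cubic_cub_fun (f : tform) : f \is 3.-homog -> cubic (cub_fun f).
Proof. by move=> hf; exists (fun j => f@_(mon3 j)); apply: cub_funE. Qed.

Lemma form_eq0 (f : tform) : f \is 3.-homog -> (forall j, (j < 10)%N -> f@_(mon3 j) = 0) -> f = 0.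
Proof.
move=> hf H; apply/mpolyP => m; rewrite mcoeff0.
case: (boolP (m \in msupp f)) => [h|h]; last by rewrite memN_msupp_eq0.
by have /mapP [j] := msupp_mons3 hf h; rewrite mem_iota /= => hj ->; apply: H.
Qed.

(** * Genericity *)

Section Conditions.
Variable R : comNzRingType.
Variables (F G : triple R -> R) (P : nat -> triple R).

Definition ninth_dir_of := ninth_dir F G P (P 7) (P 8) (P 9).
Definition ninth_of := ninth F G (P 7) ninth_dir_of.
Definition bar8_of := chord F ninth_of (chord F (P 7) (P 8)).
Definition bar10_of := chord G ninth_of (chord G (P 7) (P 9)).

Definition conic_at p v :=
  conic5 (adjcoord (P 0) (P 1) p (P 2)) (adjcoord (P 0) (P 1) p (P 3)) (adjcoord (P 0) (P 1) p v).
Definition twoCremona_at p v :=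
  twoCremona (adjcoord (P 0) (P 1) p (P 2)) (adjcoord (P 0) (P 1) p (P 3)) (adjcoord (P 0) (P 1) p v).

(** These are imposed for two eighth points, [P 7] and the ninth base point, since the same argument
    runs on both configurations. The diagonal entries are set to 1, which is neutral in the
    product. *)
Definition base_conditions p : seq R :=
  [seq if i == j then 1 else br (P i) (P j) p | i <- iota 0 7, j <- iota 0 7] ++
  [seq m12 F G p (P i) | i <- iota 0 7] ++ [seq conic_at p (P (4 + r)) | r <- iota 0 3] ++
  [:: br (twoCremona_at p (P 4)) (twoCremona_at p (P 5)) (twoCremona_at p (P 6))].
Definition point_conditions H p v : seq R :=
  [seq br v (P i) p | i <- iota 0 4] ++ [:: br (P 0) (P 1) v; conic_at p v; H v].
Definition chord_conditions D p v b : seq R :=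
  [seq br (chord D p v) (P (4 + r)) p | r <- iota 0 3] ++
  [seq br (chord D p v) (P (4 + r)) b | r <- iota 0 3] ++ [:: pol1 D b (chord D p v)].

(** A list of ring elements rather than a conjunction: morphisms act on it by [map], and its product
    is a single polynomial. *)
Definition conditions : seq R :=
  [:: m12 F G (P 7) ninth_dir_of] ++ [seq br ninth_dir_of (P i) (P 7) | i <- iota 0 7] ++
  base_conditions (P 7) ++ base_conditions ninth_of ++
  point_conditions G (P 7) (P 8) ++ point_conditions F (P 7) (P 9) ++
  point_conditions G ninth_of bar8_of ++ point_conditions F ninth_of bar10_of ++
  chord_conditions F (P 7) (P 8) ninth_of ++ chord_conditions G (P 7) (P 9) ninth_of.
End Conditions.

Section Generic.
Variable K : fieldType.
Hypothesis two_neq0 : (2%:R : K) != 0.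
Variables (F G : triple K -> K) (P : nat -> triple K).
Hypotheses (HF : cubic F) (HG : cubic G).
Hypotheses (F0 : forall i, (i < 8)%N -> F (P i) = 0) (G0 : forall i, (i < 8)%N -> G (P i) = 0).
Hypotheses (F8 : F (P 8) = 0) (G9 : G (P 9) = 0).
Hypothesis gp : forall i j k, (i < j)%N -> (j < k)%N -> (k < 7)%N -> br (P i) (P j) (P k) != 0.
Hypothesis generic : all (fun c => c != 0) (conditions F G P).

Let p := P 7.
Let w := ninth_dir_of F G P.
Let b := ninth_of F G P.
Let y8 := chord F p (P 8).
Let y9 := chord G p (P 9).
Let pb := bar8_of F G P.
Let qb := bar10_of F G P.

Lemma base_conditionsP u : all (fun c => c != 0) (base_conditions F G P u) ->
  [/\ forall i j, (i < 7)%N -> (j < 7)%N -> i != j -> br (P i) (P j) u != 0,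
      forall i, (i < 7)%N -> m12 F G u (P i) != 0,
      forall r, (r < 3)%N -> conic_at P u (P (4 + r)) != 0 &
      br (twoCremona_at P u (P 4)) (twoCremona_at P u (P 5)) (twoCremona_at P u (P 6)) != 0].
Proof.
rewrite /base_conditions all_cat => /andP [H1]; rewrite all_cat => /andP [H2].
rewrite all_cat => /andP [H3 /andP [H4 _]]; split=> //.
- move=> i j hi hj ij; move/all_allpairsP: H1 => H1.
  by have := H1 i j; rewrite !mem_iota (negbTE ij); apply.
- by move=> i hi; move: H2; rewrite all_map => /allP H; apply: H; rewrite mem_iota.
- by move=> i hi; move: H3; rewrite all_map => /allP H; apply: H; rewrite mem_iota.
Qed.

Lemma point_conditionsP (H : triple K -> K) u v : all (fun c => c != 0) (point_conditions P H u v) ->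
  [/\ forall i, (i < 4)%N -> br v (P i) u != 0, br (P 0) (P 1) v != 0,
      conic_at P u v != 0 & H v != 0].
Proof.
rewrite /point_conditions all_cat => /andP [H1 /and4P [? ? ? _]]; split=> //.
by move=> i hi; move: H1; rewrite all_map => /allP H2; apply: H2; rewrite mem_iota.
Qed.

Lemma chord_conditionsP D u v t : all (fun c => c != 0) (chord_conditions P D u v t) ->
  [/\ forall r, (r < 3)%N -> br (chord D u v) (P (4 + r)) u != 0,
      forall r, (r < 3)%N -> br (chord D u v) (P (4 + r)) t != 0 & pol1 D t (chord D u v) != 0].
Proof.
rewrite /chord_conditions !all_cat => /and3P [H1 H2 /andP [H3 _]]; split=> // r hr.
  by move: H1; rewrite all_map => /allP H; apply: H; rewrite mem_iota.
by move: H2; rewrite all_map => /allP H; apply: H; rewrite mem_iota.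
Qed.


Let nz (c : K) := c != 0.
Lemma split_conditions : [/\ m12 F G p w != 0, forall i, (i < 7)%N -> br w (P i) p != 0,
  all nz (base_conditions F G P p) /\ all nz (base_conditions F G P b),
  all nz (point_conditions P G p (P 8)) /\ all nz (point_conditions P F p (P 9)) &
  (all nz (point_conditions P G b pb) /\ all nz (point_conditions P F b qb)) /\
  (all nz (chord_conditions P F p (P 8) b) /\ all nz (chord_conditions P G p (P 9) b))].
Proof.
move: generic; rewrite /conditions !all_cat.
case/andP=> h0 /andP [h1 /andP [h2 /andP [h3 /andP [h4 /andP [h5 /andP [h6 /andP [h7 /andP [h8 h9]]]]]]]].
split=> //; first by move: h0; rewrite /= andbT.
by move=> i hi; move: h1; rewrite all_map => /allP H; apply: H; rewrite mem_iota.
Qed.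

Let mw : m12 F G p w != 0. Proof. by case: split_conditions. Qed.
Let wp : forall i, (i < 7)%N -> br w (P i) p != 0. Proof. by case: split_conditions. Qed.
Let bcp := base_conditionsP (let: And5 _ _ (conj h _) _ _ := split_conditions in h).
Let bcb := base_conditionsP (let: And5 _ _ (conj _ h) _ _ := split_conditions in h).
Let pc8 := point_conditionsP (let: And5 _ _ _ (conj h _) _ := split_conditions in h).
Let pc9 := point_conditionsP (let: And5 _ _ _ (conj _ h) _ := split_conditions in h).
Let pcb8 := point_conditionsP (let: And5 _ _ _ _ (conj (conj h _) _) := split_conditions in h).
Let pcb9 := point_conditionsP (let: And5 _ _ _ _ (conj (conj _ h) _) := split_conditions in h).
Let cc8 := chord_conditionsP (let: And5 _ _ _ _ (conj _ (conj h _)) := split_conditions in h).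
Let cc9 := chord_conditionsP (let: And5 _ _ _ _ (conj _ (conj _ h)) := split_conditions in h).

Let gpp : forall i j, (i < 7)%N -> (j < 7)%N -> i != j -> br (P i) (P j) p != 0.
Proof. by case: bcp. Qed.
Let gpb : forall i j, (i < 7)%N -> (j < 7)%N -> i != j -> br (P i) (P j) b != 0.
Proof. by case: bcb. Qed.
Let mp : forall i, (i < 7)%N -> m12 F G p (P i) != 0.
Proof. by case: bcp. Qed.
Let mb : forall i, (i < 7)%N -> m12 F G b (P i) != 0.
Proof. by case: bcb. Qed.

Lemma ninth_of_zero : F b = 0 /\ G b = 0.
Proof. exact: (ninth_zero two_neq0 HF HG F0 G0 gpp wp). Qed.

Lemma ninth_of_base v : F v = 0 -> G v = 0 ->
  (exists2 i, (i < 8)%N & exists k, v = tscale k (P i)) \/ exists k, v = tscale k b.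
Proof. exact: (base_points two_neq0 HF HG F0 G0 gpp mp mw wp). Qed.

Let bip i : (i < 7)%N -> br (P i) b p != 0.
Proof. exact: (br_ninth mw wp). Qed.
Let pib i : (i < 7)%N -> br (P i) p b != 0.
Proof. by move=> hi; have := bip hi; rewrite -oppr_eq0; congr (_ != 0); rewrite /br; ring. Qed.

(** The configuration before the final s_89, with the ninth base point in the eighth place. *)
Definition bar_config (l : nat) :=
  if l == 7%N then b else if l == 8%N then pb else if l == 9%N then qb else P l.
Let Q := bar_config.

Lemma bar_config_lt i : (i < 7)%N -> Q i = P i.
Proof. by case: i => [|[|[|[|[|[|[|]]]]]]]. Qed.

Lemma pchord_F v : F v = 0 -> forall u, pchord F G u v = tscale (G v *+ 2) (chord F u v).
Proof.
move=> Fv u; rewrite /pchord /m13 /m23 Fv /chord /tsub /tscale /=; congr (_, _, _); ring.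
Qed.
Lemma pchord_G v : G v = 0 -> forall u, pchord F G u v = tscale (- (F v *+ 2)) (chord G u v).
Proof.
move=> Gv u; rewrite /pchord /m13 /m23 Gv /chord /tsub /tscale /=; congr (_, _, _); ring.
Qed.

Let Fp : F p = 0. Proof. exact: F0. Qed.
Let Gp : G p = 0. Proof. exact: G0. Qed.
Let Fb : F b = 0. Proof. by case: ninth_of_zero. Qed.
Let Gb : G b = 0. Proof. by case: ninth_of_zero. Qed.
Let Fy8 : F y8 = 0. Proof. exact: chord_zero. Qed.
Let Gy9 : G y9 = 0. Proof. exact: chord_zero. Qed.
Let Fpb : F pb = 0. Proof. exact: chord_zero. Qed.
Let Gqb : G qb = 0. Proof. exact: chord_zero. Qed.
Let f8 : pol1 F b y8 != 0. Proof. by case: cc8. Qed.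
Let f9 : pol1 G b y9 != 0. Proof. by case: cc9. Qed.
Let mul2_neq0 (c : K) : c != 0 -> c *+ 2 != 0.
Proof. by move=> h; rewrite -mulr_natl mulf_neq0. Qed.

Let FQ i : (i < 8)%N -> F (Q i) = 0.
Proof.
by rewrite ltnS leq_eqVlt => /orP [/eqP ->|hi]; [exact: Fb | rewrite bar_config_lt // F0 // ltnW].
Qed.
Let GQ i : (i < 8)%N -> G (Q i) = 0.
Proof.
by rewrite ltnS leq_eqVlt => /orP [/eqP ->|hi]; [exact: Gb | rewrite bar_config_lt // G0 // ltnW].
Qed.

(** The determinants say that each of the five Cremona transformations is applied to a genuine
    frame, as needed to pass from inverse matrices to Cramer's rule. The last two are carried over
    from the barred side, where the three points are the coordinate points. *)
Theorem bar_config_eq : 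
  [/\ Xeq3 (crem3 0 1 7 (crem3 2 3 7 (crem3 4 5 6 (crem2 P)))) Q,
     br (P 0) (P 1) (P 7) != 0 &
     [/\ br (crem3 0 1 7 P 2) (crem3 0 1 7 P 3) (crem3 0 1 7 P 7) != 0,
      br (crem2 P 4) (crem2 P 5) (crem2 P 6) != 0,
      br (crem3 4 5 6 (crem2 P) 2) (crem3 4 5 6 (crem2 P) 3) (crem3 4 5 6 (crem2 P) 7) != 0 &
      br (crem3 2 3 7 (crem3 4 5 6 (crem2 P)) 0) (crem3 2 3 7 (crem3 4 5 6 (crem2 P)) 1)
        (crem3 2 3 7 (crem3 4 5 6 (crem2 P)) 7) != 0]].
Proof.
have [_ _ cp dp] := bcp; have [_ _ cb db] := bcb.
have [kap [k0 k1 k2 k3]] := crem2_chords two_neq0 HF HG F0 G0 Fb Gb gp gpp gpb bip mp cp dp.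
have gpQ i j k : (i < j)%N -> (j < k)%N -> (k < 7)%N -> br (Q i) (Q j) (Q k) != 0.
  move=> ij jk k7; have j7 := ltn_trans jk k7; have i7 := ltn_trans ij j7.
  by rewrite !bar_config_lt // gp.
have gpbQ i j : (i < 7)%N -> (j < 7)%N -> i != j -> br (Q i) (Q j) (Q 7) != 0.
  by move=> hi hj ij; rewrite !(@bar_config_lt i, @bar_config_lt j) // gpb.
have gppQ i j : (i < 7)%N -> (j < 7)%N -> i != j -> br (Q i) (Q j) p != 0.
  by move=> hi hj ij; rewrite !bar_config_lt // gpp.
have bipQ i : (i < 7)%N -> br (Q i) p (Q 7) != 0.
  by move=> hi; rewrite (@bar_config_lt i) // pib.
have mQ i : (i < 7)%N -> m12 F G (Q 7) (Q i) != 0.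
  by move=> hi; rewrite (@bar_config_lt i) // mb.
have cbQ r : (r < 3)%N -> conic5 (adjcoord (Q 0) (Q 1) (Q 7) (Q 2))
    (adjcoord (Q 0) (Q 1) (Q 7) (Q 3)) (adjcoord (Q 0) (Q 1) (Q 7) (Q (4 + r))) != 0.
  by move=> hr; rewrite (@bar_config_lt (4 + r)); [exact: cb | rewrite -[7%N]/(4 + 3)%N ltn_add2l].
have [kap' [k0' k1' k2' k3']] := crem2_chords two_neq0 HF HG FQ GQ Fp Gp gpQ gpbQ gppQ bipQ mQ cbQ db.
pose y (l : nat) := if l == 8%N then y8 else y9.
have [x0 x1 x2 x3] := pc8; have [q0 q1 q2 q3] := pc9.
have [x0' x1' x2' x3'] := pcb8; have [q0' q1' q2' q3'] := pcb9.
have [u1 u2 u3] := cc8; have [v1 v2 v3] := cc9.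
have lcase (T : nat -> Prop) : T 8 -> T 9 -> forall l, (7 < l < 10)%N -> T l.
  by move=> T8 T9 [|[|[|[|[|[|[|[|[|[|l]]]]]]]]]].
have h3 l : (7 < l < 10)%N -> half_rel P b kap l (y l) xpredT.
  move: l; apply: lcase.
    exact: (k3 8 y8 _ isT x0 x1 x2 (mul2_neq0 x3) (pchord_F F8 p) (u1 0%N isT) (u2 0%N isT)).
  apply: (k3 9 y9 _ isT q0 q1 q2 _ (pchord_G G9 p) (v1 0%N isT) (v2 0%N isT)).
  by rewrite oppr_eq0 mul2_neq0.
have tt k m v : tscale k (tscale m v) = tscale (k * m) v :> triple K.
  by rewrite /tscale /= !mulrA.
have lt47 i : (i < 4)%N -> (i < 7)%N by move=> h; exact: ltn_trans h _.
have x0Q i : (i < 4)%N -> br (Q 8) (Q i) (Q 7) != 0.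
  by move=> hi; rewrite (bar_config_lt (lt47 _ hi)); exact: x0'.
have q0Q i : (i < 4)%N -> br (Q 9) (Q i) (Q 7) != 0.
  by move=> hi; rewrite (bar_config_lt (lt47 _ hi)); exact: q0'.
(* By [chord_chord] the barred points have the same third points [y8] and [y9] as the original ones,
   now on lines through b. *)
have h3' l : (7 < l < 10)%N -> half_rel Q p kap' l (y l) xpredT.
  move: l; apply: lcase.
    apply: (k3' 8 y8 (G pb *+ 2 * - pol1 F b y8 ^+ 3) isT x0Q x1' x2' _ _ (u2 0%N isT) (u1 0%N isT)).
      by rewrite mulf_neq0 ?mul2_neq0 // oppr_eq0 expf_neq0.
    by rewrite [pchord F G b pb](pchord_F Fpb) [chord F b pb]chord_chord // tt.
  apply: (k3' 9 y9 (- (F qb *+ 2) * - pol1 G b y9 ^+ 3) isT q0Q q1' q2' _ _ (v2 0%N isT) (v1 0%N isT)).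
    by rewrite mulf_neq0 ?oppr_eq0 ?mul2_neq0 // expf_neq0.
  by rewrite [pchord F G b qb](pchord_G Gqb) [chord G b qb]chord_chord // tt.
have yp l r : (7 < l < 10)%N -> (r < 3)%N -> br (y l) (P (4 + r)) p != 0.
  by move=> hl hr; move: l hl; apply: lcase; [apply: u1 | apply: v1].
have yb l r : (7 < l < 10)%N -> (r < 3)%N -> br (y l) (P (4 + r)) b != 0.
  by move=> hl hr; move: l hl; apply: lcase; [apply: u2 | apply: v2].
have iP : br (crem2 P 4) (crem2 P 5) (crem2 P 6) != 0.
  exact: (crem2_indep gp gpp cp dp).
have iQ : br (crem2 Q 4) (crem2 Q 5) (crem2 Q 6) != 0.
  exact: (crem2_indep gpQ gpbQ cbQ db).
have Q017 : br (Q 0) (Q 1) (Q 7) != 0 by apply: gpbQ.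
have Q237 : br (crem3 0 1 7 Q 2) (crem3 0 1 7 Q 3) (crem3 0 1 7 Q 7) != 0.
  by apply: crem3_indep => //; apply: gpbQ.
have R2 := crem2_related bar_config_lt k0 k0' gpp gpb k1 k1' k2 k2' h3 h3' yp yb iQ.
have R4 := four_cremonas bar_config_lt k0 k0' gpp gpb k1 k1' k2 k2' h3 h3' yp yb iQ Q237.
have P017 : br (P 0) (P 1) (P 7) != 0 by apply: gpp.
have P237 : br (crem3 0 1 7 P 2) (crem3 0 1 7 P 3) (crem3 0 1 7 P 7) != 0.
  by apply: crem3_indep => //; apply: gpp.
have R5 := five_cremonas bar_config_lt k0 k0' gpp gpb k1 k1' k2 k2' h3 h3' yp yb iQ Q017 Q237.
split; first exact: R5; first exact: P017.
split; first exact: P237; first exact: iP.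
  by apply: (Xeq3_br R2) => //; apply: crem3_basis.
by apply: (Xeq3_br R4) => //; apply: crem3_basis.
Qed.
End Generic.

(** * Homogeneity of the conditions in the two cubics *)

Section Scaling.
Variable K : fieldType.
Implicit Types (D : triple K -> K) (u v w : triple K).
Hypothesis two_neq0 : (2%:R : K) != 0.
Variables (F G : triple K -> K) (P : nat -> triple K) (lam mu : K).
Hypotheses (HF : cubic F) (HG : cubic G).
Hypotheses (F0 : forall i, (i < 8)%N -> F (P i) = 0) (G0 : forall i, (i < 8)%N -> G (P i) = 0).
Hypothesis generic : all (fun c => c != 0) (conditions F G P).
Hypotheses (lam0 : lam != 0) (mu0 : mu != 0).

Definition fscale (k : K) (D : triple K -> K) u := k * D u.
Let F' := fscale lam F.
Let G' := fscale mu G.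

Lemma pol1_fscale k D u v : pol1 (fscale k D) u v = k * pol1 D u v.
Proof. rewrite /pol1 /fscale; ring. Qed.
Lemma pol2_fscale k D u v : pol2 (fscale k D) u v = k * pol2 D u v.
Proof. rewrite /pol2 /fscale; ring. Qed.

Lemma m12_fscale u v : m12 F' G' u v = lam * mu * m12 F G u v.
Proof. rewrite /m12 !pol1_fscale !pol2_fscale; ring. Qed.
Lemma m13_fscale u v : m13 F' G' u v = lam * mu * m13 F G u v.
Proof. rewrite /m13 !pol1_fscale /F' /G' /fscale; ring. Qed.
Lemma m23_fscale u v : m23 F' G' u v = lam * mu * m23 F G u v.
Proof. rewrite /m23 !pol2_fscale /F' /G' /fscale; ring. Qed.

Lemma pol1_tscale D s t u v : cubic D ->
  pol1 D (tscale s u) (tscale t v) = s ^+ 2 * t * pol1 D u v.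
Proof.
case=> c E; rewrite /pol1 !E /cubic_of /monomial3 /tadd /tsub /tscale /=; ring.
Qed.
Lemma cubic_tscale D s u : cubic D -> D (tscale s u) = s ^+ 3 * D u.
Proof. case=> c E; rewrite !E /cubic_of /monomial3 /tscale /=; ring. Qed.
Lemma pol2_tscale D s t u v : cubic D -> D u = 0 ->
  pol2 D (tscale s u) (tscale t v) = s * t ^+ 2 * pol2 D u v.
Proof.
move=> HD Du.
have -> : pol2 D (tscale s u) (tscale t v) = pol2 D (tscale s u) (tscale t v) - D (tscale s u) *+ 2.
  by rewrite (cubic_tscale s u HD) Du mulr0 mul0rn subr0.
have -> : pol2 D u v = pol2 D u v - D u *+ 2 by rewrite Du mul0rn subr0.
case: HD => c E {Du}; rewrite /pol2 !E /cubic_of /monomial3 /tadd /tsub /tscale /=; ring.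
Qed.

Lemma m12_tscale s t u v : F u = 0 -> G u = 0 ->
  m12 F G (tscale s u) (tscale t v) = (s * t) ^+ 3 * m12 F G u v.
Proof. by move=> Fu Gu; rewrite /m12 !pol1_tscale // !pol2_tscale //; ring. Qed.

Lemma chord_tscale D s t u v : cubic D -> D u = 0 ->
  chord D (tscale s u) (tscale t v) = tscale (s ^+ 2 * t ^+ 2) (chord D u v).
Proof.
move=> HD Du; rewrite /chord pol1_tscale // pol2_tscale // /tsub /tscale /=; congr (_, _, _); ring.
Qed.

Lemma chord_fscale k D u v : chord (fscale k D) u v = tscale k (chord D u v).
Proof. rewrite /chord pol1_fscale pol2_fscale /tsub /tscale /=; congr (_, _, _); ring. Qed.

Let p := P 7.
Let Fp : F p = 0. Proof. exact: F0. Qed.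
Let Gp : G p = 0. Proof. exact: G0. Qed.
Let one v : tscale 1 v = v :> triple K.
Proof. by case: v => [[? ?] ?]; rewrite /tscale /= !mul1r. Qed.

Let kw := (lam * mu) ^+ 2.
Let kb := lam * mu * kw ^+ 4.

Lemma ninth_dir_fscale : ninth_dir_of F' G' P = tscale kw (ninth_dir_of F G P).
Proof.
rewrite /ninth_dir_of /ninth_dir /pres !m12_fscale !m13_fscale !m23_fscale /kw /tsub /tscale /=.
by congr (_, _, _); ring.
Qed.

Lemma ninth_fscale : ninth_of F' G' P = tscale kb (ninth_of F G P).
Proof.
rewrite /ninth_of ninth_dir_fscale /ninth m12_fscale m13_fscale; set w := ninth_dir_of F G P.
have -> : m12 F G p (tscale kw w) = kw ^+ 3 * m12 F G p w.
  by rewrite -{1}(one p) m12_tscale // mul1r.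
have -> : m13 F G p (tscale kw w) = kw ^+ 4 * m13 F G p w.
  rewrite -{1}(one p) /m13 !pol1_tscale // !cubic_tscale //; ring.
rewrite /kb /tsub /tscale /=; congr (_, _, _); ring.
Qed.

Let b := ninth_of F G P.
Let Fb : F b = 0. Proof. by have [] := ninth_of_zero two_neq0 HF HG F0 G0 generic. Qed.
Let Gb : G b = 0. Proof. by have [] := ninth_of_zero two_neq0 HF HG F0 G0 generic. Qed.
Let kw0 : kw != 0. Proof. by rewrite expf_neq0 // mulf_neq0. Qed.
Let kb0 : kb != 0. Proof. by rewrite mulf_neq0 ?mulf_neq0 // expf_neq0. Qed.

Lemma bar8_fscale : bar8_of F' G' P = tscale (lam * kb ^+ 2 * lam ^+ 2) (bar8_of F G P).
Proof.
rewrite /bar8_of ninth_fscale !chord_fscale chord_tscale //.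
by rewrite /tscale /= !mulrA.
Qed.
Lemma bar10_fscale : bar10_of F' G' P = tscale (mu * kb ^+ 2 * mu ^+ 2) (bar10_of F G P).
Proof.
rewrite /bar10_of ninth_fscale !chord_fscale chord_tscale //.
by rewrite /tscale /= !mulrA.
Qed.

Let nz (c : K) := c != 0.

Let all_map_sim (f g : nat -> K) r : (forall i, nz (f i) -> nz (g i)) ->
  all nz [seq f i | i <- r] -> all nz [seq g i | i <- r].
Proof. by move=> H; rewrite !all_map; apply: sub_all => i; apply: H. Qed.

Let nzM (k c : K) : k != 0 -> nz c -> nz (k * c).
Proof. exact: mulf_neq0. Qed.

Lemma br_tscale_r k u v w : br u v (tscale k w) = k * br u v w.
Proof. rewrite /br /tscale /=; ring. Qed.

Lemma conic_at_tscale s t u v : conic_at P (tscale s u) (tscale t v) = s ^+ 4 * t ^+ 2 * conic_at P u v.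
Proof. rewrite /conic_at /conic5 /adjcoord /= /br /tscale /=; ring. Qed.

Lemma twoCremona_at_tscale s u v :
  twoCremona_at P (tscale s u) v = diag3 (s ^+ 6, s ^+ 6, s ^+ 4) (twoCremona_at P u v).
Proof.
have E x : adjcoord (P 0) (P 1) (tscale s u) x = diag3 (s, s, 1) (adjcoord (P 0) (P 1) u x).
  by rewrite /adjcoord !br_tscale_r /diag3 /= mul1r.
rewrite /twoCremona_at !E.
move: (adjcoord _ _ _ (P 2)) (adjcoord _ _ _ (P 3)) (adjcoord _ _ _ v) => a c x.
rewrite /twoCremona /conic5 /diag3 /=; congr (_, _, _); ring.
Qed.

Lemma base_conditions_tscale s u : s != 0 -> F u = 0 -> G u = 0 ->
  all nz (base_conditions F G P u) -> all nz (base_conditions F' G' P (tscale s u)).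
Proof.
move=> s0 Fu Gu; rewrite /base_conditions all_cat => /andP [H1]; rewrite all_cat => /andP [H2].
rewrite all_cat => /andP [H3 /andP [H4 _]].
rewrite all_cat; apply/andP; split.
  apply/all_allpairsP => i j hi hj; move/all_allpairsP: H1 => /(_ i j hi hj).
  by case: ifP => // _; rewrite br_tscale_r; apply: nzM.
rewrite all_cat; apply/andP; split.
  apply: all_map_sim H2 => i.
  have -> : m12 F' G' (tscale s u) (P i) = lam * mu * s ^+ 3 * m12 F G u (P i).
    by rewrite m12_fscale -{1}(one (P i)) m12_tscale // mulr1 mulrA.
  by apply: nzM; rewrite !mulf_neq0 // expf_neq0.
rewrite all_cat; apply/andP; split.
  apply: all_map_sim H3 => i.
  have -> : conic_at P (tscale s u) (P (4 + i)) = s ^+ 4 * conic_at P u (P (4 + i)).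
    by rewrite -{1}(one (P (4 + i))) conic_at_tscale expr1n mulr1.
  by apply: nzM; rewrite expf_neq0.
rewrite /= andbT !twoCremona_at_tscale br_diag3; apply: nzM => //.
by rewrite /= !mulf_neq0 // expf_neq0.
Qed.

Lemma point_conditions_tscale k D s t u v : cubic D -> k != 0 -> s != 0 -> t != 0 ->
  all nz (point_conditions P D u v) ->
  all nz (point_conditions P (fscale k D) (tscale s u) (tscale t v)).
Proof.
move=> HD k0 s0 t0; rewrite /point_conditions all_cat => /andP [H1 /and4P [H2 H3 H4 _]].
rewrite all_cat; apply/andP; split.
  by apply: all_map_sim H1 => i; rewrite br_tscale_r br_scale1 mulrA; apply: nzM; rewrite mulf_neq0.
apply/and4P; split=> //.
- by rewrite br_tscale_r; apply: nzM.
- by rewrite conic_at_tscale; apply: nzM => //; rewrite mulf_neq0 ?expf_neq0.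
- by rewrite /fscale cubic_tscale // mulrA; apply: nzM => //; rewrite mulf_neq0 ?expf_neq0.
Qed.

Lemma chord_conditions_tscale k D s u v t : cubic D -> D t = 0 -> k != 0 -> s != 0 ->
  all nz (chord_conditions P D u v t) ->
  all nz (chord_conditions P (fscale k D) u v (tscale s t)).
Proof.
move=> HD Dt k0 s0; rewrite /chord_conditions chord_fscale all_cat => /andP [H1].
rewrite all_cat => /andP [H2 /andP [H3 _]].
rewrite all_cat; apply/andP; split.
  by apply: all_map_sim H1 => i; rewrite br_scale1; apply: nzM.
rewrite all_cat; apply/andP; split.
  by apply: all_map_sim H2 => i; rewrite br_scale1 br_tscale_r mulrA; apply: nzM; rewrite mulf_neq0.
rewrite /= andbT pol1_fscale pol1_tscale // mulrA; apply: nzM => //.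
by rewrite !mulf_neq0 ?expf_neq0.
Qed.

Theorem conditions_fscale : all (fun c => c != 0) (conditions F' G' P).
Proof.
have [h1 h2 [h3 h4] [h5 h6] [[h7 h8] [h9 h10]]] := split_conditions generic.
rewrite /conditions ninth_dir_fscale ninth_fscale bar8_fscale bar10_fscale.
rewrite all_cat; apply/andP; split.
  rewrite /= andbT.
  have -> : m12 F' G' (P 7) (tscale kw (ninth_dir_of F G P)) =
      lam * mu * kw ^+ 3 * m12 F G (P 7) (ninth_dir_of F G P).
    by rewrite m12_fscale -{1}(one (P 7)) m12_tscale // mul1r mulrA.
  by apply: nzM => //; rewrite !mulf_neq0 // expf_neq0.
rewrite all_cat; apply/andP; split.
  rewrite all_map; apply/allP => i; rewrite mem_iota /= => hi.
  by rewrite br_scale1; apply: nzM => //; apply: h2.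
rewrite all_cat; apply/andP; split.
  by rewrite -(one (P 7)); apply: base_conditions_tscale; rewrite ?oner_neq0.
rewrite all_cat; apply/andP; split; first exact: base_conditions_tscale.
rewrite all_cat; apply/andP; split.
  by rewrite -(one (P 7)) -(one (P 8)); apply: point_conditions_tscale; rewrite ?oner_neq0.
rewrite all_cat; apply/andP; split.
  by rewrite -(one (P 7)) -(one (P 9)); apply: point_conditions_tscale; rewrite ?oner_neq0.
rewrite all_cat; apply/andP; split.
  by apply: point_conditions_tscale => //; rewrite !mulf_neq0 // expf_neq0.
rewrite all_cat; apply/andP; split.
  by apply: point_conditions_tscale => //; rewrite !mulf_neq0 // expf_neq0.
rewrite all_cat; apply/andP; split; exact: chord_conditions_tscale.
Qed.
End Scaling.

(** * Compatibility with ring morphisms *)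

Section Morphism.
Variables (R S : comNzRingType) (phi : {rmorphism R -> S}).
Definition tmap (u : triple R) : triple S := (phi u.x, phi u.y, phi u.z).
Variables (F G : triple R -> R) (F' G' : triple S -> S) (P : nat -> triple R).
Hypotheses (FF : forall u, phi (F u) = F' (tmap u)) (GG : forall u, phi (G u) = G' (tmap u)).
Let P' l := tmap (P l).

Lemma tmap_tadd u v : tmap (tadd u v) = tadd (tmap u) (tmap v).
Proof. by rewrite /tmap /tadd /= !rmorphD. Qed.
Lemma tmap_tsub u v : tmap (tsub u v) = tsub (tmap u) (tmap v).
Proof. by rewrite /tmap /tsub /= !rmorphB. Qed.
Lemma tmap_tscale k u : tmap (tscale k u) = tscale (phi k) (tmap u).
Proof. by rewrite /tmap /tscale /= !rmorphM. Qed.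
Lemma rmorph_br u v w : phi (br u v w) = br (tmap u) (tmap v) (tmap w).
Proof. by rewrite /br /tmap /= !(rmorphB, rmorphD, rmorphM). Qed.

Section Polar.
Variables (D : triple R -> R) (D' : triple S -> S).
Hypothesis DD : forall u, phi (D u) = D' (tmap u).
Lemma rmorph_pol1 u v : phi (pol1 D u v) = pol1 D' (tmap u) (tmap v).
Proof. by rewrite /pol1 !(rmorphB, rmorphD) !DD tmap_tadd tmap_tsub. Qed.
Lemma rmorph_pol2 u v : phi (pol2 D u v) = pol2 D' (tmap u) (tmap v).
Proof. by rewrite /pol2 !(rmorphB, rmorphD) !DD tmap_tadd tmap_tsub. Qed.
Lemma tmap_chord u v : tmap (chord D u v) = chord D' (tmap u) (tmap v).
Proof. by rewrite /chord tmap_tsub !tmap_tscale rmorph_pol1 rmorph_pol2. Qed.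
End Polar.

Let rpol := (rmorph_pol1 FF, rmorph_pol1 GG, rmorph_pol2 FF, rmorph_pol2 GG).

Lemma rmorph_m12 u v : phi (m12 F G u v) = m12 F' G' (tmap u) (tmap v).
Proof. by rewrite /m12 rmorphB !rmorphM !rpol. Qed.
Lemma rmorph_m13 u v : phi (m13 F G u v) = m13 F' G' (tmap u) (tmap v).
Proof. by rewrite /m13 rmorphB !rmorphM !rpol !rmorphD FF GG. Qed.
Lemma rmorph_m23 u v : phi (m23 F G u v) = m23 F' G' (tmap u) (tmap v).
Proof. by rewrite /m23 rmorphB !rmorphM !rpol !rmorphD FF GG. Qed.

Lemma tmap_ninth_dir : tmap (ninth_dir_of F G P) = ninth_dir_of F' G' P'.
Proof.
have Epres u v : phi (pres F G u v) = pres F' G' (tmap u) (tmap v).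
  by rewrite /pres rmorphB rmorphXn rmorphM rmorph_m12 rmorph_m13 rmorph_m23.
have Eprod u v : phi (prodbr P u v) = prodbr P' (tmap u) (tmap v).
  by rewrite /prodbr /= !rmorphM rmorph1 !rmorph_br.
by rewrite /ninth_dir_of /ninth_dir tmap_tsub !tmap_tscale !(rmorphM _ (pres _ _ _ _)) !Epres !Eprod.
Qed.

Lemma tmap_ninth : tmap (ninth_of F G P) = ninth_of F' G' P'.
Proof.
by rewrite /ninth_of /ninth tmap_tsub !tmap_tscale rmorph_m12 rmorph_m13 tmap_ninth_dir.
Qed.

Lemma tmap_bar8 : tmap (bar8_of F G P) = bar8_of F' G' P'.
Proof. by rewrite /bar8_of !(tmap_chord FF) tmap_ninth. Qed.
Lemma tmap_bar10 : tmap (bar10_of F G P) = bar10_of F' G' P'.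
Proof. by rewrite /bar10_of !(tmap_chord GG) tmap_ninth. Qed.

Lemma tmap_adjcoord u v w x :
  tmap (adjcoord u v w x) = adjcoord (tmap u) (tmap v) (tmap w) (tmap x).
Proof. by rewrite /adjcoord -!rmorph_br. Qed.

Lemma rmorph_conic5 u v w : phi (conic5 u v w) = conic5 (tmap u) (tmap v) (tmap w).
Proof. by rewrite /conic5 /tmap /= !(rmorphB, rmorphD, rmorphM). Qed.

Lemma rmorph_conic_at u v : phi (conic_at P u v) = conic_at P' (tmap u) (tmap v).
Proof. by rewrite /conic_at rmorph_conic5 !tmap_adjcoord. Qed.

Lemma tmap_twoCremona u v w : tmap (twoCremona u v w) = twoCremona (tmap u) (tmap v) (tmap w).
Proof. by rewrite /twoCremona -rmorph_conic5 /tmap /= !(rmorphM, rmorphB). Qed.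

Lemma tmap_twoCremona_at u v : tmap (twoCremona_at P u v) = twoCremona_at P' (tmap u) (tmap v).
Proof. by rewrite /twoCremona_at tmap_twoCremona !tmap_adjcoord. Qed.

Lemma map_base_conditions u :
  map phi (base_conditions F G P u) = base_conditions F' G' P' (tmap u).
Proof.
rewrite /base_conditions map_cat; congr cat.
  rewrite map_allpairs; apply: eq_allpairs => i j.
  by case: ifP => _; rewrite ?rmorph1 ?rmorph_br.
rewrite map_cat; congr cat.
  by rewrite -map_comp; apply: eq_map => i /=; rewrite rmorph_m12.
rewrite map_cat; congr cat.
  by rewrite -map_comp; apply: eq_map => i /=; rewrite rmorph_conic_at.
by rewrite /= rmorph_br !tmap_twoCremona_at.
Qed.

Lemma map_point_conditions (D : triple R -> R) (D' : triple S -> S) u v :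
  (forall u, phi (D u) = D' (tmap u)) ->
  map phi (point_conditions P D u v) = point_conditions P' D' (tmap u) (tmap v).
Proof.
move=> DD; rewrite /point_conditions map_cat; congr (_ ++ _).
  by rewrite -map_comp; apply: eq_map => i /=; rewrite rmorph_br.
by rewrite /= rmorph_br rmorph_conic_at DD.
Qed.

Lemma map_chord_conditions (D : triple R -> R) (D' : triple S -> S) u v w :
  (forall u, phi (D u) = D' (tmap u)) ->
  map phi (chord_conditions P D u v w) = chord_conditions P' D' (tmap u) (tmap v) (tmap w).
Proof.
move=> DD; rewrite /chord_conditions 2!map_cat; congr (_ ++ (_ ++ _)).
- by rewrite -map_comp; apply: eq_map => i /=; rewrite rmorph_br (tmap_chord DD).
- by rewrite -map_comp; apply: eq_map => i /=; rewrite rmorph_br (tmap_chord DD).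
- by rewrite /= (rmorph_pol1 DD) (tmap_chord DD).
Qed.

Theorem map_conditions : map phi (conditions F G P) = conditions F' G' P'.
Proof.
rewrite /conditions map_cat; congr cat; first by rewrite /= rmorph_m12 tmap_ninth_dir.
rewrite map_cat; congr cat.
  by rewrite -map_comp; apply: eq_map => i /=; rewrite rmorph_br tmap_ninth_dir.
rewrite map_cat; congr cat; first exact: map_base_conditions.
rewrite map_cat; congr cat; first by rewrite map_base_conditions tmap_ninth.
rewrite map_cat; congr cat; first exact: map_point_conditions.
rewrite map_cat; congr cat; first exact: map_point_conditions.
rewrite map_cat; congr cat.
  by rewrite (map_point_conditions _ _ GG) tmap_ninth tmap_bar8.
rewrite map_cat; congr cat.
  by rewrite (map_point_conditions _ _ FF) tmap_ninth tmap_bar10.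
rewrite map_cat; congr cat.
  by rewrite (map_chord_conditions _ _ _ FF) tmap_ninth.
by rewrite (map_chord_conditions _ _ _ GG) tmap_ninth.
Qed.
End Morphism.

(** * Cubics through nine of ten points, by cofactors *)

Section EvaluationMatrix.
Variable R : comNzRingType.
Implicit Types P : nat -> triple R.

Definition evmx P : 'M[R]_10 := \matrix_(i < 10, j < 10) monomial3 j (P i).
(** Cramer's rule without division: column m of the adjugate holds the coefficients of a cubic that
    vanishes at all the points but [P m], where its value is the determinant. *)
Definition cofactor_col P (m : 'I_10) (j : nat) : R := (\adj (evmx P)) (inord j) m.
(* The cubics through [P 0 .. P 8] and through [P 0 .. P 7] and [P 9]. *)
Definition cubicF P := cubic_of (cofactor_col P (inord 9)).
Definition cubicG P := cubic_of (cofactor_col P (inord 8)).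
(** Over a field, a nonzero determinant means that no nonzero cubic passes through all ten
    points. *)
Definition genpoly P : R :=
  \det (evmx P) * foldr *%R 1 (conditions (cubicF P) (cubicG P) P).

Lemma cubic_of_sum (c : nat -> R) (u : triple R) : cubic_of c u = \sum_(j < 10) monomial3 j u * c j.
Proof.
rewrite !big_ord_recl big_ord0 /cubic_of /bump /=; ring.
Qed.

Lemma cubic_of_cofactor P m (i : 'I_10) :
  cubic_of (cofactor_col P m) (P i) = \det (evmx P) *+ (i == m).
Proof.
have := mul_mx_adj (evmx P) => /matrixP /(_ i m); rewrite !mxE => <-.
by rewrite cubic_of_sum; apply: eq_bigr => j _; rewrite !mxE /cofactor_col inord_val mxE.
Qed.
End EvaluationMatrix.

Section EvaluationMorphism.
Variables (R S : comNzRingType) (phi : {rmorphism R -> S}).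
Variable P : nat -> triple R.
Let P' l := tmap phi (P l).

Lemma rmorph_monomial3 j (u : triple R) : phi (monomial3 j u) = monomial3 j (tmap phi u).
Proof. by case: j => [|[|[|[|[|[|[|[|[|j]]]]]]]]] /=; rewrite !rmorphM. Qed.

Lemma map_evmx : map_mx phi (evmx P) = evmx P'.
Proof. by apply/matrixP => i j; rewrite !mxE rmorph_monomial3. Qed.

Lemma rmorph_cubic_of (c : nat -> R) (u : triple R) : phi (cubic_of c u) = cubic_of (phi \o c) (tmap phi u).
Proof. by rewrite /cubic_of !rmorphD !(rmorphM _ (c _)) !rmorph_monomial3. Qed.

Lemma rmorph_cofactor m : phi \o cofactor_col P m =1 cofactor_col P' m.
Proof. by move=> j; rewrite /= /cofactor_col -map_evmx -map_mx_adj [RHS]mxE. Qed.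

Lemma cubic_of_ext (c d : nat -> S) (u : triple S) : c =1 d -> cubic_of c u = cubic_of d u.
Proof. by move=> E; rewrite /cubic_of !E. Qed.

Lemma rmorph_genpoly : phi (genpoly P) = genpoly P'.
Proof.
rewrite /genpoly rmorphM -det_map_mx map_evmx; congr (_ * _).
have -> s : phi (foldr *%R 1 s) = foldr *%R 1 (map phi s).
  by elim: s => [|x s IH] /=; rewrite ?rmorph1 // rmorphM IH.
congr foldr; apply: map_conditions => u.
  by rewrite /cubicF rmorph_cubic_of; apply/cubic_of_ext/rmorph_cofactor.
by rewrite /cubicG rmorph_cubic_of; apply/cubic_of_ext/rmorph_cofactor.
Qed.
End EvaluationMorphism.

Lemma foldr_mul_neq0 (K : fieldType) (s : seq K) :
  (foldr *%R 1 s != 0) = all (fun c => c != 0) s.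
Proof. by elim: s => [|x s IH] /=; rewrite ?oner_neq0 // mulf_eq0 negb_or IH. Qed.

Lemma genpoly_neq0 (K : fieldType) (P : nat -> triple K) : genpoly P != 0 ->
  \det (evmx P) != 0 /\ all (fun c => c != 0) (conditions (cubicF P) (cubicG P) P).
Proof. by rewrite mulf_eq0 negb_or foldr_mul_neq0 => /andP. Qed.

(* A configuration that is generic modulo 31, and the inverse modulo 31 of its evaluation matrix. *)
Definition sample_points : seq (nat * nat * nat) :=
 [:: (1, 0, 0); (0, 1, 0); (1, 1, 1); (2, 5, 7); (2, 9, 7); (3, 1, 6); (9, 8, 6); (0, 0, 1);
  (1, 10, 4); (4, 3, 6)]%N.
Definition sample_inverse : seq (seq nat) :=
 [:: [:: 1; 0; 0; 0; 0; 0; 0; 0; 0; 0];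
   [:: 3; 6; 3; 0; 0; 19; 1; 28; 25; 30];
   [:: 14; 25; 1; 9; 18; 9; 12; 4; 19; 14];
   [:: 26; 0; 20; 14; 3; 8; 29; 13; 14; 27];
   [:: 8; 17; 4; 1; 13; 25; 2; 28; 19; 9];
   [:: 13; 12; 24; 26; 15; 22; 22; 14; 5; 24];
   [:: 0; 1; 0; 0; 0; 0; 0; 0; 0; 0];
   [:: 28; 26; 23; 27; 14; 9; 26; 26; 2; 7];
   [:: 0; 6; 19; 16; 30; 1; 1; 10; 9; 13];
   [:: 0; 0; 0; 0; 0; 0; 0; 1; 0; 0]]%N.
(** Indices from 10 on fall back to 0, as [inord] does, so that the sample equals a [tconf] as a
    function on all of [nat]. *)
Definition sample (R : comNzRingType) (l : nat) : triple R :=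
  let u := nth (0, 0, 0)%N sample_points (if (l < 10)%N then l else 0) in
  (u.1.1%:R, u.1.2%:R, u.2%:R).
Definition sample_inv (R : comNzRingType) (i j : nat) : R :=
  (nth 0 (nth [::] sample_inverse i) j)%:R.

(** The inverse is given as data and checked entry by entry through [cubic_of], so no sum over
    permutations is ever evaluated. *)
Lemma sample_inverseP : evmx (sample 'F_31) *m (\matrix_(i, j) sample_inv 'F_31 i j) = 1%:M.
Proof.
apply/matrixP => i k; rewrite !mxE.
have -> : \sum_j evmx (sample 'F_31) i j * (\matrix_(i0, j0) sample_inv 'F_31 i0 j0) j k =
   cubic_of (fun j => sample_inv 'F_31 j k) (sample 'F_31 i).
  by rewrite cubic_of_sum; apply: eq_bigr => j _; rewrite !mxE.
have H : all (fun i => all (fun k => cubic_of (fun j => sample_inv 'F_31 j k) (sample 'F_31 i)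
    == (i == k)%:R) (iota 0 10)) (iota 0 10) by vm_compute.
apply/eqP; move/allP: H => /(_ i); rewrite mem_iota ltn_ord => /(_ isT).
by move/allP => /(_ k); rewrite mem_iota ltn_ord => /(_ isT).
Qed.

Lemma sample_det : \det (evmx (sample 'F_31)) != 0.
Proof.
have := congr1 (@determinant _ 10) sample_inverseP; rewrite det_mulmx det1 => E.
by apply: contraNneq (oner_neq0 'F_31) => z; rewrite -E z mul0r.
Qed.

Lemma sample_cofactor (m : 'I_10) j : (j < 10)%N ->
  cofactor_col (sample 'F_31) m j = \det (evmx (sample 'F_31)) * sample_inv 'F_31 j m.
Proof.
move=> hj; rewrite /cofactor_col -[\adj _]mulmx1 -sample_inverseP mulmxA mul_adj_mx.
by rewrite mul_scalar_mx !mxE inordK.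
Qed.

(** The conditions are computed for the cubics read off from the inverse matrix. The cofactor cubics
    are their multiples by the determinant, of which only the nonvanishing is known. *)
Lemma sample_generic : genpoly (sample 'F_31) != 0.
Proof.
set d := \det (evmx (sample 'F_31)).
pose F := cubic_of (fun j => sample_inv 'F_31 j 9).
pose G := cubic_of (fun j => sample_inv 'F_31 j 8).
have EF : cubicF (sample 'F_31) = fscale d F.
  apply: functional_extensionality => u; rewrite /fscale /cubicF /F !cubic_of_sum mulr_sumr.
  by apply: eq_bigr => j _; rewrite sample_cofactor // inordK // mulrCA.
have EG : cubicG (sample 'F_31) = fscale d G.
  apply: functional_extensionality => u; rewrite /fscale /cubicG /G !cubic_of_sum mulr_sumr.
  by apply: eq_bigr => j _; rewrite sample_cofactor // inordK // mulrCA.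
rewrite /genpoly mulf_neq0 ?sample_det // foldr_mul_neq0 EF EG.
have two : (2%:R : 'F_31) != 0 by vm_compute.
have HF : cubic F by exists (fun j => sample_inv 'F_31 j 9).
have HG : cubic G by exists (fun j => sample_inv 'F_31 j 8).
have F0 i : (i < 8)%N -> F (sample 'F_31 i) = 0.
  have H : all (fun i => F (sample 'F_31 i) == 0) (iota 0 8) by vm_compute.
  by move=> hi; apply/eqP; move/allP: H => /(_ i); rewrite mem_iota; apply.
have G0 i : (i < 8)%N -> G (sample 'F_31 i) = 0.
  have H : all (fun i => G (sample 'F_31 i) == 0) (iota 0 8) by vm_compute.
  by move=> hi; apply/eqP; move/allP: H => /(_ i); rewrite mem_iota; apply.
have gen : all (fun c => c != 0) (conditions F G (sample 'F_31)) by vm_compute.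
exact: (conditions_fscale two HF HG F0 G0 gen sample_det sample_det).
Qed.

(** The integer value at the sample reduces to a nonzero class modulo 31, hence is nonzero, and
    characteristic zero preserves this. *)
Lemma genpoly_CC : genpoly (sample CC) != 0.
Proof.
have tm (R : comNzRingType) (phi : {rmorphism int -> R}) :
    (fun l => tmap phi (sample int l)) = sample R.
  by apply: functional_extensionality => l; rewrite /tmap /sample /= !rmorph_nat.
pose phi31 : {rmorphism int -> 'F_31} := intr.
pose phiC : {rmorphism int -> CC} := intr.
have hz : genpoly (sample int) != 0.
  apply: contraNneq sample_generic => z.
  by rewrite -(tm _ phi31) -rmorph_genpoly z rmorph0.
rewrite -(tm _ phiC) -rmorph_genpoly.
by rewrite [phiC _ == 0](intr_eq0 (Rdefinitions.R)[i]).
Qed.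

(** The numbering of the variables matches [flat], so evaluation there gives the configuration
    back. *)
Definition generic_config (l : nat) : triple {mpoly CC[30]} :=
  let k := (3 * (inord l : 'I_10))%N in ('X_(inord k), 'X_(inord k.+1), 'X_(inord k.+2)).

Lemma meval_generic_config (P : config) :
  (fun l => tmap (meval (flat P)) (generic_config l)) = tconf P.
Proof.
apply: functional_extensionality => l; rewrite /generic_config /tmap /= !mevalXU /flat.
set m := (inord l : 'I_10).
have hm : (3 * m + 3 <= 30)%N by rewrite -mulnSr (leq_mul2l 3 m.+1 10) ltn_ord.
have k r : (r < 3)%N -> (inord (3 * m + r) : 'I_30) = (3 * m + r)%N :> nat.
  by move=> hr; rewrite inordK // (leq_trans _ hm) // ltn_add2l.
have e0 := k 0%N isT; have e1 := k 1%N isT; have e2 := k 2%N isT.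
rewrite addn0 in e0; rewrite addn1 in e1; rewrite addn2 in e2.
have q r : (r < 3)%N -> ((3 * m + r) %/ 3 = m)%N /\ ((3 * m + r) %% 3 = r)%N.
  move=> hr; rewrite (mulnC 3) divnMDl // divn_small // addn0.
  by rewrite -modnDml modnMl add0n modn_small.
have [q0 r0] := q 0%N isT; have [q1 r1] := q 1%N isT; have [q2 r2] := q 2%N isT.
rewrite addn0 in q0 r0; rewrite addn1 in q1 r1; rewrite addn2 in q2 r2.
by rewrite e0 e1 e2 q0 r0 q1 r1 q2 r2 inord_val.
Qed.

Definition generic_poly : {mpoly CC[30]} := genpoly generic_config.

Lemma generic_polyE (P : config) : generic_poly.@[flat P] = genpoly (tconf P).
Proof. by rewrite -meval_generic_config -rmorph_genpoly. Qed.

Lemma generic_poly_neq0 : generic_poly != 0.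
Proof.
apply: contraNneq genpoly_CC => z.
pose P0 : config := fun l => vec_of (sample CC l).
have -> : sample CC = tconf P0.
  apply: functional_extensionality => l; rewrite /tconf /P0 vec_ofK.
  case: (ltnP l 10) => h; first by rewrite inordK.
  have -> : inord l = ord0 :> 'I_10.
    by apply: val_inj; rewrite /inord /insubd insubN // -leqNgt.
  by rewrite /sample ltnNge h.
by rewrite -generic_polyE z meval0.
Qed.

(** Exchanging the two ends exchanges [pol1] and [pol2] when F vanishes at both. *)
Lemma chord_sym (K : fieldType) (F : triple K -> K) u v : cubic F -> F u = 0 -> F v = 0 ->
  chord F u v = tscale (-1) (chord F v u).
Proof.
move=> HF Fu Fv.
have odd w : F (tscale (-1) w) = - F w by rewrite cubic_tscale //; ring.
have E : tsub v u = tscale (-1) (tsub u v) by rewrite /tsub /tscale /=; congr (_, _, _); ring.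
have E' : tadd v u = tadd u v by rewrite /tadd; congr (_, _, _); exact: addrC.
have E1 : pol1 F v u = pol2 F u v.
  by rewrite /pol1 /pol2 E E' odd Fu; ring.
have E2 : pol2 F v u = pol1 F u v.
  by rewrite /pol1 /pol2 E E' odd Fv; ring.
rewrite /chord E1 E2 /tsub /tscale /=; congr (_, _, _); ring.
Qed.

Lemma two_CC : (2%:R : CC) != 0. Proof. exact: natCC_neq0. Qed.

Lemma evE (f : tform) x : ev f x = cub_fun f (tri_of x).
Proof. by rewrite /cub_fun tri_ofK. Qed.

Lemma third_point_chord (D : tform) p q r : third_point D p q r ->
  exists2 k, k != 0 & tri_of r = tscale k (chord (cub_fun D) (tri_of p) (tri_of q)).
Proof.
move=> [a [b [c [c0 [[_ [k [k0 ->]]] E]]]]].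
have Fst s t : cub_fun D (tadd (tscale s (tri_of p)) (tscale t (tri_of q))) = c * s * t * (b * s - a * t).
  by rewrite -!tri_ofZ -tri_ofD -evE E.
have E1 : tadd (tri_of p) (tri_of q) = tadd (tscale 1 (tri_of p)) (tscale 1 (tri_of q)).
  by rewrite /tadd /tscale /= !mul1r.
have E2 : tsub (tri_of p) (tri_of q) = tadd (tscale 1 (tri_of p)) (tscale (-1) (tri_of q)).
  by rewrite /tsub /tadd /tscale /= !mul1r !mulN1r.
have E3 : cub_fun D (tri_of q) = 0.
  by rewrite -[tri_of q](_ : tadd (tscale 0 (tri_of p)) (tscale 1 (tri_of q)) = _) ?Fst ?mulr0 ?mul0r //
    /tadd /tscale /= !mul0r !mul1r !add0r.
(* Comparing restrictions gives [pol1] = 2cb and [pol2] = -2ca, so the chord is -2c times a p + b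
   q. *)
exists (- k / (2%:R * c)).
  by rewrite mulf_neq0 ?oppr_eq0 // invr_neq0 // mulf_neq0 // two_CC.
rewrite /chord /pol1 /pol2 E3 E1 E2 !Fst !tri_ofZ tri_ofD !tri_ofZ /tsub /tadd /tscale /=.
have t0 := two_CC.
by congr (_, _, _); field; rewrite ?t0 ?c0.
Qed.

Lemma chord_third_point (D : tform) p q k : cubic (cub_fun D) ->
  cub_fun D p = 0 -> cub_fun D q = 0 -> chord (cub_fun D) p q != (0, 0, 0) -> k != 0 ->
  forall r, tri_of r = tscale k (chord (cub_fun D) p q) -> third_point D (vec_of p) (vec_of q) r.
Proof.
move=> HD Dp Dq ch k0 r Er; set F := cub_fun D in HD Dp Dq ch Er *.
have half0 : (- 2%:R^-1 : CC) != 0 by rewrite oppr_eq0 invr_neq0 // two_CC.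
exists (pol2 F p q), (- pol1 F p q), (- 2%:R^-1); split=> //.
have Ech : tri_of (pol2 F p q *: vec_of p + - pol1 F p q *: vec_of q) = chord F p q.
  rewrite tri_ofD !tri_ofZ !vec_ofK /chord /tadd /tsub /tscale /=; congr (_, _, _); ring.
split.
  split; first by apply: contraNneq ch => z; rewrite -Ech z tri_of0.
  by exists k; split=> //; apply: (can_inj tri_ofK); rewrite tri_ofZ Ech.
move=> s t; rewrite evE -/F tri_ofD !tri_ofZ !vec_ofK.
apply: (mulfI two_CC); rewrite mulr_natl cubic_line // Dq mul0rn mulr0 addr0.
have t0 := two_CC.
by field.
Qed.

(** * Transfer to the given curves *)

Section Main.
Variables (P : config) (C0 C : tform).
Hypothesis gpos : general_position P.
Hypothesis gen : generic_poly.@[flat P] != 0.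
Hypotheses (H0 : is_cubic C0) (H1 : is_cubic C).
Hypothesis on0 : forall l : 'I_10, (l <= 8)%N -> on_curve C0 (P l).
Hypothesis on1 : forall l : 'I_10, (l <= 7)%N \/ l = o10 9 -> on_curve C (P l).

Let T := tconf P.
Let F := cubicF T.
Let G := cubicG T.
Let d := \det (evmx T).
Let d0 : d != 0. Proof. by move: gen; rewrite generic_polyE => /genpoly_neq0 []. Qed.
Let cond : all (fun c => c != 0) (conditions F G T).
Proof. by move: gen; rewrite generic_polyE => /genpoly_neq0 []. Qed.
Let HF : cubic F. Proof. by exists (cofactor_col T (inord 9)). Qed.
Let HG : cubic G. Proof. by exists (cofactor_col T (inord 8)). Qed.

Let FT i : (i < 10)%N -> F (T i) = d *+ (i == 9).
Proof.
move=> hi; have := cubic_of_cofactor T (inord 9) (inord i : 'I_10).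
by rewrite -val_eqE /= !inordK.
Qed.
Let GT i : (i < 10)%N -> G (T i) = d *+ (i == 8).
Proof.
move=> hi; have := cubic_of_cofactor T (inord 8) (inord i : 'I_10).
by rewrite -val_eqE /= !inordK.
Qed.

Let F0 i : (i < 8)%N -> F (T i) = 0.
Proof. by move=> hi; rewrite FT ?(ltn_trans hi) //; case: i hi => [|[|[|[|[|[|[|[|]]]]]]]]. Qed.
Let G0 i : (i < 8)%N -> G (T i) = 0.
Proof. by move=> hi; rewrite GT ?(ltn_trans hi) //; case: i hi => [|[|[|[|[|[|[|[|]]]]]]]]. Qed.
Let F8 : F (T 8) = 0. Proof. by rewrite FT. Qed.
Let G9 : G (T 9) = 0. Proof. by rewrite GT. Qed.

(** The adjugate applied to the ten values of E returns its coefficients times [d], and only the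
    last two values survive. So F and G span the cubics through the first eight points, and C0 and C
    are multiples of F and G. *)
Lemma cubic_decomp (E : tform) : E \is 3.-homog -> (forall i, (i < 8)%N -> cub_fun E (T i) = 0) ->
  (forall j, (j < 10)%N -> d * E@_(mon3 j) =
    cofactor_col T (inord 8) j * cub_fun E (T 8) + cofactor_col T (inord 9) j * cub_fun E (T 9)).
Proof.
move=> hE E0 j hj.
pose e : 'cV[CC]_10 := \col_k E@_(mon3 k).
have val i : (evmx T *m e) i 0 = cub_fun E (T i).
  by rewrite mxE cub_funE // cubic_of_sum; apply: eq_bigr => k _; rewrite !mxE.
have : ((\adj (evmx T)) *m (evmx T *m e)) (inord j) 0 = d * E@_(mon3 j).
  by rewrite mulmxA mul_adj_mx mul_scalar_mx !mxE inordK.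
move=> <-; rewrite mxE (bigD1 (inord 8)) //= (bigD1 (inord 9)) /=; last first.
  by rewrite -val_eqE /= !inordK.
rewrite big1 ?addr0 => [|i /andP [i8 i9]].
  by rewrite !val /cofactor_col !inordK.
rewrite val E0 ?mulr0 //; move: i8 i9; rewrite -!val_eqE /= !inordK //.
by case: i => [[|[|[|[|[|[|[|[|[|[|]]]]]]]]]]].
Qed.

Lemma cubic_decomp_fun (E : tform) : E \is 3.-homog ->
  (forall i, (i < 8)%N -> cub_fun E (T i) = 0) ->
  forall u, d * cub_fun E u = cub_fun E (T 8) * G u + cub_fun E (T 9) * F u.
Proof.
move=> hE E0 u; rewrite cub_funE // cubic_of_sum mulr_sumr.
rewrite /F /G /cubicF /cubicG !cubic_of_sum !mulr_sumr -big_split /=.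
apply: eq_bigr => j _; rewrite mulrCA cubic_decomp //; ring.
Qed.

Let onC0 i : (i < 9)%N -> cub_fun C0 (T i) = 0.
Proof.
move=> hi; have [|_] := @on0 (inord i); last by rewrite evE.
by rewrite inordK // (ltn_trans hi).
Qed.
Let onC i : (i < 8)%N -> cub_fun C (T i) = 0.
Proof.
move=> hi; have [|_] := @on1 (inord i); last by rewrite evE.
by left; rewrite inordK // (ltn_trans hi).
Qed.
Let onC9 : cub_fun C (T 9) = 0.
Proof. by have [|_] := @on1 (o10 9); [right | rewrite evE]. Qed.

Let hC0 : C0 \is 3.-homog. Proof. by case: H0. Qed.
Let hC : C \is 3.-homog. Proof. by case: H1. Qed.

Let lam_ex : exists2 l, l != 0 & cub_fun C0 = fscale l F.
Proof.
exists (cub_fun C0 (T 9) / d).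
  rewrite mulf_neq0 ?invr_neq0 //; case: H0 => nz _; apply: contraNneq nz => z; apply/eqP.
  apply: form_eq0 => // j hj; apply: (mulfI d0).
  rewrite cubic_decomp // => [|i hi]; last by rewrite onC0 // ltnW.
  by rewrite (onC0 (isT : 8 < 9)%N) z !mulr0 addr0.
apply: functional_extensionality => u; apply: (mulfI d0).
rewrite cubic_decomp_fun // => [|i hi]; last by rewrite onC0 // ltnW.
by rewrite (onC0 (isT : 8 < 9)%N) mul0r add0r /fscale mulrA (mulrC d) divfK.
Qed.

Let mu_ex : exists2 m, m != 0 & cub_fun C = fscale m G.
Proof.
exists (cub_fun C (T 8) / d).
  rewrite mulf_neq0 ?invr_neq0 //; case: H1 => nz _; apply: contraNneq nz => z; apply/eqP.
  apply: form_eq0 => // j hj; apply: (mulfI d0).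
  by rewrite cubic_decomp // onC9 z !mulr0 addr0.
apply: functional_extensionality => u; apply: (mulfI d0).
by rewrite cubic_decomp_fun // onC9 mul0r addr0 /fscale mulrA (mulrC d) divfK.
Qed.

Let gpT i j k : (i < 10)%N -> (j < 10)%N -> (k < 10)%N -> i != j -> j != k -> i != k ->
  br (T i) (T j) (T k) != 0.
Proof.
move=> hi hj hk ij jk ik; rewrite -det_rows3; apply: gpos; rewrite -[inord _]/(o10 _) o10_eq //.
Qed.

Let gp3 i j k : (i < j)%N -> (j < k)%N -> (k < 7)%N -> br (T i) (T j) (T k) != 0.
Proof.
move=> ij jk k7; have k10 := ltn_trans k7 (isT : 7 < 10)%N.
have j10 := ltn_trans jk k10; have i10 := ltn_trans ij j10.
by apply: gpT => //; rewrite neq_ltn ?ij ?jk // (ltn_trans ij jk).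
Qed.

Let b := ninth_of F G T.
Let y8 := chord F (T 7) (T 8).
Let y9 := chord G (T 7) (T 9).
Let b8 := bar8_of F G T.
Let b10 := bar10_of F G T.

Let Fb : F b = 0. Proof. by case: (ninth_of_zero two_CC HF HG F0 G0 cond). Qed.
Let Gb : G b = 0. Proof. by case: (ninth_of_zero two_CC HF HG F0 G0 cond). Qed.

Let splitc := split_conditions cond.
Let bpT : forall i, (i < 7)%N -> br (T i) b (T 7) != 0.
Proof. by case: splitc => mw wp _ _ _; exact: (br_ninth mw wp). Qed.
Let gpb : forall i j, (i < 7)%N -> (j < 7)%N -> i != j -> br (T i) (T j) b != 0.
Proof. by case: splitc => _ _ [_ /base_conditionsP [H _ _ _]] _ _. Qed.
Let cc8 : [/\ forall r, (r < 3)%N -> br y8 (T (4 + r)) (T 7) != 0,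
  forall r, (r < 3)%N -> br y8 (T (4 + r)) b != 0 & pol1 F b y8 != 0].
Proof. by case: splitc => _ _ _ _ [_ [/chord_conditionsP]]. Qed.
Let cc9 : [/\ forall r, (r < 3)%N -> br y9 (T (4 + r)) (T 7) != 0,
  forall r, (r < 3)%N -> br y9 (T (4 + r)) b != 0 & pol1 G b y9 != 0].
Proof. by case: splitc => _ _ _ _ [_ [_ /chord_conditionsP]]. Qed.
Let pb8 : forall i, (i < 4)%N -> br b8 (T i) b != 0.
Proof. by case: splitc => _ _ _ _ [[/point_conditionsP [H _ _ _] _] _]. Qed.
Let pb10 : forall i, (i < 4)%N -> br b10 (T i) b != 0.
Proof. by case: splitc => _ _ _ _ [[_ /point_conditionsP [H _ _ _]] _]. Qed.

Let brl0 v w : br (0, 0, 0) v w = 0 :> CC. Proof. rewrite /br /=; ring. Qed.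
Let br_neq0 u v w : br u v w != 0 -> u != (0, 0, 0) :> triple CC.
Proof. by apply: contraNneq => ->; rewrite brl0. Qed.

Let y8nz : y8 != (0, 0, 0). Proof. by case: cc8 => /(_ 0%N isT) /br_neq0. Qed.
Let y9nz : y9 != (0, 0, 0). Proof. by case: cc9 => /(_ 0%N isT) /br_neq0. Qed.
Let b8nz : b8 != (0, 0, 0). Proof. exact: br_neq0 (pb8 (isT : 0 < 4)%N). Qed.
Let b10nz : b10 != (0, 0, 0). Proof. exact: br_neq0 (pb10 (isT : 0 < 4)%N). Qed.
Let bnz : b != (0, 0, 0).
Proof.
by apply: contraNneq (bpT (isT : 0 < 7)%N) => ->; rewrite /br /=; apply/eqP; ring.
Qed.

Let Fy8 : F y8 = 0. Proof. exact: (chord_zero two_CC HF (F0 (isT : 7 < 8)%N) F8). Qed.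
Let Gy9 : G y9 = 0. Proof. exact: (chord_zero two_CC HG (G0 (isT : 7 < 8)%N) G9). Qed.
Let Fb8 : F b8 = 0. Proof. exact: (chord_zero two_CC HF Fb Fy8). Qed.
Let Gb10 : G b10 = 0. Proof. exact: (chord_zero two_CC HG Gb Gy9). Qed.

Let Tnz i : (i < 10)%N -> T i != (0, 0, 0).
Proof.
move=> hi; have [j [k [hj hk h]]] : exists j k, [/\ (j < 10)%N, (k < 10)%N & [&& i != j, j != k & i != k]].
  by case: i hi => [|[|i]] _; [exists 1%N, 2%N | exists 0%N, 2%N | exists 0%N, 1%N].
by case/and3P: h => ij jk ik; apply: (@br_neq0 _ (T j) (T k)); exact: gpT.
Qed.

Let Pvec l : P l = vec_of (T l). Proof. by rewrite /T /tconf inord_val tri_ofK. Qed.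
Let Pnz l : P l != 0. Proof. by rewrite Pvec vec_of_neq0 // Tnz. Qed.

Let fC0 u : (cub_fun C0 u == 0) = (F u == 0).
Proof. by have [l l0 ->] := lam_ex; rewrite /fscale mulf_eq0 (negbTE l0). Qed.
Let fC u : (cub_fun C u == 0) = (G u == 0).
Proof. by have [l l0 ->] := mu_ex; rewrite /fscale mulf_eq0 (negbTE l0). Qed.

Let tscale_eq (k : CC) x u : tri_of x = tscale k u -> x = k *: vec_of u.
Proof. by move=> E; apply: (can_inj tri_ofK); rewrite tri_ofZ vec_ofK. Qed.

Lemma proj_eq_scale (k : CC) u x : u != (0, 0, 0) -> k != 0 -> x = k *: vec_of u ->
  proj_eq (vec_of u) x.
Proof. by move=> u0 k0 ->; split; [exact: vec_of_neq0 | exists k]. Qed.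

Let nine_lt x (l : 'I_9) : (l < 8)%N -> nine P x l = vec_of (T l).
Proof. by move=> hl; rewrite /nine ltn_eqF // Pvec inordK // (ltn_trans hl). Qed.

Lemma common_zeros pb9 (k : CC) : k != 0 -> pb9 = k *: vec_of b -> forall x, x != 0 ->
  (ev C0 x = 0 /\ ev C x = 0 <-> exists l : 'I_9, proj_eq (nine P pb9 l) x).
Proof.
move=> k0 Epb x x0; split.
  rewrite !evE => -[/eqP + /eqP]; rewrite fC0 fC => /eqP Fx /eqP Gx.
  have [[i hi [m Em]]|[m Em]] := ninth_of_base two_CC HF HG F0 G0 cond Fx Gx.
    exists (inord i); rewrite nine_lt; last by rewrite inordK // (ltn_trans hi).
    rewrite inordK ?(ltn_trans hi) //.
    have Ex := tscale_eq Em; apply: (proj_eq_scale (k := m)) => //.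
      by rewrite Tnz // (ltn_trans hi).
    by apply: contraNneq x0 => m0; rewrite Ex m0 scale0r.
  exists (inord 8); rewrite /nine inordK //=; have Ex := tscale_eq Em.
  split; first by rewrite Epb scaler_eq0 negb_or k0 vec_of_neq0.
  exists (m / k); split.
    rewrite mulf_neq0 ?invr_neq0 //; apply: contraNneq x0 => m0.
    by rewrite Ex m0 scale0r.
  by rewrite Epb scalerA divfK.
move=> [l [_ [m [m0 ->]]]].
have H u : F u = 0 -> G u = 0 -> ev C0 (m *: vec_of u) = 0 /\ ev C (m *: vec_of u) = 0.
  move=> Fu Gu; rewrite !evE tri_ofZ vec_ofK.
  by split; apply/eqP; rewrite ?fC0 ?fC cubic_tscale ?Fu ?Gu ?mulr0.
case: (ltnP l 8) => l8.
  by rewrite nine_lt //; apply: H; [exact: F0 | exact: G0].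
have l8' : (l : nat) == 8%N by rewrite eqn_leq l8 andbT -ltnS.
rewrite /nine l8' Epb scalerA.
have [Z1 Z2] := H _ Fb Gb.
split; apply/eqP; rewrite evE tri_ofZ vec_ofK ?fC0 ?fC cubic_tscale ?Fb ?Gb ?mulr0 //.
Qed.

Let chordC0 u v : exists2 l, l != 0 & chord (cub_fun C0) u v = tscale l (chord F u v).
Proof. by have [l l0 ->] := lam_ex; exists l; rewrite // chord_fscale. Qed.
Let chordC u v : exists2 l, l != 0 & chord (cub_fun C) u v = tscale l (chord G u v).
Proof. by have [l l0 ->] := mu_ex; exists l; rewrite // chord_fscale. Qed.

Let tt (k m : CC) v : tscale k (tscale m v) = tscale (k * m) v.
Proof. by rewrite /tscale /= !mulrA. Qed.
Let one v : tscale 1 v = v :> triple CC.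
Proof. by case: v => [[? ?] ?]; rewrite /tscale /= !mul1r. Qed.

Let tscale_neq0 (k : CC) u : k != 0 -> u != (0, 0, 0) -> tscale k u != (0, 0, 0).
Proof.
move=> k0; apply: contraNneq => E.
have -> : u = tscale k^-1 (tscale k u).
  by rewrite tt mulVf // one.
by rewrite E /tscale /= !mulr0.
Qed.

Lemma third_point_C0 u v y (m : CC) : F u = 0 -> F v = 0 -> chord F u v = tscale m y -> m != 0 ->
  y != (0, 0, 0) -> third_point C0 (vec_of u) (vec_of v) (vec_of y).
Proof.
move=> Fu Fv E m0 y0; have [l l0 El] := chordC0 u v.
have lm0 : l * m != 0 by rewrite mulf_neq0.
apply: (@chord_third_point _ _ _ (l * m)^-1) => //.
- exact: cubic_cub_fun.
- by apply/eqP; rewrite fC0 Fu.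
- by apply/eqP; rewrite fC0 Fv.
- by rewrite El E tt tscale_neq0.
- by rewrite invr_neq0.
- by rewrite vec_ofK El E !tt -mulrA mulVf // one.
Qed.
Lemma third_point_C u v y (m : CC) : G u = 0 -> G v = 0 -> chord G u v = tscale m y -> m != 0 ->
  y != (0, 0, 0) -> third_point C (vec_of u) (vec_of v) (vec_of y).
Proof.
move=> Gu Gv E m0 y0; have [l l0 El] := chordC u v.
have lm0 : l * m != 0 by rewrite mulf_neq0.
apply: (@chord_third_point _ _ _ (l * m)^-1) => //.
- exact: cubic_cub_fun.
- by apply/eqP; rewrite fC Gu.
- by apply/eqP; rewrite fC Gv.
- by rewrite El E tt tscale_neq0.
- by rewrite invr_neq0.
- by rewrite vec_ofK El E !tt -mulrA mulVf // one.
Qed.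

Let conf_o10 i : (i < 10)%N -> P (o10 i) = vec_of (T i).
Proof. by move=> hi; rewrite Pvec /o10 inordK. Qed.

Lemma bar_exists : bar_conditions P C0 C (vec_of b8) (vec_of b) (vec_of b10).
Proof.
have [_ _ f8] := cc8; have [_ _ f9] := cc9.
split; [|split; [|split; [|split; [|split]]]].
- by split; [exact: vec_of_neq0 | rewrite evE vec_ofK; apply/eqP; rewrite fC0 Fb8].
- by split; [exact: vec_of_neq0 | rewrite evE vec_ofK; apply/eqP; rewrite fC0 Fb].
- by split; [exact: vec_of_neq0 | rewrite evE vec_ofK; apply/eqP; rewrite fC Gb10].
- exists C0, C; split=> //; split=> //; split; last first.
    by apply: (@common_zeros _ 1); rewrite ?oner_neq0 // scale1r.
  move=> al be E.
  have H u : al * cub_fun C0 u + be * cub_fun C u = 0.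
    have : ev (al *: C0 + be *: C) (vec_of u) = 0 by rewrite E /ev meval0.
    by rewrite /ev mevalD !mevalZ.
  split.
    have := H (T 9); rewrite onC9 mulr0 addr0 => /eqP; rewrite mulf_eq0 fC0 FT //= mulr1n.
    by rewrite (negbTE d0) orbF => /eqP.
  have := H (T 8); rewrite (onC0 (isT : 8 < 9)%N) mulr0 add0r => /eqP.
  by rewrite mulf_eq0 fC GT //= mulr1n (negbTE d0) orbF => /eqP.
- exists (vec_of y8); split.
    apply: (@third_point_C0 _ _ _ (- - pol1 F b y8 ^+ 3)) => //.
      rewrite chord_sym // [chord F b b8]chord_chord // tt; congr (tscale _ _); ring.
    by rewrite opprK expf_neq0.
  rewrite !conf_o10 //; apply: (@third_point_C0 _ _ _ 1); rewrite ?oner_neq0 ?one //.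
  exact: F0.
exists (vec_of y9); split.
  apply: (@third_point_C _ _ _ (- pol1 G b y9 ^+ 3)) => //; first exact: chord_chord.
  by rewrite oppr_eq0 expf_neq0.
rewrite !conf_o10 //; apply: (@third_point_C _ _ _ 1); rewrite ?oner_neq0 ?one //.
exact: G0.
Qed.

(** The pencil of condition (1) is arbitrary, but its members pass through the first eight points,
    hence are combinations of F and G and vanish at [b]. So [b] is one of the nine listed points,
    and the brackets with [b] separate it from the first eight; this determines [q9]. The two sums
    then determine [q8] and [q10] by [chord_unique]. *)
Lemma bar_unique q8 q9 q10 : bar_conditions P C0 C q8 q9 q10 ->
  exists k8 k9 k10 : CC, [/\ [/\ k8 != 0, k9 != 0 & k10 != 0], q8 = k8 *: vec_of b8,
    q9 = k9 *: vec_of b & q10 = k10 *: vec_of b10].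
Proof.
move=> [[q80 on8] [[q90 _] [[q100 on10] [pen [[r [t1 t2]] [r' [t3 t4]]]]]]].
have [nb8 nb8' f8] := cc8; have [nb9 nb9' f9] := cc9.
have Fq8 : F (tri_of q8) = 0 by apply/eqP; rewrite -fC0 -evE on8.
have Gq10 : G (tri_of q10) = 0 by apply/eqP; rewrite -fC -evE on10.
have [k9 k90 E9] : exists2 k : CC, k != 0 & tri_of q9 = tscale k b.
  have [E1 [E2 [[_ h1] [[_ h2] [_ Z]]]]] := pen.
  have van i : (i < 8)%N -> cub_fun E1 (T i) = 0 /\ cub_fun E2 (T i) = 0.
    move=> hi; have x0 : vec_of (T i) != 0 by rewrite vec_of_neq0 // Tnz // (ltn_trans hi).
    rewrite -{1}(vec_ofK (T i)) -{2}(vec_ofK (T i)) -!evE; apply/(Z _ x0).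
    exists (inord i); rewrite nine_lt; last by rewrite inordK // (ltn_trans hi).
    rewrite inordK ?(ltn_trans hi) //; split=> //.
    by exists 1; rewrite oner_neq0 scale1r.
  have zb E : E \is 3.-homog -> (forall i, (i < 8)%N -> cub_fun E (T i) = 0) -> ev E (vec_of b) = 0.
    move=> hE vE; rewrite evE vec_ofK; apply: (mulfI d0).
    by rewrite cubic_decomp_fun // Fb Gb !mulr0 addr0.
  have b0 := vec_of_neq0 bnz.
  have [] := (Z _ b0).1.
    by split; apply: zb => // i hi; have [] := van i hi.
  move=> l [_ [m [m0 Em]]]; case: (ltnP l 8) => l8.
    rewrite nine_lt // in Em; have Eb : b = tscale m (T l).
      by rewrite -(vec_ofK b) Em tri_ofZ vec_ofK.
    case: (ltngtP l 7) => l7.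
    - have := bpT l7; rewrite Eb /br /tscale /= => /eqP []; ring.
    - by move: l8; rewrite ltnS leqNgt l7.
    - have := bpT (isT : 0 < 7)%N; rewrite Eb l7 /br /tscale /= => /eqP []; ring.
  have l8' : (l : nat) == 8%N by rewrite eqn_leq l8 andbT -ltnS.
  exists m^-1; first by rewrite invr_neq0.
  rewrite -(vec_ofK b) Em /nine l8' tri_ofZ tt mulVf //; exact/esym/one.
have [k1 k10 K1] := third_point_chord t1; have [k2 k20 K2] := third_point_chord t2.
have [k3 k30 K3] := third_point_chord t3; have [k4 k40 K4] := third_point_chord t4.
have [l1 l10 L1] := chordC0 (tri_of q8) (tri_of q9).
have [l2 l20 L2] := chordC0 (T 7) (T 8).
have [l3 l30 L3] := chordC (tri_of q9) (tri_of q10).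
have [l4 l40 L4] := chordC (T 7) (T 9).
have inv (k m : CC) u v : k != 0 -> tscale k u = tscale m v -> u = tscale (k^-1 * m) v.
  by move=> k0 E; rewrite -tt -E tt mulVf // one.
rewrite L1 E9 in K1.
have c1 : chord F (tri_of q8) (tscale k9 b) = tscale (k9 ^+ 2) (chord F (tri_of q8) b).
  by rewrite -{1}(one (tri_of q8)) chord_tscale // expr1n mul1r.
rewrite c1 !tt in K1.
rewrite !conf_o10 // !vec_ofK in K2 K4.
rewrite L2 tt K1 in K2.
have nz1 : k1 * l1 * k9 ^+ 2 != 0 by rewrite !mulf_neq0 // expf_neq0.
have C8 := inv _ _ _ _ nz1 K2.
have [m8 m80 M8] := chord_unique two_CC HF Fb Fy8 Fq8 (nb8' 0%N isT) f8
  (mulf_neq0 (invr_neq0 nz1) (mulf_neq0 k20 l20)) C8.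
rewrite L3 E9 in K3.
have c3 : chord G (tscale k9 b) (tri_of q10) = tscale (- k9 ^+ 2) (chord G (tri_of q10) b).
  rewrite -{1}(one (tri_of q10)) chord_tscale // expr1n mulr1 chord_sym // tt mulrN1 //.
rewrite c3 !tt in K3; rewrite L4 tt K3 in K4.
have nz3 : k3 * l3 * - k9 ^+ 2 != 0 by rewrite !mulf_neq0 // oppr_eq0 expf_neq0.
have C10 := inv _ _ _ _ nz3 K4.
have [m10 m100 M10] := chord_unique two_CC HG Gb Gy9 Gq10 (nb9' 0%N isT) f9
  (mulf_neq0 (invr_neq0 nz3) (mulf_neq0 k40 l40)) C10.
by exists m8, k9, m10; split=> //; apply: tscale_eq.
Qed.

Let swp (l : nat) := if l == 7%N then 8%N else if l == 8%N then 7%N else l.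

Lemma T89_bar q8 q9 q10 (k8 k9 k10 : CC) : k8 != 0 -> k9 != 0 -> k10 != 0 ->
  q8 = k8 *: vec_of b8 -> q9 = k9 *: vec_of b -> q10 = k10 *: vec_of b10 ->
  X_eq (T89 P) (replace3 P q8 q9 q10).
Proof.
move=> k80 k90 k100 E8 E9 E10.
have [X5 n1 [n2 n3 n4 n5]] := bar_config_eq two_CC HF HG F0 G0 F8 G9 gp3 cond.
apply: X_eq_of.
  move=> l; rewrite /replace3; case: (l =P o10 7) => _.
    by rewrite E8 scaler_eq0 negb_or k80 vec_of_neq0.
  case: (l =P o10 8) => _; first by rewrite E9 scaler_eq0 negb_or k90 vec_of_neq0.
  case: (l =P o10 9) => _; first by rewrite E10 scaler_eq0 negb_or k100 vec_of_neq0.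
  exact: Pnz.
pose P1 := cremona (o10 0) (o10 1) (o10 7) P.
pose P2 := cremona (o10 2) (o10 3) (o10 7) P1.
pose P3 := cremona (o10 4) (o10 5) (o10 6) P2.
pose P4 := cremona (o10 2) (o10 3) (o10 7) P3.
pose P5 := cremona (o10 0) (o10 1) (o10 7) P4.
have S1 l : (l < 10)%N -> tconf P1 l = crem3 0 1 7 T l.
  by move=> hl; exact: (@cremonaE 0 1 7 P l isT isT isT hl n1).
have S2 l : (l < 10)%N -> tconf P2 l = crem2 T l.
  have n : br (tconf P1 2) (tconf P1 3) (tconf P1 7) != 0.
    by rewrite (S1 2 isT) (S1 3 isT) (S1 7 isT); exact: n2.
  move=> hl; rewrite (@cremonaE 2 3 7 P1 l isT isT isT hl n).
  exact: (@crem3_ext 2 3 7 (tconf P1) (crem3 0 1 7 T) isT isT isT S1 l hl).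
have S3 l : (l < 10)%N -> tconf P3 l = crem3 4 5 6 (crem2 T) l.
  have n : br (tconf P2 4) (tconf P2 5) (tconf P2 6) != 0.
    by rewrite (S2 4 isT) (S2 5 isT) (S2 6 isT); exact: n3.
  move=> hl; rewrite (@cremonaE 4 5 6 P2 l isT isT isT hl n).
  exact: (@crem3_ext 4 5 6 (tconf P2) (crem2 T) isT isT isT S2 l hl).
have S4 l : (l < 10)%N -> tconf P4 l = crem3 2 3 7 (crem3 4 5 6 (crem2 T)) l.
  have n : br (tconf P3 2) (tconf P3 3) (tconf P3 7) != 0.
    by rewrite (S3 2 isT) (S3 3 isT) (S3 7 isT); exact: n4.
  move=> hl; rewrite (@cremonaE 2 3 7 P3 l isT isT isT hl n).
  exact: (@crem3_ext 2 3 7 (tconf P3) (crem3 4 5 6 (crem2 T)) isT isT isT S3 l hl).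
have S5 l : (l < 10)%N -> tconf P5 l = crem3 0 1 7 (crem3 2 3 7 (crem3 4 5 6 (crem2 T))) l.
  have n : br (tconf P4 0) (tconf P4 1) (tconf P4 7) != 0.
    by rewrite (S4 0 isT) (S4 1 isT) (S4 7 isT); exact: n5.
  move=> hl; rewrite (@cremonaE 0 1 7 P4 l isT isT isT hl n).
  exact: (@crem3_ext 0 1 7 (tconf P4) (crem3 2 3 7 (crem3 4 5 6 (crem2 T))) isT isT isT S4 l hl).
have ET : T89 P = swap (o10 7) (o10 8) P5 by [].
have ST l : (l < 10)%N -> tconf (T89 P) l = tconf P5 (swp l).
  move=> hl; rewrite ET; move: P5 {S5 ET} => P5; rewrite /tconf /swap -[inord l]/(o10 l) /swp.
  case: (l =P 7) => [->|/eqP n7]; first by rewrite tpermL.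
  case: (l =P 8) => [->|/eqP n8]; first by rewrite tpermR.
  by rewrite tpermD //; rewrite eq_sym o10_eq.
have SR l : (l < 10)%N -> exists2 c : CC, c != 0 &
    tconf (replace3 P q8 q9 q10) l = tscale c (bar_config F G T (swp l)).
  move=> hl; rewrite /tconf /replace3 -[inord l]/(o10 l) !o10_eq // /swp /bar_config.
  case: (l =P 7) => [_|/eqP l7]; first by exists k8; rewrite // E8 tri_ofZ vec_ofK.
  case: (l =P 8) => [_|/eqP l8]; first by exists k9; rewrite // E9 tri_ofZ vec_ofK.
  rewrite (negbTE l7) (negbTE l8).
  case: (l =P 9) => [_|/eqP l9]; first by exists k10; rewrite // E10 tri_ofZ vec_ofK.
  by exists 1; rewrite ?oner_neq0 // one.
have [m0 [m1 [m2 [hm H]]]] := X5; exists m0, m1, m2; split=> // l hl.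
have hs : (swp l < 10)%N by rewrite /swp; case: ifP => // _; case: ifP.
have [c c0 Ec] := H _ hs; have [e e0 Ee] := SR l hl.
exists (e * c); first by rewrite mulf_neq0.
by rewrite Ee Ec ST // S5 // tt.
Qed.

Lemma bar_conditions_proj_eq q8 q9 q10 q8' q9' q10' :
  bar_conditions P C0 C q8 q9 q10 -> bar_conditions P C0 C q8' q9' q10' ->
  [/\ proj_eq q8 q8', proj_eq q9 q9' & proj_eq q10 q10'].
Proof.
have pe (k k' : CC) u : u != (0, 0, 0) -> k != 0 -> k' != 0 ->
    proj_eq (k *: vec_of u) (k' *: vec_of u).
  move=> u0 k0 k0'; split; first by rewrite scaler_eq0 negb_or k0 vec_of_neq0.
  exists (k' / k); split; first by rewrite mulf_neq0 ?invr_neq0.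
  by rewrite scalerA divfK.
move=> /bar_unique [k8 [k9 [k10 [[? ? ?] -> -> ->]]]].
by move=> /bar_unique [k8' [k9' [k10' [[? ? ?] -> -> ->]]]]; split; apply: pe.
Qed.

Lemma bar_conditions_T89 q8 q9 q10 : bar_conditions P C0 C q8 q9 q10 ->
  X_eq (T89 P) (replace3 P q8 q9 q10) /\
  (forall x : vec3, x != 0 ->
     (ev C0 x = 0 /\ ev C x = 0 <-> exists l : 'I_9, proj_eq (nine P q9 l) x)).
Proof.
move=> /bar_unique [k8 [k9 [k10 [[h8 h9 h10] E8 E9 E10]]]]; split.
  exact: (T89_bar h8 h9 h10).
exact: (common_zeros h9).
Qed.
End Main.

Theorem theorem6 :
  exists F : {mpoly CC[30]}, F != 0 /\
  forall (P : config) (C0 C : tform),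
    general_position P -> F.@[flat P] != 0 ->
    smooth_cubic C0 -> smooth_cubic C ->
    (forall l : 'I_10, (l <= 8)%N -> on_curve C0 (P l)) ->
    (forall l : 'I_10, (l <= 7)%N \/ l = o10 9 -> on_curve C (P l)) ->
    (exists pb8 pb9 qb, bar_conditions P C0 C pb8 pb9 qb) /\
    (forall pb8 pb9 qb pb8' pb9' qb',
        bar_conditions P C0 C pb8 pb9 qb ->
        bar_conditions P C0 C pb8' pb9' qb' ->
        [/\ proj_eq pb8 pb8', proj_eq pb9 pb9' & proj_eq qb qb']) /\
    (forall pb8 pb9 qb, bar_conditions P C0 C pb8 pb9 qb ->
        X_eq (T89 P) (replace3 P pb8 pb9 qb) /\
        (forall x : vec3, x != 0 ->
           (ev C0 x = 0 /\ ev C x = 0 <-> exists l : 'I_9, proj_eq (nine P pb9 l) x))).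
Proof.
exists generic_poly; split; first exact: generic_poly_neq0.
move=> P C0 C gpos gen [cub0 _] [cub _] on0 on1.
split; first by do 3 eexists; exact: (bar_exists gpos gen cub0 cub on0 on1).
split; first exact: (bar_conditions_proj_eq gpos gen cub0 cub on0 on1).
exact: (bar_conditions_T89 gpos gen cub0 cub on0 on1).
Qed.
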